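(* Let $G=(V,E)$ be the 1-skeleton of a triangulation of the 2-sphere $\mathbb{S}^2$, and let $\Theta:E\to[0,\pi)$. Suppose that $\mathcal{C}=\{D_v\}_{v\in V}$ and $\tilde{\mathcal{C}}=\{\tilde D_v\}_{v\in V}$ are thin disk configurations in $\hat{\mathbb{C}}$ realizing the same incidence data $(G,\Theta)$. Then $\mathcal{C}$ and $\tilde{\mathcal{C}}$ differ by a Möbius or an anti-Möbius transformation; that is, there is such a transformation $T$ with $T(D_v)=\tilde D_v$ for all $v\in V$.
   Context: $\hat{\mathbb{C}}$ is the Riemann sphere with its usual constant curvature $+1$ metric. An anti-Möbius transformation is the composition of a Möbius transformation with $z\mapsto\bar z$. A triangulation of a topological surface $S$ is a collection of triangular faces, each a topological closed disk, so that two given faces are glued either along a single edge, or at a single vertex, or not at all, and with no gluings along the boundary of any one fixed triangle, such that the resulting object is homeomorphic to $S$. Its 1-skeleton is the graph formed by its vertices and edges. A disk configuration is a collection of metric closed disks (of positive radius) in $\hat{\mathbb{C}}$ such that no disk of the collection is contained in any other. It is thin if no three disks of it have a common point. The contact graph of a disk configuration has a vertex for every disk, two vertices sharing an edge if and only if the corresponding disks meet. For two closed disks $A,B$ which meet, neither containing the other, the external intersection angle (overlap angle) $\measuredangle(A,B)$ is the angle, at a point of $\partial A\cap\partial B$, of the exterior sector (the complement of $A\cup B$ near that point) bounded by the two arcs $\partial A\setminus B$ and $\partial B\setminus A$; it is $0$ if $A$ and $B$ are externally tangent. A disk configuration $\{D_v\}_{v\in V}$ realizes the incidence data $(G,\Theta)$,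 $G=(V,E)$, $\Theta:E\to[0,\pi)$, if $G$ is its contact graph (with $v$ corresponding to $D_v$) and $\measuredangle(D_u,D_v)$ is defined and equals $\Theta\langle u,v\rangle$ for every edge $\langle u,v\rangle$ of $G$. *)

(* Defs.v *)
From HB Require Import structures.
From mathcomp Require Import all_boot all_order all_algebra.
From mathcomp Require Import all_classical all_reals all_analysis.
From mathcomp Require Import complex.

Set Implicit Arguments.
Unset Strict Implicit.
Unset Printing Implicit Defensive.

Import Order.TTheory GRing.Theory Num.Theory.
Import numFieldNormedType.Exports.

Local Open Scope classical_set_scope.
Local Open Scope ring_scope.

Section Sphere.
Context {R : realType}.

Definition dot (u v : 'rV[R]_3) : R := \sum_(i < 3) u 0 i * v 0 i.

Definition unit_sphere : set 'rV[R]_3 := [set u | dot u u = 1].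

End Sphere.

Section RiemannSphere.
Context {R : realType}.

(* [None] is the point at infinity. *)
Definition riemann_sphere : Type := option R[i].

(* Inverse stereographic projection onto the unit sphere, from the north
   pole (0, 0, 1).  The curvature +1 metric 4 |dz|^2 / (1 + |z|^2)^2 is the
   pull-back of the round metric of the unit sphere under this map. *)
Definition stereo (z : riemann_sphere) : 'rV[R]_3 :=
  if z is Some w then
    let n := complex.Re w ^+ 2 + complex.Im w ^+ 2 in
    \row_(k < 3) nth 0 [:: 2 * complex.Re w / (n + 1); 2 * complex.Im w / (n + 1);
                           (n - 1) / (n + 1)] k
  else \row_(k < 3) nth 0 [:: 0; 0; 1] k.

(* Great-circle distance. *)
Definition sdist (z w : riemann_sphere) : R := acos (dot (stereo z) (stereo w)).

(* When c = 0 the value at infinity is infinity; when c z + d = 0 the value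
   at z is infinity. *)
Definition moebius_map (a b c d : R[i]) (z : riemann_sphere) : riemann_sphere :=
  if z is Some w then
    if c * w + d == 0 then None else Some ((a * w + b) / (c * w + d))
  else if c == 0 then None else Some (a / c).

Definition is_moebius (T : riemann_sphere -> riemann_sphere) : Prop :=
  exists a b c d : R[i], a * d - b * c != 0 /\ T = moebius_map a b c d.

Definition sphere_conj (z : riemann_sphere) : riemann_sphere :=
  omap (fun w : R[i] => Complex (complex.Re w) (- complex.Im w)) z.

Definition is_anti_moebius (T : riemann_sphere -> riemann_sphere) : Prop :=
  exists2 M, is_moebius M & T = M \o sphere_conj.

End RiemannSphere.
Arguments riemann_sphere : clear implicits.

Section Disks.
Context {R : realType}.

Record disk := Disk {
  center : riemann_sphere R;
  radius : R;
  radius_gt0 : 0 < radius }.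

Definition disk_set (A : disk) : set (riemann_sphere R) :=
  [set z | sdist (center A) z <= radius A].

Definition disk_boundary (A : disk) : set (riemann_sphere R) :=
  [set z | sdist (center A) z = radius A].

Definition disks_meet (A B : disk) : Prop := disk_set A `&` disk_set B !=set0.

Definition externally_tangent (A B : disk) : Prop :=
  exists p, disk_set A `&` disk_set B = [set p].

(* [t] is the unit tangent vector at [p] to the circle bounding [A], in the
   direction in which this circle leaves [B], i.e., the initial direction of
   the arc of the boundary of [A] lying outside [B].  With c the centre of a
   disk, the distance to c is a decreasing function of the inner product with
   c: so the vectors tangent to the boundary of [A] at [p] are those orthogonal
   to both [p] and the centre of [A], and a tangent vector points out of [B]
   when its inner product with the centre of [B] is negative.  There is no such
   [t] when the two boundary circles are tangent at [p]. *)
Definition leaving_tangent (A B : disk) (p : riemann_sphere R) (t : 'rV[R]_3) :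
    Prop :=
  [/\ dot t t = 1,
      dot t (stereo p) = 0,
      dot t (stereo (center A)) = 0 &
      dot t (stereo (center B)) < 0].

(* "The external intersection angle of [A] and [B] is defined and equal to
   [theta]".  When the boundary circles cross at [p], the exterior sector at
   [p] is bounded by the initial directions of the two arcs (boundary of [A])
   minus [B] and (boundary of [B]) minus [A]; it is convex, so that its angle
   is the angle between these two directions.  The angle is undefined if the
   disks overlap and their boundary circles do not cross. *)
Definition external_angle (A B : disk) (theta : R) : Prop :=
  (externally_tangent A B /\ theta = 0) \/
  (exists p tA tB,
    [/\ disk_boundary A p, disk_boundary B p,
        leaving_tangent A B p tA, leaving_tangent B A p tB &
        theta = acos (dot tA tB)]).

Context {V : finType}.
Implicit Types D : V -> disk.

Definition disk_configuration D : Prop :=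
  forall u v, u != v -> ~ (disk_set (D u) `<=` disk_set (D v)).

Definition thin D : Prop :=
  forall u v w, u != v -> u != w -> v != w ->
    disk_set (D u) `&` disk_set (D v) `&` disk_set (D w) = set0.

(* Edges are represented as two-element sets of vertices. *)
Definition is_contact_graph (E : {set {set V}}) D : Prop :=
  forall u v, u != v -> ([set u; v]%SET \in E <-> disks_meet (D u) (D v)).

(* Only the values of [Theta] on [E] matter. *)
Definition realizes (E : {set {set V}}) (Theta : {set V} -> R) D : Prop :=
  is_contact_graph E D /\
  forall u v, [set u; v]%SET \in E ->
    external_angle (D u) (D v) (Theta [set u; v]%SET).

End Disks.
Arguments disk : clear implicits.

Definition homeomorphic (X Y : topologicalType) (A : set X) (B : set Y) : Prop :=
  exists (f : X -> Y) (g : Y -> X),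
    [/\ {within A, continuous f}, {within B, continuous g},
        (forall x, A x -> B (f x) /\ g (f x) = x) &
        (forall y, B y -> A (g y) /\ f (g y) = y)].

Section Triangulations.
Context (R : realType) {V : finType}.

(* A family of triangles is given by the set [F] of its triples of vertices;
   its geometric realization is described by barycentric coordinates. *)
Definition realization (F : {set {set V}}) : set {ptws V -> R} :=
  [set x | [/\ forall v, 0 <= x v,
               \sum_v x v = 1 &
               exists2 f, f \in F & forall v, v \notin f -> x v = 0]].

(* Two distinct triples meet in at most two vertices, so two distinct faces
   share exactly an edge, exactly a vertex, or nothing, and the three sides
   and three corners of a face are distinct.  Finiteness is no restriction, by
   compactness of the sphere. *)
Definition sphere_triangulation (F : {set {set V}}) : Prop :=
  [/\ forall f, f \in F -> #|f| = 3%N,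
      finset.cover F = [set: V]%SET &
      homeomorphic (realization F) (@unit_sphere R)].

Definition skeleton_edges (F : {set {set V}}) : {set {set V}} :=
  [set e : {set V} | (#|e| == 2) && [exists f in F, e \subset f]]%SET.

End Triangulations.

(* Main.v *)
From mathcomp Require Import all_boot all_order all_algebra.
From mathcomp Require Import all_classical all_reals all_analysis.
From mathcomp Require Import complex ring lra.
Require Import Defs.

Set Implicit Arguments.
Unset Strict Implicit.
Unset Printing Implicit Defensive.

Import Order.TTheory GRing.Theory Num.Theory.
Import numFieldNormedType.Exports.

Local Open Scope classical_set_scope.
Local Open Scope ring_scope.

(** A disk is the negative set of a vector [n] of norm -1 in Minkowski space,
    and the cosine of an overlap angle is the product of two such vectors.  As
    the configuration is thin, three disks of a face are orthogonal to a common
    circle, and the graph minus a face is connected (a compact contractible set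
    does not separate the sphere); these two facts force the faces of the
    triangulation to be the facets of the convex hull of the vectors [n].  Fix a
    face and move a point of its empty interstice to infinity so that its three
    disks get equal radii.  In this chart the other faces at a vertex [v] outside
    the fixed one close up around [v], hence their angles add up to [2 pi].  The
    angles are given by the radii and the overlap angles, and thinness makes
    them strictly monotone in the radii.  So the ratio of the radii in the two
    configurations satisfies a maximum principle; it is 1 on the fixed face, so
    the radii agree, the centres differ by an isometry of the plane, and the two
    configurations by a Moebius or an anti-Moebius transformation. *)

(** * The circle and the plane *)

Section Circle.
Context {R : realType}.

(** The topology of the sphere is used only through [tight_complex]: a side of a face lies in a
    second face, and the graph without a face is connected. That the link of a vertex is a cycle is
    not among these facts; it comes out of the geometry, because in the chart no neighbour lies in
    the sector of a face, so that turning to the next neighbour is a permutation whose orbit makes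
    exactly one turn. Both facts rest on one separation statement, applied to an arc and to a face,
    and proved by lifting angles instead of by homology. Overlap angles may be obtuse, so the
    products [e u v] may be negative. What replaces their positivity is [0 < e u w + e u v * e v w],
    the form in which thinness yields both the point sent to infinity and the monotonicity of the
    angles. That point is taken beyond the fixed face and on the inner side of all others: hence
    every disk is bounded in the chart, and only the fixed face is exempt from the sector
    conditions. *)

Lemma polar_unit (c s : R) : c ^+ 2 + s ^+ 2 = 1 ->
  exists t, [/\ 0 <= t, t < pi *+ 2, c = cos t & s = sin t].
Proof.
move=> cs1.
have c1 : -1 <= c <= 1.
  rewrite -ler_norml -(@ler_pXn2r _ 2) ?nnegrE// expr1n real_normK ?num_real//.
  by rewrite -cs1 lerDl sqr_ge0.
have ce : cos (acos c) = c by rewrite acosK// in_itv.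
have se : sin (acos c) = `|s|.
  by rewrite sin_acos// -cs1 addrC addKr sqrtr_sqr.
have a0 := acos_ge0 c1; have api := acos_lepi c1.
have pi0 : 0 < (pi : R) := pi_gt0 R.
have [s0|s0] := leP 0 s.
  exists (acos c); split => //; last by rewrite se ger0_norm.
  rewrite (le_lt_trans api)// mulr2n; lra.
exists (pi *+ 2 - acos c); split => //.
- by rewrite mulr2n; lra.
- rewrite ltrBlDr ltrDl lt_neqAle a0 andbT; apply/eqP => h.
  by move: se; rewrite -h sin0 => /esym/normr0P/eqP; lra.
- by rewrite addrC cosD2pi cosN ce.
- by rewrite addrC sinD2pi sinN se ltr0_norm// opprK.
Qed.

(* [atan (X / D)] is the signed angle between two unit vectors of positive inner product [D] and determinant [X]. *)
Lemma atan_turn (t c2 s2 : R) : c2 ^+ 2 + s2 ^+ 2 = 1 ->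
  0 < cos t * c2 + sin t * s2 ->
  let a := t + atan ((cos t * s2 - sin t * c2) / (cos t * c2 + sin t * s2)) in
  cos a = c2 /\ sin a = s2.
Proof.
move=> h2 D0 /=; have h1 := cos2Dsin2 t.
set c1 := cos t in h1 D0 *; set s1 := sin t in h1 D0 *.
set D := c1 * c2 + s1 * s2 in D0 *; set X := c1 * s2 - s1 * c2.
have XD : D ^+ 2 + X ^+ 2 = 1.
  by transitivity ((c1 ^+ 2 + s1 ^+ 2) * (c2 ^+ 2 + s2 ^+ 2));
    [rewrite /D /X; ring | rewrite h1 h2 mulr1].
have D0' : D != 0 by rewrite gt_eqF.
have e1 : 1 + (X / D) ^+ 2 = (D^-1) ^+ 2.
  by transitivity ((D ^+ 2 + X ^+ 2) / D ^+ 2); [field | rewrite XD exprVn mul1r].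
have ca : cos (atan (X / D)) = D.
  by rewrite cos_atan e1 sqrtr_sqr ger0_norm ?invr_ge0 ?ltW// invrK.
have sa : sin (atan (X / D)) = X.
  have /(congr1 (fun x => x * D)) := atanK (X / D).
  by rewrite /tan ca divfK// divfK.
rewrite cosD sinD ca sa -/c1 -/s1; split.
  transitivity ((c1 ^+ 2 + s1 ^+ 2) * c2); [rewrite /D /X; ring | by rewrite h1 mul1r].
transitivity ((c1 ^+ 2 + s1 ^+ 2) * s2); [rewrite /D /X; ring | by rewrite h1 mul1r].
Qed.

End Circle.

Section ContOn.
(** Pointwise form of continuity for the subspace topology ([subspace_continuousP]); it composes
    along maps between sets without changing the types. *)
Definition cont_on {T U : topologicalType} (K : set T) (f : T -> U) :=
  forall x, K x -> f y @[y --> within K (nbhs x)] --> f x.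

Lemma cont_on_comp {T U V : topologicalType} (K : set T) (L : set U) (f : T -> U) (g : U -> V) :
  cont_on K f -> (forall x, K x -> L (f x)) -> cont_on L g -> cont_on K (g \o f).
Proof.
move=> cf KL cg x Kx A gA.
have : nbhs x (fun y => K y -> (fun y => L y -> A (g y)) (f y)) := cf x Kx _ (cg _ (KL _ Kx) _ gA).
by rewrite /fmap/= /within/=; apply: filterS => y + Ky; apply => //; exact: KL.
Qed.

Lemma continuous_cont_on {T U : topologicalType} (K : set T) (f : T -> U) :
  continuous f -> cont_on K f.
Proof. by move=> cf x _; apply: cvg_within_filter; exact: cf. Qed.

Lemma cont_onT {T U : topologicalType} (f : T -> U) : cont_on setT f -> continuous f.
Proof.
move=> h x A fA; have hx : nbhs x (fun y => setT y -> A (f y)) := h x I A fA.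
by apply: filterS hx => y; exact.
Qed.

End ContOn.

Section Lift.
Context {R : realType}.

(** Both unit vectors are within 1/2 of [(c0, s0)] in each coordinate, so their squared distance is
    less than 2. *)
Lemma unit_dot_gt0 (c1 s1 c2 s2 c0 s0 : R) :
  c1 ^+ 2 + s1 ^+ 2 = 1 -> c2 ^+ 2 + s2 ^+ 2 = 1 ->
  `|c0 - c1| < 2^-1 -> `|s0 - s1| < 2^-1 -> `|c0 - c2| < 2^-1 -> `|s0 - s2| < 2^-1 ->
  0 < c1 * c2 + s1 * s2.
Proof.
move=> h1 h2; rewrite !ltr_norml => /andP[? ?] /andP[? ?] /andP[? ?] /andP[? ?].
have a : (c1 - c2) ^+ 2 < 1 by nra.
have b : (s1 - s2) ^+ 2 < 1 by nra.
nra.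
Qed.

(* A continuous map to the circle from a compact contractible set has a
   continuous angle: cut the contraction into steps so short that the image
   turns by less than a quarter turn along each of them, and add up the turns. *)
Lemma circle_lift (T : topologicalType) (K : set T) (H : T -> R -> T) (a : T) (c s : T -> R) :
  compact K -> K a -> continuous (fun y : T * R => H y.1 y.2) ->
  (forall x t, K x -> 0 <= t <= 1 -> K (H x t)) ->
  (forall x, K x -> H x 0 = a) -> (forall x, K x -> H x 1 = x) ->
  cont_on K c -> cont_on K s -> (forall x, K x -> c x ^+ 2 + s x ^+ 2 = 1) ->
  exists th : T -> R, cont_on K th /\ forall x, K x -> c x = cos (th x) /\ s x = sin (th x).
Proof.
move=> cK Ka cH HK H0 H1 cc cs cs1.
have cHt t : continuous (H^~ t).
  move=> x; apply: (cvg_comp (fun y : T => (y, t)) (fun y => H y.1 y.2)); last exact: (cH (x, t)).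
  exact: cvg_pair cvg_id (cvg_cst _).
have KI : compact (K `*` `[0, 1 : R]) by apply: compact_setX => //; exact: segment_compact.
have cHK (f : T -> R) : cont_on K f -> cont_on (K `*` `[0, 1 : R]) (fun y => f (H y.1 y.2)).
  move=> cf; apply: (@cont_on_comp _ _ _ _ K (fun y : T * R => H y.1 y.2)) => //.
    exact: continuous_cont_on.
  by move=> [x t] [/= Kx]; rewrite in_itv/= => t01; exact: HK.
(* Uniform continuity in time: by compactness of [K] times the unit interval one [d] works for all
   points, and over times less than [d] apart the direction turns by less than a quarter turn. *)
have [d [d0 hd]] : exists d : R, 0 < d /\ forall y t u, K y -> 0 <= t <= 1 -> 0 <= u <= 1 ->
    `|t - u| < d -> 0 < c (H y t) * c (H y u) + s (H y t) * s (H y u).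
  have : \forall d \near 0^'+, K `*` `[0, 1 : R] `<=` (fun y => forall u : R, 0 <= u <= 1 -> `|y.2 - u| < d ->
     0 < c (H y.1 y.2) * c (H y.1 u) + s (H y.1 y.2) * s (H y.1 u)).
    have /compact_near_coveringP/near_covering_withinP := KI.
    apply => -[x t] [/= Kx]; rewrite in_itv/= => t01.
    have xt : (K `*` `[0, 1 : R]) (x, t) by split => //=; rewrite in_itv.
    have hc : \forall z \near (x, t), (K `*` `[0, 1 : R]) z -> `|c (H x t) - c (H z.1 z.2)| < 2^-1.
      have /cvgrPdist_lt := cHK c cc _ xt; apply; by rewrite invr_gt0.
    have hs : \forall z \near (x, t), (K `*` `[0, 1 : R]) z -> `|s (H x t) - s (H z.1 z.2)| < 2^-1.
      have /cvgrPdist_lt := cHK s cs _ xt; apply; by rewrite invr_gt0.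
    have [[A B] [/= Ax Bt] AB] := filterI hc hs.
    have [e /= e0 eB] : nbhs_ball t B by apply/nbhs_ballP.
    have Bt' : nbhs t (ball t (e / 2)) by apply: nbhsx_ballx; rewrite divr_gt0.
    exists (A `*` ball t (e / 2), [set d | d < e / 2]) => /=.
      split; first by exists (A, ball t (e/2)).
      by apply: nbhs_right_lt; rewrite divr_gt0.
    move=> [[y t'] d] [/= [Ay tt'] de] [/= Ky]; rewrite in_itv/= => t'01 u u01 tu.
    have Bt1 : B t' by apply: eB; apply: le_ball tt'; rewrite ler_pdivrMr// ler_pMr// ler1n.
    have Bu : B u.
      apply: eB; rewrite (splitr e); apply: ball_triangle tt' _.
      by rewrite /ball/= (lt_trans tu de).
    have [/= h1 h2] := AB (y, t') (conj Ay Bt1).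
    have [/= h3 h4] := AB (y, u) (conj Ay Bu).
    have k1 : (K `*` `[0, 1 : R]) (y, t') by split => //=; rewrite in_itv.
    have k2 : (K `*` `[0, 1 : R]) (y, u) by split => //=; rewrite in_itv.
    exact: (unit_dot_gt0 (cs1 _ (HK _ _ Ky t'01)) (cs1 _ (HK _ _ Ky u01)) (h1 k1) (h2 k1) (h3 k2) (h4 k2)).
  move=> h; near (0 : R)^'+ => d; exists d; split => //.
  have hd : K `*` `[0, 1 : R] `<=` (fun y => forall u : R, 0 <= u <= 1 -> `|y.2 - u| < d ->
     0 < c (H y.1 y.2) * c (H y.1 u) + s (H y.1 y.2) * s (H y.1 u)) by near: d.
  by move=> y t u Ky t01; apply: (hd (y, t)); split => //=; rewrite in_itv.
have [n nd] : exists n : nat, n.+1%:R^-1 < d.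
  by have [n _ /(_ n (leqnn n))] := near_infty_natSinv_lt (PosNum d0); exists n.
pose q j : R := j%:R / n.+1%:R.
have q01 j : (j <= n.+1)%N -> 0 <= q j <= 1.
  by move=> jn; rewrite divr_ge0//= ler_pdivrMr ?ltr0n// mul1r ler_nat.
have qS j : `|q j - q j.+1| < d.
  rewrite /q -mulrBl -natr1 opprD addrA subrr sub0r mulN1r normrN.
  by rewrite gtr0_norm ?invr_gt0.
(* All paths start at [a], so a single angle there is a common initial value for the lifts, which
   makes the base of the induction for continuity trivial. *)
have [t0 [_ _ ct0 st0]] := polar_unit (cs1 a Ka).
pose D x j := c (H x (q j)) * c (H x (q j.+1)) + s (H x (q j)) * s (H x (q j.+1)).
pose X x j := c (H x (q j)) * s (H x (q j.+1)) - s (H x (q j)) * c (H x (q j.+1)).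
pose th k x := iteri k (fun j t => t + atan (X x j / D x j)) t0.
have D0 x j : K x -> (j < n.+1)%N -> 0 < D x j.
  by move=> Kx jn; apply: hd => //; apply: q01 => //; exact: ltnW.
have thE k x : (k <= n.+1)%N -> K x -> cos (th k x) = c (H x (q k)) /\ sin (th k x) = s (H x (q k)).
  elim: k => [_ Kx|k IH kn Kx]; first by rewrite /th/= /q mul0r H0.
  have [IHc IHs] := IH (ltnW kn) Kx.
  have := D0 x k Kx kn; rewrite /th/= -/(th k x) /X /D -IHc -IHs.
  apply: atan_turn; apply: cs1; apply: HK => //; exact: q01.
have chq (f : T -> R) j : cont_on K f -> (j <= n.+1)%N -> cont_on K (fun x => f (H x (q j))).
  move=> cf jn; apply: (@cont_on_comp _ _ _ _ K (H^~ (q j))) => //.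
    exact: continuous_cont_on.
  by move=> x Kx; apply: HK => //; exact: q01.
have cth k : (k <= n.+1)%N -> cont_on K (th k).
  elim: k => [_ x Kx|k IH kn x Kx]; first exact: cvg_cst.
  rewrite /th/= -/(th k x); apply: cvgD; first exact: (IH (ltnW kn) x Kx).
  apply: (cvg_comp _ (@atan R)); last exact: continuous_atan.
  apply: cvgM; last apply: cvgV.
  - apply: cvgB; apply: cvgM; by [apply: (chq c _ cc) => //; exact: ltnW | apply: (chq s _ cs) => //; exact: ltnW].
  - by rewrite gt_eqF// D0.
  - apply: cvgD; apply: cvgM; by [apply: (chq c _ cc) => //; exact: ltnW | apply: (chq s _ cs) => //; exact: ltnW].
exists (th n.+1); split; first exact: cth.
move=> x Kx; have [-> ->] := thE n.+1 x (leqnn _) Kx.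
by rewrite /q divff ?pnatr_eq0// H1.
Unshelve. all: by end_near. Qed.

End Lift.

(** * Non-separation in the plane *)

Section Plane.
Context {R : realType}.
Implicit Types z : R * R.

Definition pdist (a z : R * R) : R := Num.sqrt ((z.1 - a.1) ^+ 2 + (z.2 - a.2) ^+ 2).

Lemma pdist_gt0 (a z : R * R) : z <> a -> 0 < pdist a z.
Proof.
move=> za; rewrite sqrtr_gt0 lt_neqAle addr_ge0 ?sqr_ge0// andbT eq_sym.
rewrite paddr_eq0 ?sqr_ge0// !sqrf_eq0 !subr_eq0; apply/negP => /andP[/eqP e1 /eqP e2].
by apply: za; case: z a e1 e2 => [? ?] [? ?] /= -> ->.
Qed.

Lemma pdist_unit (a z : R * R) : z <> a ->
  ((z.1 - a.1) / pdist a z) ^+ 2 + ((z.2 - a.2) / pdist a z) ^+ 2 = 1.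
Proof.
move=> za; rewrite !expr_div_n -mulrDl sqr_sqrtr ?addr_ge0 ?sqr_ge0// divff//.
rewrite -[X in X != 0]sqr_sqrtr ?addr_ge0 ?sqr_ge0// sqrf_eq0.
by rewrite gt_eqF//; exact: pdist_gt0.
Qed.

Lemma cvg_if {T : Type} (F : set_system T) {FF : Filter F} (P : T -> bool) (f g : T -> R) (l : R) :
  f x @[x --> F] --> l -> g x @[x --> F] --> l -> (if P x then f x else g x) @[x --> F] --> l.
Proof.
move=> /cvgrPdist_lt hf /cvgrPdist_lt hg; apply/cvgrPdist_lt => e e0.
by move: (hf e e0) (hg e e0); apply: filterS2 => x; case: (P x).
Qed.

Lemma continuous_pdist (a : R * R) : continuous (pdist a).
Proof.
move=> z; apply: continuous_comp; last exact: sqrt_continuous.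
by apply: cvgD; apply: cvgM; apply: cvgB; (exact: cvg_cst) || (exact: cvg_fst) || (exact: cvg_snd).
Qed.

Lemma continuous_dir1 (a z : R * R) : z <> a ->
  {for z, continuous (fun z => (z.1 - a.1) / pdist a z)}.
Proof.
move=> za; apply: cvgM; first by apply: cvgB; [exact: cvg_fst | exact: cvg_cst].
by apply: cvgV; [rewrite gt_eqF ?pdist_gt0 | exact: continuous_pdist].
Qed.

Lemma continuous_dir2 (a z : R * R) : z <> a ->
  {for z, continuous (fun z => (z.2 - a.2) / pdist a z)}.
Proof.
move=> za; apply: cvgM; first by apply: cvgB; [exact: cvg_snd | exact: cvg_cst].
by apply: cvgV; [rewrite gt_eqF ?pdist_gt0 | exact: continuous_pdist].
Qed.

Lemma compact_disc (a : R * R) (r : R) : compact [set z | pdist a z <= r].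
Proof.
apply: (@subclosed_compact _ _ ((`[a.1 - r, a.1 + r] : set R) `*` `[a.2 - r, a.2 + r])).
- have := @closed_comp _ _ (pdist a) [set x | x <= r] (fun z _ => @continuous_pdist a z).
  by apply; exact: closed_le.
- by apply: compact_setX; exact: segment_compact.
- move=> z /= h; have r0 : 0 <= r by rewrite (le_trans _ h)// sqrtr_ge0.
  have h2 : (z.1 - a.1) ^+ 2 + (z.2 - a.2) ^+ 2 <= r ^+ 2.
    by rewrite -(@sqr_sqrtr _ (_ + _)) ?addr_ge0 ?sqr_ge0// ler_pXn2r ?nnegrE ?sqrtr_ge0.
  rewrite /= !in_itv/=; split.
    have : `|z.1 - a.1| <= r.
      rewrite -(@ler_pXn2r _ 2) ?nnegrE// real_normK ?num_real//.
      by apply: le_trans h2; rewrite lerDl sqr_ge0.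
    by rewrite ler_norml; lra.
  have : `|z.2 - a.2| <= r.
    rewrite -(@ler_pXn2r _ 2) ?nnegrE// real_normK ?num_real//.
    by apply: le_trans h2; rewrite lerDr sqr_ge0.
  by rewrite ler_norml; lra.
Qed.

(** The field has a continuous angle on the disc. Along the boundary circle this angle minus the
    parameter has cosine 1 throughout, but it drops by [2 pi] in one turn; halfway, by the
    intermediate value theorem, its cosine would be -1. *)
Lemma no_radial_field (a : R * R) (r : R) (c s : R * R -> R) : 0 < r ->
  continuous c -> continuous s -> (forall z, c z ^+ 2 + s z ^+ 2 = 1) ->
  (forall z, pdist a z = r -> c z = (z.1 - a.1) / r /\ s z = (z.2 - a.2) / r) -> False.
Proof.
move=> r0 cc cs cs1 bd.
pose H (x : R * R) (t : R) : R * R := (a.1 + t * (x.1 - a.1), a.2 + t * (x.2 - a.2)).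
have paa : pdist a a = 0 by rewrite /pdist !subrr expr0n addr0 sqrtr0.
have [||||||||th [cth thE]] := @circle_lift R _ [set z | pdist a z <= r] H a c s (@compact_disc a r).
- by rewrite /= paa ltW.
- move=> y.
  have c1 : (a.1 + z.2 * (z.1.1 - a.1)) @[z --> y] --> (a.1 + y.2 * (y.1.1 - a.1)).
    apply: cvgD; first exact: cvg_cst.
    apply: cvgM; first exact: cvg_snd.
    apply: cvgB; last exact: cvg_cst.
    by apply: (cvg_comp fst); exact: cvg_fst.
  have c2 : (a.2 + z.2 * (z.1.2 - a.2)) @[z --> y] --> (a.2 + y.2 * (y.1.2 - a.2)).
    apply: cvgD; first exact: cvg_cst.
    apply: cvgM; first exact: cvg_snd.
    apply: cvgB; last exact: cvg_cst.
    by apply: (cvg_comp fst); [exact: cvg_fst | exact: cvg_snd].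
  exact: cvg_pair c1 c2.
- move=> x t /= xr /andP[t0 t1]; rewrite /pdist/=.
  have e (u v : R) : u + t * (v - u) - u = t * (v - u) by rewrite addrC addKr.
  rewrite !e !exprMn -mulrDr.
  rewrite sqrtrM ?sqr_ge0// sqrtr_sqr ger0_norm// (le_trans _ xr)//.
  by rewrite ler_piMl// sqrtr_ge0.
- by move=> x _; rewrite /H !mul0r !addr0 -surjective_pairing.
- by move=> x _; rewrite /H !mul1r !subrKC -surjective_pairing.
- exact: continuous_cont_on.
- exact: continuous_cont_on.
- by move=> x _.
pose g (t : R) : R * R := (a.1 + r * cos t, a.2 + r * sin t).
have pg t : pdist a (g t) = r.
  rewrite /pdist/= ![_ + _ * _ - _]addrC !addKr !exprMn -mulrDr cos2Dsin2 mulr1.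
  by rewrite sqrtr_sqr gtr0_norm.
have gE t : cos (th (g t)) = cos t /\ sin (th (g t)) = sin t.
  have [] := bd _ (pg t); have [] := thE (g t) _; first by rewrite /= pg.
  move=> -> -> -> ->; rewrite /= ![_ + _ * _ - _]addrC !addKr.
  by rewrite !(mulrC r) !mulfK// gt_eqF.
have cg : continuous g.
  move=> t.
  have c1 : (a.1 + r * cos u) @[u --> t] --> (a.1 + r * cos t).
    by apply: cvgD; [exact: cvg_cst | apply: cvgM; [exact: cvg_cst | exact: continuous_cos]].
  have c2 : (a.2 + r * sin u) @[u --> t] --> (a.2 + r * sin t).
    by apply: cvgD; [exact: cvg_cst | apply: cvgM; [exact: cvg_cst | exact: continuous_sin]].
  exact: cvg_pair c1 c2.
pose phi t := th (g t) - t.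
have cphi : continuous phi.
  move=> t; apply: cvgB; last exact: cvg_id.
  apply: (@cont_onT _ _ (th \o g)).
  apply: (@cont_on_comp _ _ _ _ [set z | pdist a z <= r]) => //; first exact: continuous_cont_on.
  by move=> u _ /=; rewrite pg.
have pi0 : 0 < (pi : R) := pi_gt0 R.
have phi2 : phi (pi *+ 2) = phi 0 - pi *+ 2.
  by rewrite /phi /g cos2pi sin2pi cos0 sin0 subr0.
have cos1 t : cos (phi t) = 1.
  rewrite /phi cosB; have [-> ->] := gE t.
  by rewrite -!expr2 cos2Dsin2.
have [|||t _ tE] := @IVT R phi 0 (pi *+ 2) (phi 0 - pi).
- by rewrite mulr2n; lra.
- exact: continuous_subspaceT.
- by rewrite phi2 ge_min le_max mulr2n; apply/andP; split; apply/orP; [right | left]; lra.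
have := cos1 t; rewrite tE cosB cospi sinpi cos1; lra.
Qed.

(* The angle [th] extends continuously from [K] to the plane.  Using it on [U] and the
   direction from [z0] elsewhere gives a continuous field of unit vectors which is
   radial far away. *)
Lemma plane_nonsep (U W K : set (R * R)) (z0 : R * R) (rho M : R) (th : R * R -> R) :
  open U -> open W -> closed K -> (forall z, U z \/ W z \/ K z) ->
  U `&` W = set0 -> U `&` K = set0 -> U z0 -> 0 < rho ->
  (forall z, rho <= pdist z0 z -> W z) ->
  cont_on K th -> 0 < M -> (forall z, K z -> `|th z| <= M) ->
  (forall z, K z -> cos (th z) = (z.1 - z0.1) / pdist z0 z /\ sin (th z) = (z.2 - z0.2) / pdist z0 z) ->
  False.
Proof.
move=> oU oW cK cov UW UK Uz0 rho0 far cth M0 bth thE.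
(* Tietze extension, for which the angle has to be bounded on [K]. *)
have [|g [gE cg _]] := @continuous_bounded_extension (R * R)%type R pseudometric_normal K cK th M M0 _ bth.
  by apply/subspace_continuousP.
have nU z : ~ U z -> z <> z0 by move=> nU zz; apply: nU; rewrite zz.
pose c z := if `[<U z>] then cos (g z) else (z.1 - z0.1) / pdist z0 z.
pose s z := if `[<U z>] then sin (g z) else (z.2 - z0.2) / pdist z0 z.
have key (f : R -> R) (d : R * R -> R) : continuous f ->
    (forall z, z <> z0 -> {for z, continuous d}) -> (forall z, K z -> f (th z) = d z) ->
    continuous (fun z => if `[<U z>] then f (g z) else d z).
  move=> cf cd fd z.
  have cfg : f (g y) @[y --> z] --> f (g z) by apply: continuous_comp; [exact: cg | exact: cf].
  case: (cov z) => [Uz|[Wz|Kz]].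
  - rewrite /continuous_at/= asboolT//; apply: cvg_trans cfg; apply: near_eq_cvg.
    have := open_nbhs_nbhs (conj oU Uz); apply: filterS => y Uy.
    by rewrite asboolT.
  - have nUW y : W y -> ~ U y by move=> Wy Uy; have : (U `&` W) y by []; rewrite UW.
    rewrite /continuous_at/= asboolF; last exact: nUW.
    apply: cvg_trans (cd z (nU _ (nUW _ Wz))); apply: near_eq_cvg.
    have := open_nbhs_nbhs (conj oW Wz); apply: filterS => y Wy.
    by rewrite asboolF//; exact: nUW.
  - have nUz : ~ U z by move=> Uz; have : (U `&` K) z by []; rewrite UK.
    (* On [K] the extended angle gives exactly the direction from [z0], so the two branches have the
       same limit there. *)
    rewrite /continuous_at/= asboolF//; apply: cvg_if; last exact: cd (nU _ nUz).
    by rewrite -fd// gE ?inE.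
apply: (@no_radial_field z0 rho c s) => //.
- apply: key; [exact: continuous_cos | exact: continuous_dir1 | by move=> z /thE[]].
- apply: key; [exact: continuous_sin | exact: continuous_dir2 | by move=> z /thE[]].
- move=> z; rewrite /c /s; case: ifPn => [_|/asboolPn nUz]; first exact: cos2Dsin2.
  by apply: pdist_unit; exact: nU.
- move=> z zr; rewrite /c /s asboolF ?zr// => Uz.
  have : (U `&` W) z by split => //; apply: far; rewrite zr.
  by rewrite UW.
Qed.

End Plane.

(** * Separation of the sphere *)

Section Sphere3.
Context {R : realType}.

Definition o0 : 'I_3 := ord0.
Definition o1 : 'I_3 := lift ord0 ord0.
Definition o2 : 'I_3 := lift ord0 (lift ord0 ord0).

Definition mk3 (a b c : R) : 'rV[R]_3 := \row_(k < 3) nth 0 [:: a; b; c] k.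

Lemma mk3E a b c : (mk3 a b c 0 o0 = a) * (mk3 a b c 0 o1 = b) * (mk3 a b c 0 o2 = c).
Proof. by rewrite /mk3 !mxE. Qed.

Lemma ord3P (i : 'I_3) : [\/ i = o0, i = o1 | i = o2].
Proof.
case: i => [[|[|[|//]]] h]; [constructor 1 | constructor 2 | constructor 3]; exact: val_inj.
Qed.

Lemma rV3P (u v : 'rV[R]_3) : u 0 o0 = v 0 o0 -> u 0 o1 = v 0 o1 -> u 0 o2 = v 0 o2 -> u = v.
Proof. by move=> h0 h1 h2; apply/rowP => i; case: (ord3P i) => ->. Qed.

Lemma dot3 (u v : 'rV[R]_3) : dot u v = u 0 o0 * v 0 o0 + u 0 o1 * v 0 o1 + u 0 o2 * v 0 o2.
Proof. by rewrite /dot !big_ord_recl big_ord0 addr0 addrA. Qed.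

Lemma dotC (u v : 'rV[R]_3) : dot u v = dot v u.
Proof. by rewrite /dot; apply: eq_bigr => i _; rewrite mulrC. Qed.

Lemma dotBl (u v w : 'rV[R]_3) : dot (u - v) w = dot u w - dot v w.
Proof. by rewrite /dot -sumrB; apply: eq_bigr => i _; rewrite !mxE mulrBl. Qed.

Lemma dotZl (k : R) (u w : 'rV[R]_3) : dot (k *: u) w = k * dot u w.
Proof. by rewrite /dot mulr_sumr; apply: eq_bigr => i _; rewrite !mxE mulrA. Qed.

Lemma dotBr (u v w : 'rV[R]_3) : dot w (u - v) = dot w u - dot w v.
Proof. by rewrite dotC dotBl !(dotC w). Qed.

Lemma dotZr (k : R) (u w : 'rV[R]_3) : dot w (k *: u) = k * dot w u.
Proof. by rewrite dotC dotZl dotC. Qed.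

Lemma dot_eq0 (u : 'rV[R]_3) : dot u u = 0 -> u = 0.
Proof.
move=> /eqP; rewrite psumr_eq0; last by move=> i _; rewrite -expr2 sqr_ge0.
by move=> /allP h; apply/rowP => i; apply/eqP; rewrite mxE; have := h i; rewrite mem_index_enum mulf_eq0 orbb; apply.
Qed.

Lemma cvg_rV3 {T : Type} (F : set_system T) {FF : Filter F} (f : T -> 'rV[R]_3) (v : 'rV[R]_3) :
  (forall i, f x 0 i @[x --> F] --> v 0 i) -> f x @[x --> F] --> v.
Proof.
move=> h A [P vP PA]; rewrite /fmap/=.
apply: (filterS (P := (fun x => P 0 o0 (f x 0 o0)) `&` ((fun x => P 0 o1 (f x 0 o1)) `&` (fun x => P 0 o2 (f x 0 o2))))).
  move=> x [h0 [h1 h2]]; apply: PA => i j; rewrite (ord1 i).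
  by case: (ord3P j) => ->.
by apply: filterI; [|apply: filterI]; apply: h; exact: vP.
Qed.

Lemma continuous_dotl (w : 'rV[R]_3) : continuous (fun u : 'rV[R]_3 => dot u w).
Proof.
move=> u; have -> : (fun u : 'rV[R]_3 => dot u w) =
    (fun u : 'rV[R]_3 => u 0 o0 * w 0 o0 + u 0 o1 * w 0 o1 + u 0 o2 * w 0 o2).
  by apply/funext => v; rewrite dot3.
have h i : (fun v : 'rV[R]_3 => v 0 i * w 0 i) @ u --> u 0 i * w 0 i.
  by apply: (@cvgM R 'rV[R]_3 (nbhs (u : 'rV[R]_3))); [exact: coord_continuous | exact: cvg_cst].
exact: (@cvgD _ _ _ (nbhs (u : 'rV[R]_3)) _ _ _ _ _ (@cvgD _ _ _ (nbhs (u : 'rV[R]_3)) _ _ _ _ _ (h _) (h _)) (h _)).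
Qed.

(** The reflection in the plane bisecting [q] and the pole. It reduces separation on the sphere to
    the case in which a chosen point is the pole. *)
Lemma reflect_to_north (q : 'rV[R]_3) : unit_sphere q ->
  exists h : 'rV[R]_3 -> 'rV[R]_3, [/\ continuous h, forall u, h (h u) = u,
    forall u, unit_sphere u -> unit_sphere (h u) & h q = mk3 0 0 1].
Proof.
rewrite /unit_sphere/= => qq; pose w := q - mk3 0 0 1.
have [w0|w0] := eqVneq (dot w w) 0.
  exists id; split => //.
    by move=> u; exact: cvg_id.
  by apply/subr0_eq/dot_eq0.
pose h (u : 'rV[R]_3) := u - (dot u w * (2 / dot w w)) *: w.
have hE u i : h u 0 i = u 0 i - dot u w * (2 / dot w w) * w 0 i by rewrite /h !mxE.
have hw u : dot (h u) w = - dot u w.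
  rewrite /h dotBl dotZl; set e := dot u w; set k := dot w w; by field.
exists h; split.
- move=> u; have FF : Filter (nbhs (u : 'rV[R]_3)) by exact: nbhs_filter.
  apply: (@cvg_rV3 _ _ FF) => i.
  have -> : (fun x : 'rV[R]_3 => h x 0 i) = (fun x : 'rV[R]_3 => x 0 i - dot x w * (2 / dot w w) * w 0 i).
    by apply/funext => x; rewrite hE.
  rewrite hE; apply: (@cvgB _ _ _ _ FF); first exact: coord_continuous.
  apply: (@cvgM _ _ _ FF); last exact: cvg_cst.
  by apply: (@cvgM _ _ _ FF); [exact: continuous_dotl | exact: cvg_cst].
- by move=> u; apply/rowP => i; rewrite hE hw hE; ring.
- move=> u /= uu; have e1 : dot u (h u) = dot u u - dot u w * (2 / dot w w) * dot u w.
    by rewrite /h dotBr dotZr.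
  have -> : dot (h u) (h u) = dot u (h u) - dot u w * (2 / dot w w) * dot w (h u).
    by rewrite {1}/h dotBl dotZl.
  by rewrite e1 (dotC w) hw uu; set e := dot u w; set k := dot w w in w0 *; field.
- have nn : dot (mk3 0 0 1) (mk3 0 0 1) = 1 :> R by rewrite dot3 !mk3E; ring.
  have qw : dot w w = 2 * dot q w.
    rewrite /w !dotBl !dotBr nn qq (dotC (mk3 0 0 1) q); ring.
  have w0' : dot q w != 0 by apply: contraNneq w0 => e; rewrite qw e mulr0.
  rewrite /h qw (_ : _ * _ = 1) ?scale1r; first by rewrite /w opprB addrC subrK.
  by set e := dot q w in w0' *; field.
Qed.
End Sphere3.

(** * Stereographic projection between plane and sphere *)

Section Transfer.
Context {R : realType}.
Implicit Types z : R * R.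

Definition inv_stereo (z : R * R) : 'rV[R]_3 :=
  let n := z.1 ^+ 2 + z.2 ^+ 2 in
  mk3 (2 * z.1 / (n + 1)) (2 * z.2 / (n + 1)) ((n - 1) / (n + 1)).

Definition north_proj (u : 'rV[R]_3) : R * R :=
  (u 0 o0 / (1 - u 0 o2), u 0 o1 / (1 - u 0 o2)).

Lemma sqn1_gt0 (a b : R) : 0 < a ^+ 2 + b ^+ 2 + 1.
Proof. by rewrite ltr_wpDl// addr_ge0 ?sqr_ge0. Qed.

Lemma inv_stereo_sphere z : unit_sphere (inv_stereo z).
Proof.
rewrite /unit_sphere/= dot3 /inv_stereo !mk3E.
have := lt0r_neq0 (sqn1_gt0 z.1 z.2); move: z => [a b] /= n0; by field.
Qed.

Lemma inv_stereoK : cancel inv_stereo north_proj.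
Proof.
move=> [a b]; rewrite /north_proj /inv_stereo !mk3E /=.
have n0 := lt0r_neq0 (sqn1_gt0 a b).
have -> : 1 - (a ^+ 2 + b ^+ 2 - 1) / (a ^+ 2 + b ^+ 2 + 1) = 2 / (a ^+ 2 + b ^+ 2 + 1) by field.
by congr pair; field; rewrite n0.
Qed.

Lemma north_coord (u : 'rV[R]_3) : unit_sphere u -> u <> mk3 0 0 1 -> 1 - u 0 o2 != 0.
Proof.
rewrite /unit_sphere/= dot3 => uu uN; apply/eqP => h; apply: uN.
have e2 : u 0 o2 = 1 by move/subr0_eq: h.
move: uu; rewrite e2 mulr1 -!expr2 => /(congr1 (fun x => x - 1)); rewrite addrK subrr.
move/eqP; rewrite paddr_eq0 ?sqr_ge0// !sqrf_eq0 => /andP[/eqP h0 /eqP h1].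
by apply: rV3P; rewrite !mk3E.
Qed.

Lemma north_projK (u : 'rV[R]_3) : unit_sphere u -> u <> mk3 0 0 1 -> inv_stereo (north_proj u) = u.
Proof.
move=> us uN; have := north_coord us uN; move: us; rewrite /unit_sphere/= dot3.
move=> us w1.
have nE : (u 0 o0 / (1 - u 0 o2)) ^+ 2 + (u 0 o1 / (1 - u 0 o2)) ^+ 2 = 2 / (1 - u 0 o2) - 1.
  rewrite !expr_div_n -mulrDl.
  have -> : u 0 o0 ^+ 2 + u 0 o1 ^+ 2 = (1 - u 0 o2) * (1 + u 0 o2).
    by move: us; move: (u 0 o0) (u 0 o1) (u 0 o2) => a b c h; rewrite -subr_sqr expr1n -h; ring.
  by move: w1; move: (u 0 o2) => c w1; field.
apply: rV3P; rewrite /inv_stereo /north_proj /= nE !mk3E subrK; move: w1; move: (u 0 o0) (u 0 o1) (u 0 o2) => a b c w1; field; rewrite w1//.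
Qed.

Lemma continuous_inv_stereo : continuous inv_stereo.
Proof.
move=> z; apply: cvg_rV3 => i.
have cn : (y.1 ^+ 2 + y.2 ^+ 2) @[y --> z] --> z.1 ^+ 2 + z.2 ^+ 2.
  by apply: cvgD; apply: cvgM; first [exact: cvg_fst | exact: cvg_snd].
have cn1 : (y.1 ^+ 2 + y.2 ^+ 2 + 1)^-1 @[y --> z] --> (z.1 ^+ 2 + z.2 ^+ 2 + 1)^-1.
  apply: cvgV; first exact: lt0r_neq0 (sqn1_gt0 _ _).
  by apply: cvgD; [exact: cn | exact: cvg_cst].
case: (ord3P i) => ->; rewrite /inv_stereo mk3E.
- have -> : (fun x : R * R => mk3 (2 * x.1 / (x.1 ^+ 2 + x.2 ^+ 2 + 1)) (2 * x.2 / (x.1 ^+ 2 + x.2 ^+ 2 + 1)) ((x.1 ^+ 2 + x.2 ^+ 2 - 1) / (x.1 ^+ 2 + x.2 ^+ 2 + 1)) 0 o0) = (fun x : R * R => 2 * x.1 / (x.1 ^+ 2 + x.2 ^+ 2 + 1)) by apply/funext => x; rewrite mk3E.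
  apply: cvgM; last exact: cn1.
  by apply: cvgM; [exact: cvg_cst | exact: cvg_fst].
- have -> : (fun x : R * R => mk3 (2 * x.1 / (x.1 ^+ 2 + x.2 ^+ 2 + 1)) (2 * x.2 / (x.1 ^+ 2 + x.2 ^+ 2 + 1)) ((x.1 ^+ 2 + x.2 ^+ 2 - 1) / (x.1 ^+ 2 + x.2 ^+ 2 + 1)) 0 o1) = (fun x : R * R => 2 * x.2 / (x.1 ^+ 2 + x.2 ^+ 2 + 1)) by apply/funext => x; rewrite mk3E.
  apply: cvgM; last exact: cn1.
  by apply: cvgM; [exact: cvg_cst | exact: cvg_snd].
- have -> : (fun x : R * R => mk3 (2 * x.1 / (x.1 ^+ 2 + x.2 ^+ 2 + 1)) (2 * x.2 / (x.1 ^+ 2 + x.2 ^+ 2 + 1)) ((x.1 ^+ 2 + x.2 ^+ 2 - 1) / (x.1 ^+ 2 + x.2 ^+ 2 + 1)) 0 o2) = (fun x : R * R => (x.1 ^+ 2 + x.2 ^+ 2 - 1) / (x.1 ^+ 2 + x.2 ^+ 2 + 1)) by apply/funext => x; rewrite mk3E.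
  apply: cvgM; last exact: cn1.
  by apply: cvgB; [exact: cn | exact: cvg_cst].
Qed.

Lemma cont_on_north_proj (L : set 'rV[R]_3) : (forall u, L u -> 1 - u 0 o2 != 0) -> cont_on L north_proj.
Proof.
move=> hL u Lu; apply: cvg_within_filter.
have FF : Filter (nbhs (u : 'rV[R]_3)) by exact: nbhs_filter.
have c2 : (fun v : 'rV[R]_3 => (1 - v 0 o2)^-1) @ u --> (1 - u 0 o2)^-1.
  apply: (@cvgV _ _ _ FF); first exact: hL.
  by apply: (@cvgB _ _ _ _ FF); [exact: cvg_cst | exact: coord_continuous].
have c0 i : (fun v : 'rV[R]_3 => v 0 i / (1 - v 0 o2)) @ u --> u 0 i / (1 - u 0 o2).
  by apply: (@cvgM _ _ _ FF); [exact: coord_continuous | exact: c2].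
exact: (@cvg_pair _ _ _ (nbhs (u : 'rV[R]_3)) _ _ FF _ _ _ _ (c0 o0) (c0 o1)).
Qed.

Lemma inv_stereo_far (A : set 'rV[R]_3) (z0 : R * R) : nbhs (mk3 0 0 1 : 'rV[R]_3) A ->
  exists rho, 0 < rho /\ forall z, rho <= pdist z0 z -> A (inv_stereo z).
Proof.
move=> /nbhs_ballP[e /= e0 eA].
pose n0 := z0.1 ^+ 2 + z0.2 ^+ 2; have n00 : 0 <= n0 by rewrite addr_ge0 ?sqr_ge0.
(* At distance [2 k + 1] from [z0], [n + 1 = |z|^2 + 1] exceeds [4 / e^2 + 2 / e]. The first term
   bounds the two horizontal coordinates, the second the height defect [2 / (n + 1)]. *)
pose k := n0 + 4 / e ^+ 2 + 2 / e.
have k1 : 0 < 4 / e ^+ 2 by rewrite divr_gt0// exprn_gt0.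
have k2 : 0 < 2 / e by rewrite divr_gt0.
exists (2 * k + 1); split; first by rewrite /k; lra.
move=> z hz; apply: eA; pose n := z.1 ^+ 2 + z.2 ^+ 2.
have kk : 0 < k by rewrite /k; lra.
have h1 : (2 * k + 1) ^+ 2 <= (z.1 - z0.1) ^+ 2 + (z.2 - z0.2) ^+ 2.
  rewrite -[X in _ <= X]sqr_sqrtr ?addr_ge0 ?sqr_ge0// ler_pXn2r ?nnegrE ?sqrtr_ge0//.
  by rewrite addr_ge0// mulr_ge0// ltW.
have h2 : (z.1 - z0.1) ^+ 2 + (z.2 - z0.2) ^+ 2 <= 2 * n + 2 * n0.
  rewrite /n /n0; move: z z0 {hz n0 n00 k kk h1 n} => [a b] [c d] /=.
  have := sqr_ge0 (a + c); have := sqr_ge0 (b + d); nra.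
have n1 : 4 / e ^+ 2 + 2 / e < n + 1 by move: h1 h2 kk; rewrite /k; nra.
have np : 0 < n + 1 by apply: sqn1_gt0.
have sm (t : R) : t ^+ 2 <= n -> `|0 - 2 * t / (n + 1)| < e.
  move=> tn; rewrite sub0r normrN -(@ltr_pXn2r _ 2) ?nnegrE ?normr_ge0 ?(ltW e0)//.
  rewrite real_normK ?num_real// expr_div_n ltr_pdivrMr ?exprn_gt0//.
  have : 4 < e ^+ 2 * (n + 1) by rewrite mulrC -ltr_pdivrMr ?exprn_gt0//; lra.
  have : 0 <= t ^+ 2 by exact: sqr_ge0.
  have : 0 < e ^+ 2 by rewrite exprn_gt0.
  move: (e ^+ 2) => e2; rewrite exprMn; move: (t ^+ 2) tn => t2; nra.
split => // i j; rewrite (ord1 i) /ball/=; case: (ord3P j) => ->; rewrite /inv_stereo !mk3E -/n.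
- by apply: sm; rewrite lerDl sqr_ge0.
- by apply: sm; rewrite lerDr sqr_ge0.
- have -> : 1 - (n - 1) / (n + 1) = 2 / (n + 1) by field; rewrite lt0r_neq0.
  rewrite gtr0_norm ?divr_gt0// ltr_pdivrMr// mulrC -ltr_pdivrMr//; lra.
Qed.

End Transfer.

Section NonSeparation.
Context {R : realType}.

Lemma cont_on_sub {T U : topologicalType} (K L : set T) (f : T -> U) :
  K `<=` L -> cont_on L f -> cont_on K f.
Proof.
move=> KL cf x Kx A fA; have h : nbhs x (fun y => L y -> A (f y)) := cf x (KL _ Kx) A fA.
by apply: filterS h => y Ly /KL; exact: Ly.
Qed.

(** Projecting from [f x1] makes [W] a neighbourhood of infinity. The direction from the image of
    [x0] to a point of [K] is a map to the circle on a contractible compact set, so it has a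
    continuous angle, which is what [plane_nonsep] refutes. *)
Lemma sphere_nonsep_north (T : topologicalType) (A K U W : set T)
    (f : T -> 'rV[R]_3) (g : 'rV[R]_3 -> T) (H : T -> R -> T) (a x0 x1 : T) :
  cont_on A f -> cont_on unit_sphere g ->
  (forall x, A x -> unit_sphere (f x) /\ g (f x) = x) ->
  (forall y, unit_sphere y -> A (g y) /\ f (g y) = y) ->
  compact K -> K `<=` A -> K a -> continuous (fun y : T * R => H y.1 y.2) ->
  (forall x t, K x -> 0 <= t <= 1 -> K (H x t)) ->
  (forall x, K x -> H x 0 = a) -> (forall x, K x -> H x 1 = x) ->
  open U -> open W -> (forall x, A x -> U x \/ W x \/ K x) ->
  (forall x, A x -> U x -> W x -> False) -> (forall x, U x -> K x -> False) ->
  (forall x, W x -> K x -> False) ->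
  A x0 -> U x0 -> A x1 -> W x1 -> f x1 = mk3 0 0 1 -> False.
Proof.
move=> cf cg fS gS cK KA Ka cH HK H0 H1 oU oW cov UW UK WK Ax0 Ux0 Ax1 Wx1 fx1.
pose G := g \o (@inv_stereo R).
have cG : continuous G.
  apply: cont_onT; apply: (@cont_on_comp _ _ _ _ unit_sphere) => //.
    by apply: continuous_cont_on; exact: continuous_inv_stereo.
  by move=> z _; exact: inv_stereo_sphere.
have AG z : A (G z) by have [] := gS _ (inv_stereo_sphere z).
have fG z : f (G z) = inv_stereo z by have [] := gS _ (inv_stereo_sphere z).
have gN : g (mk3 0 0 1) = x1 by rewrite -fx1; have [_ ->] := fS _ Ax1.
have x01 : x0 <> x1 by move=> e; apply: (UW x0) => //; rewrite e.
have fN x : A x -> x <> x1 -> f x <> mk3 0 0 1.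
  by move=> Ax xx1 fxN; apply: xx1; have [_ <-] := fS _ Ax; rewrite fxN.
have Gtau x : A x -> x <> x1 -> G (north_proj (f x)) = x.
  by move=> Ax xx1; have [fxS gfx] := fS _ Ax; rewrite /G/= north_projK//; exact: fN.
pose z0 := north_proj (f x0).
have Kx1 x : K x -> x <> x1 by move=> Kx e; apply: (WK x) => //; rewrite e.
have Kz0 x : K x -> north_proj (f x) <> z0.
  move=> Kx e; apply: (UK x) => //.
  by rewrite -(Gtau x (KA _ Kx) (Kx1 _ Kx)) e Gtau.
have cft : cont_on K (north_proj \o f).
  apply: (@cont_on_comp _ _ _ _ (fun u : 'rV[R]_3 => 1 - u 0 o2 != 0)).
  - exact: cont_on_sub cf.
  - by move=> x Kx; apply: north_coord; [exact: (fS _ (KA _ Kx)).1 | apply: fN; [exact: KA | exact: Kx1]].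
  - exact: cont_on_north_proj.
pose dir (i : bool) (z : R * R) := ((if i then z.2 - z0.2 else z.1 - z0.1) / pdist z0 z : R).
have cdir i : cont_on K (dir i \o (north_proj \o f)).
  apply: (@cont_on_comp _ _ _ _ (fun z : R * R => z <> z0)); [exact: cft | by move=> x Kx; exact: Kz0 | ].
  move=> z zz0; apply: cvg_within_filter; rewrite /dir; case: i.
    exact: continuous_dir2.
  exact: continuous_dir1.
have [|th [cth thE]] := circle_lift cK Ka cH HK H0 H1 (cdir false) (cdir true).
  by move=> x Kx; apply: pdist_unit; exact: Kz0.
have [M [M0 bM]] : exists M : R, 0 < M /\ forall x, K x -> `|th x| <= M.
  have /compact_bounded[M [_ hM]] : compact (th @` K).
    by apply: continuous_compact => //; apply/subspace_continuousP.
  exists (`|M| + 1); split; first by rewrite ltr_wpDl.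
  move=> x Kx; apply: (hM (`|M| + 1)) => /=; last by exists x.
  by rewrite (le_lt_trans (ler_norm M))// ltrDl.
have [rho [rho0 far]] : exists rho, 0 < rho /\ forall z, rho <= pdist z0 z -> W (G z).
  have NS : unit_sphere (mk3 0 0 1 : 'rV[R]_3) by rewrite -fx1; have [] := fS _ Ax1.
  have hN : nbhs (mk3 0 0 1 : 'rV[R]_3) (fun u => unit_sphere u -> W (g u)).
    by apply: (cg _ NS W); rewrite gN; exact: open_nbhs_nbhs.
  have [rho [rho0 h]] := inv_stereo_far z0 hN.
  by exists rho; split => // z /h; apply; exact: inv_stereo_sphere.
have oGU : open (G @^-1` U) by apply: open_comp => // z _; exact: cG.
have oGW : open (G @^-1` W) by apply: open_comp => // z _; exact: cG.
have KE : G @^-1` K = ~` (G @^-1` U `|` G @^-1` W).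
  apply/seteqP; split => z /=; first by move=> Kz [Uz|Wz]; [exact: (UK (G z)) | exact: (WK (G z))].
  by move=> h; case: (cov (G z) (AG z)) => [Uz|[Wz|//]]; exfalso; apply: h; [left|right].
have G0 : G z0 = x0 by rewrite Gtau.
apply: (@plane_nonsep R (G @^-1` U) (G @^-1` W) (G @^-1` K) z0 rho M (th \o G)) => //.
- by rewrite KE; apply: open_closedC; exact: openU.
- by move=> z; exact: cov (AG z).
- by apply/seteqP; split => // z [Uz Wz]; exact: (UW (G z)).
- by apply/seteqP; split => // z [Uz Wz]; exact: (UK (G z)).
- by rewrite /= G0.
- apply: (@cont_on_comp _ _ _ _ K) => //; exact: continuous_cont_on.
- by move=> z Kz; exact: bM.
- move=> z Kz; have [<- <-] := thE _ Kz.
  have e : north_proj (f (G z)) = z by rewrite fG inv_stereoK.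
  by rewrite /comp e.
Qed.

Lemma sphere_nonsep (T : topologicalType) (A K U W : set T)
    (f : T -> 'rV[R]_3) (g : 'rV[R]_3 -> T) (H : T -> R -> T) (a x0 x1 : T) :
  cont_on A f -> cont_on unit_sphere g ->
  (forall x, A x -> unit_sphere (f x) /\ g (f x) = x) ->
  (forall y, unit_sphere y -> A (g y) /\ f (g y) = y) ->
  compact K -> K `<=` A -> K a -> continuous (fun y : T * R => H y.1 y.2) ->
  (forall x t, K x -> 0 <= t <= 1 -> K (H x t)) ->
  (forall x, K x -> H x 0 = a) -> (forall x, K x -> H x 1 = x) ->
  open U -> open W -> (forall x, A x -> U x \/ W x \/ K x) ->
  (forall x, A x -> U x -> W x -> False) -> (forall x, U x -> K x -> False) ->
  (forall x, W x -> K x -> False) ->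
  A x0 -> U x0 -> A x1 -> W x1 -> False.
Proof.
move=> cf cg fS gS cK KA Ka cH HK H0 H1 oU oW cov UW UK WK Ax0 Ux0 Ax1 Wx1.
have [h [ch hh hS hN]] := reflect_to_north (fS _ Ax1).1.
apply: (@sphere_nonsep_north T A K U W (h \o f) (g \o h) H a x0 x1) => //.
- apply: (@cont_on_comp _ _ _ _ setT) => //; exact: continuous_cont_on.
- apply: (@cont_on_comp _ _ _ _ unit_sphere) => //; exact: continuous_cont_on.
- by move=> x Ax /=; have [? ?] := fS _ Ax; rewrite hh; split => //; exact: hS.
- by move=> y Sy /=; have [? ->] := gS _ (hS _ Sy); rewrite hh.
Qed.

End NonSeparation.

(** * Triangulations of the sphere *)

Section Realization.
Context {R : realType} {V : finType}.
Implicit Types (F : {set {set V}}).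

Lemma ptws_coord_continuous (v : V) : continuous (fun x : {ptws V -> R} => x v).
Proof. exact: (@proj_continuous V (fun=> R) v). Qed.

Lemma cvg_ptws {T : Type} (F : set_system T) {FF : Filter F} (f : T -> {ptws V -> R}) (l : {ptws V -> R}) :
  (forall v, f x v @[x --> F] --> l v) -> f x @[x --> F] --> l.
Proof.
move=> h; apply/cvg_sup => v U [W [[B oB <-] Bl WU]].
apply: (filterS WU); apply: (h v B); exact: open_nbhs_nbhs.
Qed.

Lemma continuous_coord_sum (P : pred V) : continuous (fun x : {ptws V -> R} => \sum_(v | P v) x v).
Proof.
apply: continuous_big => [|v _]; last exact: ptws_coord_continuous.
by move=> x; apply: cvgD; [exact: cvg_fst | exact: cvg_snd].
Qed.

Lemma closed_simplex (P : pred V) :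
  closed [set x : {ptws V -> R} | [/\ forall v, 0 <= x v, \sum_v x v = 1 & forall v, ~~ P v -> x v = 0]].
Proof.
have -> : [set x : {ptws V -> R} | [/\ forall v, 0 <= x v, \sum_v x v = 1 & forall v, ~~ P v -> x v = 0]] =
  (\bigcap_(v in setT) [set x : {ptws V -> R} | 0 <= x v]) `&`
  ([set x : {ptws V -> R} | \sum_v x v = 1] `&`
   \bigcap_(v in [set v | ~~ P v]) [set x : {ptws V -> R} | x v = 0]).
  apply/seteqP; split => x /=; first by move=> [h1 h2 h3]; split => // v _; exact: h1.
  by move=> [h1 [h2 h3]]; split => // v; exact: h1.
apply: closedI; last apply: closedI.
- apply: closed_bigI => v _.
  have := @closed_comp _ _ (fun x : {ptws V -> R} => x v) [set t | 0 <= t] (fun z _ => @ptws_coord_continuous v z).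
  by apply; exact: closed_ge.
- have := @closed_comp _ _ (fun x : {ptws V -> R} => \sum_v x v) [set t | t = 1] (fun z _ => @continuous_coord_sum predT z).
  by apply; exact: closed_eq.
- apply: closed_bigI => v _.
  have := @closed_comp _ _ (fun x : {ptws V -> R} => x v) [set t | t = 0] (fun z _ => @ptws_coord_continuous v z).
  by apply; exact: closed_eq.
Qed.

Lemma realization_le1 F (x : {ptws V -> R}) v : @realization R V F x -> 0 <= x v <= 1.
Proof.
move=> [x0 x1 _]; rewrite x0 -x1 (bigD1 v)//= lerDl sumr_ge0// => w _; exact: x0.
Qed.

Lemma compact_cube (K : set {ptws V -> R}) : closed K -> (forall x, K x -> forall v, 0 <= x v <= 1) -> compact K.
Proof.
move=> cK KA.
pose B : set {ptws V -> R} := [set x | forall v, [set t : R | 0 <= t <= 1] (x v)].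
have cB : compact B.
  apply: (@tychonoff V (fun=> R) (fun=> [set t : R | 0 <= t <= 1])) => v.
  rewrite (_ : mkset _ = `[0 : R, 1]%classic); first exact: segment_compact.
  by apply/seteqP; split => x /=; rewrite in_itv.
apply: (subclosed_compact cK cB) => x Kx v /=; exact: KA.
Qed.

Lemma continuous_homothety (a : {ptws V -> R}) :
  continuous (fun y : {ptws V -> R} * R => (fun v => a v + y.2 * (y.1 v - a v)) : {ptws V -> R}).
Proof.
move=> y.
pose h := fun y : {ptws V -> R} * R => (fun v => a v + y.2 * (y.1 v - a v)) : {ptws V -> R}.
have FF : Filter (nbhs y) by exact: nbhs_filter.
have := @cvg_ptws _ (nbhs y) FF h (h y).
rewrite /continuous_at -/h.
apply.
move=> v.
have c1 : (fun z : {ptws V -> R} * R => z.1 v) @ y --> y.1 v.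
  apply: (cvg_comp fst (fun x : {ptws V -> R} => x v)); first exact: cvg_fst.
  exact: ptws_coord_continuous.
have c2 : (fun z : {ptws V -> R} * R => z.2) @ y --> y.2 by exact: cvg_snd.
exact: (cvgD (cvg_cst _) (cvgM c2 (cvgB c1 (cvg_cst _)))).
Qed.

(** A set star-shaped about [a] is contracted by homotheties. These are continuous on the whole
    coordinate space and preserve [K], though not the realization, which need not be convex. *)
Lemma realization_nonsep F (K U W : set {ptws V -> R}) (a x0 x1 : {ptws V -> R}) :
  homeomorphic (@realization R V F) (@unit_sphere R) ->
  closed K -> K `<=` @realization R V F -> K a ->
  (forall x (t : R), K x -> 0 <= t <= 1 -> K (fun v => a v + t * (x v - a v))) ->
  open U -> open W -> (forall x, @realization R V F x -> U x \/ W x \/ K x) ->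
  (forall x, @realization R V F x -> U x -> W x -> False) -> (forall x, U x -> K x -> False) ->
  (forall x, W x -> K x -> False) ->
  @realization R V F x0 -> U x0 -> @realization R V F x1 -> W x1 -> False.
Proof.
move=> [f [g [cf cg fS gS]]] cK KA Ka HK oU oW cov UW UK WK Ax0 Ux0 Ax1 Wx1.
pose H (x : {ptws V -> R}) (t : R) : {ptws V -> R} := fun v => a v + t * (x v - a v).
apply: (@sphere_nonsep R _ (@realization R V F) K U W f g H a x0 x1) => //.
- exact/subspace_continuousP.
- exact/subspace_continuousP.
- by apply: compact_cube => // x Kx v; apply: realization_le1; exact: KA.
- exact: continuous_homothety.
- by move=> x Kx; apply/funext => v; rewrite /H mul0r addr0.
- by move=> x Kx; apply/funext => v; rewrite /H mul1r addrC subrK.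
Qed.

Definition vtx (v : V) : {ptws V -> R} := fun w => (w == v)%:R.

Lemma sum_vtx v : \sum_w vtx v w = 1.
Proof. by rewrite (bigD1 v)//= /vtx eqxx big1 ?addr0// => w /negbTE ->. Qed.

Lemma vtx_realization F f v : f \in F -> v \in f -> @realization R V F (vtx v).
Proof.
move=> fF vf; split; [by move=> w; rewrite ler0n | exact: sum_vtx|].
by exists f => // w; apply: contraNeq; rewrite pnatr_eq0 eqb0 negbK => /eqP ->.
Qed.

Lemma pos_in_face (f : {set V}) (x : {ptws V -> R}) v : (forall v, v \notin f -> x v = 0) -> 0 < x v -> v \in f.
Proof. by move=> h; apply: contraTT => /h ->; rewrite ltxx. Qed.

(* If [u, v] were an edge of [f] only, the arc of [f] where the smaller of the two
   coordinates equals 1/4 would separate the sphere. *)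
Lemma second_face F f u v : sphere_triangulation R F -> f \in F -> u \in f -> v \in f -> u != v ->
  exists g, [/\ g \in F, g != f, u \in g & v \in g].
Proof.
move=> [F3 _ hom] fF uf vf uv.
have uvf : [set u; v]%SET \subset f by rewrite finset.subUset !finset.sub1set uf vf.
have : (0 < #|f :\: [set u; v]|)%N.
  by rewrite cardsD (finset.setIidPr uvf) F3// cards2 uv.
case/card_gt0P => w; rewrite !inE negb_or => /andP[/andP[wu wv] wf].
have [[g [? ? ? ?]]|no] := pselect (exists g, [/\ g \in F, g != f, u \in g & v \in g]); first by exists g.
have only g : g \in F -> u \in g -> v \in g -> g = f.
  by move=> gF ug vg; apply/eqP/negP => /negP gf; apply: no; exists g.
exfalso.
pose m (x : {ptws V -> R}) := Num.min (x u) (x v).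
have cm : continuous m by move=> x; apply: continuous_min; exact: ptws_coord_continuous.
pose S := [set x : {ptws V -> R} | [/\ forall v, 0 <= x v, \sum_v x v = 1 & forall v, v \notin f -> x v = 0]].
(* The arc consists of a segment of [x u = 1/4] and one of [x v = 1/4]; [a] is their common point,
   hence a star centre. The level 1/4 puts the midpoint of the edge and the vertex [u] on different
   sides. *)
pose a : {ptws V -> R} := fun y => vtx u y / 4 + vtx v y / 4 + vtx w y / 2.
have [uw vw vu] : [/\ u != w, v != w & v != u] by rewrite !(eq_sym u) ![_ == w]eq_sym wu wv eq_sym uv.
have au : a u = 4^-1 by rewrite /a /vtx eqxx (negbTE uv) (negbTE uw) !mul0r !addr0 mul1r.
have av : a v = 4^-1 by rewrite /a /vtx eqxx (negbTE vu) (negbTE vw) !mul0r addr0 add0r mul1r.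
pose x0 : {ptws V -> R} := fun y => vtx u y / 2 + vtx v y / 2.
have SA x : S x -> @realization R V F x by move=> [? ? ?]; split => //; exists f.
have Sa : (S `&` [set x | m x = 4^-1]) a.
  split; last by rewrite /= /m au av minxx.
  split.
  + by move=> y; rewrite /a !addr_ge0// divr_ge0// ler0n.
  + by rewrite /a !big_split/= -!mulr_suml !sum_vtx; lra.
  + move=> y yf; rewrite /a /vtx.
    have -> : (y == u) = false by apply: contraNF yf => /eqP ->.
    have -> : (y == v) = false by apply: contraNF yf => /eqP ->.
    have -> : (y == w) = false by apply: contraNF yf => /eqP ->.
    by rewrite !mul0r !addr0.
apply: (@realization_nonsep F (S `&` [set x | m x = 4^-1]) [set x | 4^-1 < m x] [set x | m x < 4^-1] a x0 (vtx u)) => //.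
- apply: closedI; first exact: (@closed_simplex (mem f)).
  have := @closed_comp _ _ m [set t | t = 4^-1] (fun z _ => cm z).
  by apply; exact: closed_eq.
- by move=> x [/SA].
- have [[a0 a1 af] _] := Sa.
  move=> x t [[xp x1 xf] xm] /andP[t0 t1]; split.
    split.
    + move=> y; have := a0 y; have := xp y; nra.
    + by rewrite big_split/= -mulr_sumr sumrB a1 x1 subrr mulr0 addr0.
    + by move=> y yf; rewrite af// xf// subrr mulr0 addr0.
  move: xm; rewrite /= /m au av => xm.
  have [xu xv] : 4^-1 <= x u /\ 4^-1 <= x v by rewrite -xm !ge_min !lexx orbT.
  have : x u = 4^-1 \/ x v = 4^-1 by move: xm; rewrite /Num.min; case: ifP; [left|right].
  by case=> ->; rewrite subrr mulr0 addr0; [rewrite min_l | rewrite min_r] => //; nra.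
- have := @open_comp _ _ m [set t | 4^-1 < t] (fun z _ => cm z).
  by apply; exact: open_gt.
- have := @open_comp _ _ m [set t | t < 4^-1] (fun z _ => cm z).
  by apply; exact: open_lt.
- move=> x Ax /=; case: (ltgtP (m x) 4^-1) => [|//|xm]; [by right; left|by left|].
  (* A point with both coordinates at least 1/4 lies in a face containing [u] and [v], and [f] is
     the only one. *)
  right; right; split => //; case: Ax => x0' x1' [g gF hg]; split => //.
  have [xu xv] : 4^-1 <= x u /\ 4^-1 <= x v by rewrite -xm !ge_min !lexx orbT.
  have q0 : 0 < 4^-1 :> R by rewrite invr_gt0.
  by rewrite -(only g gF)//; apply: (pos_in_face hg); apply: lt_le_trans q0 _.
- by move=> x _ /= h1 h2; have := lt_trans h1 h2; rewrite ltxx.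
- by move=> x /= h1 [_ /= h2]; rewrite h2 ltxx in h1.
- by move=> x /= h1 [_ /= h2]; rewrite h2 ltxx in h1.
- apply: SA; split.
  + by move=> y; rewrite /x0 !addr_ge0// divr_ge0// ler0n.
  + by rewrite /x0 !big_split/= -!mulr_suml !sum_vtx; lra.
  + move=> y yf; rewrite /x0 /vtx.
    have -> : (y == u) = false by apply: contraNF yf => /eqP ->.
    have -> : (y == v) = false by apply: contraNF yf => /eqP ->.
    by rewrite !mul0r !addr0.
- by rewrite /= /m /x0 /vtx !eqxx (negbTE uv) (negbTE vu) !mul0r addr0 add0r minxx /=; lra.
- exact: vtx_realization fF uf.
- by rewrite /= /m /vtx eqxx (negbTE vu) min_r ?ler01 //=; lra.
Qed.

(** A closed face is convex, so it does not separate. The total weights on the vertices of [X]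
    outside [f] and on the remaining vertices outside [f] define two open sets; a point of both
    would give an edge leading out of [X]. *)
Lemma face_complement_connected F f (X : {set V}) x : sphere_triangulation R F -> f \in F ->
  x \in X -> x \notin f ->
  (forall u v, u \in X -> v \notin f -> [set u; v]%SET \in skeleton_edges F -> v \in X) ->
  forall y, y \notin f -> y \in X.
Proof.
move=> [F3 cov hom] fF xX xf cl y yf; apply: contraT => yX; exfalso.
have covF v : exists2 g, g \in F & v \in g.
  have : v \in finset.cover F by rewrite cov finset.in_setT.
  by rewrite /finset.cover => /finset.bigcupP[g gF vg]; exists g.
pose PU v := (v \in X) && (v \notin f); pose PW v := (v \notin X) && (v \notin f).
have [w wf] : exists w, w \in f by apply/card_gt0P; rewrite F3.
have sum_pos (P : pred V) (z : {ptws V -> R}) : (forall v, 0 <= z v) -> 0 < \sum_(v | P v) z v ->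
    exists2 v, P v & 0 < z v.
  move=> z0; rewrite lt_neqAle sumr_ge0 ?andbT// eq_sym psumr_neq0// => /hasP[v _ /andP[Pv zv]].
  by exists v.
have pos_sum (P : pred V) (z : {ptws V -> R}) v : (forall v, 0 <= z v) -> P v -> 0 < z v ->
    0 < \sum_(v | P v) z v.
  by move=> z0 Pv zv; rewrite (bigD1 v)//= ltr_pwDl// sumr_ge0.
pose S := [set x : {ptws V -> R} | [/\ forall v, 0 <= x v, \sum_v x v = 1 & forall v, v \notin f -> x v = 0]].
have SA z : S z -> @realization R V F z by move=> [? ? ?]; split => //; exists f.
have Sw : S (vtx w).
  split; [by move=> v; rewrite ler0n | exact: sum_vtx|].
  by move=> v; apply: contraNeq; rewrite pnatr_eq0 eqb0 negbK => /eqP ->.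
apply: (@realization_nonsep F S [set z | 0 < \sum_(v | PU v) z v] [set z | 0 < \sum_(v | PW v) z v] (vtx w) (vtx x) (vtx y)) => //.
- exact: (@closed_simplex (mem f)).
- case: Sw => [a0 a1 af] z t [zp z1 zf] /andP[t0 t1]; split.
  + move=> v; have := a0 v; have := zp v; nra.
  + by rewrite big_split/= -mulr_sumr sumrB a1 z1 subrr mulr0 addr0.
  + by move=> v vf; rewrite af// zf// subrr mulr0 addr0.
- have := @open_comp _ _ (fun z : {ptws V -> R} => \sum_(v | PU v) z v) [set t | 0 < t] (fun z _ => @continuous_coord_sum PU z).
  by apply; exact: open_gt.
- have := @open_comp _ _ (fun z : {ptws V -> R} => \sum_(v | PW v) z v) [set t | 0 < t] (fun z _ => @continuous_coord_sum PW z).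
  by apply; exact: open_gt.
- move=> z [z0 z1 _] /=.
  have [[v /andP[vf zv]]|h] := pselect (exists v, (v \notin f) && (0 < z v)).
    by have [vX|vX] := boolP (v \in X); [left|right; left]; apply: (pos_sum _ _ v) => //; rewrite /PU /PW vX vf.
  right; right; split => // v vf; apply/eqP; rewrite eq_le z0 andbT leNgt; apply/negP => zv.
  by apply: h; exists v; rewrite vf zv.
- move=> z [z0 z1 [g gF hg]] /= /(sum_pos _ _ z0)[u /andP[uX uf] zu] /(sum_pos _ _ z0)[v /andP[vX vf] zv].
  have uv : u != v by apply: contraNneq vX => <-.
  move: vX; rewrite (cl u v)// inE cards2 uv; apply/andP; split => //.
  by apply/existsP; exists g; rewrite gF finset.subUset !finset.sub1set (pos_in_face hg zu) (pos_in_face hg zv).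
- move=> z /= h [z0 z1 zf]; move: h; rewrite big1 ?ltxx// => v /andP[_ vf]; exact: zf.
- move=> z /= h [z0 z1 zf]; move: h; rewrite big1 ?ltxx// => v /andP[_ vf]; exact: zf.
- by have [g gF xg] := covF x; exact: vtx_realization gF xg.
- by apply: (pos_sum _ (vtx x) x); [move=> v; rewrite ler0n | rewrite /PU xX xf | rewrite /vtx eqxx].
- by have [g gF xg] := covF y; exact: vtx_realization gF xg.
- by apply: (pos_sum _ (vtx y) y); [move=> v; rewrite ler0n | rewrite /PW yX yf | rewrite /vtx eqxx].
Qed.

End Realization.

(** * Disks as vectors of Minkowski space *)

Section Lorentz.
Context {R : realType}.

(* [Form A X Y C] stands for the function [A |z|^2 + 2 (X Re z + Y Im z) + C], which is
   negative inside a disk or half-plane; points are null vectors. *)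
Record form := Form { fA : R; fX : R; fY : R; fC : R }.

(** The polarisation of [A C - X^2 - Y^2], of signature (1, 3). Its product with
    [Form 1 (-x) (-y) (x^2 + y^2)] is half the value of the function at [(x, y)]. *)
Definition mink (n m : form) : R :=
  (fA n * fC m + fC n * fA m) / 2 - fX n * fX m - fY n * fY m.
Local Notation e := mink.

Definition fD (n m : form) := Form (fA n + fA m) (fX n + fX m) (fY n + fY m) (fC n + fC m).
Definition fZ (k : R) (n : form) := Form (k * fA n) (k * fX n) (k * fY n) (k * fC n).

Lemma eC n m : e n m = e m n. Proof. rewrite /mink; ring. Qed.
Lemma eDl n m p : e (fD n m) p = e n p + e m p. Proof. rewrite /mink /=; ring. Qed.
Lemma eZl k n p : e (fZ k n) p = k * e n p. Proof. rewrite /mink /=; ring. Qed.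
Lemma eDr n m p : e p (fD n m) = e p n + e p m. Proof. by rewrite eC eDl !(eC p). Qed.
Lemma eZr k n p : e p (fZ k n) = k * e p n. Proof. by rewrite eC eZl eC. Qed.

Definition det3 (a b c a' b' c' a'' b'' c'' : R) :=
  a * (b' * c'' - c' * b'') - b * (a' * c'' - c' * a'') + c * (a' * b'' - b' * a'').

(* The vector product of Minkowski space: [e (cross u v w) y] is the determinant of [u, v, w, y]. *)
Definition cross (u v w : form) := Form
  (2 * det3 (fA u) (fX u) (fY u) (fA v) (fX v) (fY v) (fA w) (fX w) (fY w))
  (- det3 (fA u) (fY u) (fC u) (fA v) (fY v) (fC v) (fA w) (fY w) (fC w))
  (det3 (fA u) (fX u) (fC u) (fA v) (fX v) (fC v) (fA w) (fX w) (fC w))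
  (- 2 * det3 (fX u) (fY u) (fC u) (fX v) (fY v) (fC v) (fX w) (fY w) (fC w)).

Lemma cross_orth1 u v w : e (cross u v w) u = 0.
Proof. by case: u v w => [? ? ? ?] [? ? ? ?] [? ? ? ?]; rewrite /mink /cross /det3 /=; field. Qed.
Lemma cross_orth2 u v w : e (cross u v w) v = 0.
Proof. by case: u v w => [? ? ? ?] [? ? ? ?] [? ? ? ?]; rewrite /mink /cross /det3 /=; field. Qed.
Lemma cross_orth3 u v w : e (cross u v w) w = 0.
Proof. by case: u v w => [? ? ? ?] [? ? ? ?] [? ? ? ?]; rewrite /mink /cross /det3 /=; field. Qed.

(** The linear relation between five vectors of a space of dimension four, tested against [m]. *)
Lemma cramer u v w y m z :
  e (cross u v w) y * e m z = e (cross z v w) y * e m u + e (cross u z w) y * e m v +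
    e (cross u v z) y * e m w + e (cross u v w) z * e m y.
Proof.
by case: u v w y m z => [? ? ? ?] [? ? ? ?] [? ? ? ?] [? ? ? ?] [? ? ? ?] [? ? ? ?];
  rewrite /mink /cross /det3 /=; field.
Qed.

Lemma cauchy_binet u v w p q r :
  e (cross u v w) (cross p q r) =
  - 4 * det3 (e u p) (e u q) (e u r) (e v p) (e v q) (e v r) (e w p) (e w q) (e w r).
Proof.
by case: u v w p q r => [? ? ? ?] [? ? ? ?] [? ? ? ?] [? ? ? ?] [? ? ? ?] [? ? ? ?];
  rewrite /mink /cross /det3 /=; field.
Qed.

(** The forward half of the light cone: the points of the sphere up to a positive factor
    ([null_ray_pointP]). The last clause excludes the zero form. *)
Definition null_ray (q : form) := [/\ e q q = 0, 0 <= fA q, 0 <= fC q & 0 < fA q + fC q].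

Lemma form_eq (n m : form) : fA n = fA m -> fX n = fX m -> fY n = fY m -> fC n = fC m -> n = m.
Proof. by case: n m => [? ? ? ?] [? ? ? ?] /= -> -> -> ->. Qed.

Lemma null_eq (q : form) : e q q = 0 -> fA q * fC q = fX q ^+ 2 + fY q ^+ 2.
Proof. by rewrite /mink; lra. Qed.

Lemma sumsq_eq0 (x y : R) : x ^+ 2 + y ^+ 2 <= 0 -> x = 0 /\ y = 0.
Proof.
move=> h; have hx := sqr_ge0 x; have hy := sqr_ge0 y.
by split; apply/eqP; rewrite -sqrf_eq0; apply/eqP; lra.
Qed.

Lemma null_ray_ge0 p q : null_ray p -> null_ray q -> 0 <= e p q.
Proof.
move=> [/null_eq pp pA pC _] [/null_eq qq qA qC _].
rewrite /mink; set s := (_ / 2); set t := fX p * fX q + fY p * fY q.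
have s0 : 0 <= s by rewrite /s divr_ge0// addr_ge0// mulr_ge0.
suff : t <= s by rewrite /t; lra.
rewrite leNgt; apply/negP => st.
have : s ^+ 2 < t ^+ 2 by rewrite ltr_pXn2r ?nnegrE//; lra.
have : t ^+ 2 <= (fX p ^+ 2 + fY p ^+ 2) * (fX q ^+ 2 + fY q ^+ 2).
  have := sqr_ge0 (fX p * fY q - fY p * fX q); rewrite /t; lra.
have := sqr_ge0 (fA p * fC q - fC p * fA q).
rewrite -pp -qq /s; lra.
Qed.

(** The orthogonal complement of a null vector is negative semidefinite, with kernel spanned by that
    vector. *)
Lemma causal_perp P y : null_ray P -> e y P = 0 -> 0 <= e y y -> exists c, y = fZ c P.
Proof.
move=> [/null_eq PP PA PC PAC] yP yy.
have [A0|A0] := eqVneq (fA P) 0.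
  have [X0 Y0] : fX P = 0 /\ fY P = 0 by apply: sumsq_eq0; rewrite -PP A0 mul0r.
  have C0 : 0 < fC P by move: PAC; rewrite A0 add0r.
  move: yP; rewrite /mink A0 X0 Y0 => yP.
  have yA : fA y = 0 by apply: (mulIf (lt0r_neq0 C0)); rewrite mul0r; lra.
  have [yX yY] : fX y = 0 /\ fY y = 0 by apply: sumsq_eq0; move: yy; rewrite /mink yA; lra.
  exists (fC y / fC P); apply: form_eq; rewrite /= ?A0 ?X0 ?Y0 ?mulr0//.
  by rewrite divfK// lt0r_neq0.
pose c := fA y / fA P; have cA : fA y = c * fA P by rewrite /c divfK.
have [dX dY] : fX y - c * fX P = 0 /\ fY y - c * fY P = 0.
  apply: sumsq_eq0.
  have : e y y - 2 * c * e y P = - ((fX y - c * fX P) ^+ 2 + (fY y - c * fY P) ^+ 2).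
    transitivity (fA y * fC y - fX y ^+ 2 - fY y ^+ 2 - c * (fA y * fC P + fC y * fA P) + 2 * c * (fX y * fX P + fY y * fY P)).
      by rewrite /mink; field.
    rewrite cA.
    transitivity (- ((fX y - c * fX P) ^+ 2 + (fY y - c * fY P) ^+ 2) + c ^+ 2 * (fX P ^+ 2 + fY P ^+ 2 - fA P * fC P)); first by ring.
    by rewrite PP; ring.
  rewrite yP; lra.
exists c; apply: form_eq => //=; try lra.
apply: (mulIf A0); move: yP; rewrite /mink cA.
have -> : fX y = c * fX P by lra. have -> : fY y = c * fY P by lra.
move=> h; have : c * (fX P ^+ 2 + fY P ^+ 2) = c * (fA P * fC P) by rewrite PP.
lra.
Qed.

Lemma null_ray_sep_gt0 n p q : null_ray p -> null_ray q -> e n p != 0 -> e n q = 0 -> 0 < e p q.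
Proof.
move=> ptp ptq np nq; rewrite lt_neqAle null_ray_ge0// andbT eq_sym; apply: contraNneq np => pq.
have pp : 0 <= e p p by case: ptp => ->.
by have [c ->] := causal_perp ptq pq pp; rewrite eZr nq mulr0.
Qed.

Lemma null_ray_future P y : null_ray P -> e y y = 0 -> 0 < e y P -> null_ray y.
Proof.
move=> ptP /[dup] yy /null_eq yn yP.
have sq : 0 <= fA y * fC y by rewrite yn addr_ge0 ?sqr_ge0.
have [|A0] := ltP (fA y) 0.
  move=> A0; have C0 : fC y <= 0 by rewrite -(nmulr_rge0 _ A0).
  have pty : null_ray (fZ (-1) y) by split => /=; [rewrite eZl eZr yy !mulr0 | lra..].
  have := null_ray_ge0 pty ptP; rewrite eZl; lra.
have [PP PA PC _] := ptP.
have xy0 : fA y * fC y = 0 -> fX y = 0 /\ fY y = 0 by move=> h; apply: sumsq_eq0; rewrite -yn h.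
have [C0|C0] := ltP (fC y) 0.
  have A00 : fA y = 0 by apply/eqP; rewrite eq_le A0 andbT -(nmulr_lge0 _ C0).
  have [X0 Y0] := xy0 ltac:(by rewrite A00 mul0r).
  move: yP; rewrite /mink A00 X0 Y0; nra.
split => //; rewrite lt_neqAle addr_ge0// andbT eq_sym paddr_eq0//; apply/negP => /andP[/eqP A00 /eqP C00].
have [X0 Y0] := xy0 ltac:(by rewrite A00 mul0r).
by move: yP; rewrite /mink A00 X0 Y0 C00; lra.
Qed.

Definition crossing (u v : form) := exists P, [/\ null_ray P, e u P = 0 & e v P = 0].

Definition notriple (u v w : form) := forall q, null_ray q -> e u q <= 0 -> e v q <= 0 -> 0 < e w q.

(** The bounds are those of the cosine of an angle in [[0, pi)]: the value 1 is external tangency,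
    while -1, internal tangency, is excluded. *)
Definition overlap (u v : form) := crossing u v /\ -1 < e u v <= 1.

Definition thin3 (u v w : form) :=
  [/\ [/\ e u u = -1, e v v = -1 & e w w = -1], overlap u v, overlap v w, overlap u w & notriple u v w].

Lemma overlapC u v : overlap u v -> overlap v u.
Proof. by move=> [[P [? ? ?]] ?]; split; [exists P | rewrite eC]. Qed.

Lemma notriple12 u v w : notriple u v w -> notriple v u w.
Proof. by move=> h q ptq vq uq; exact: h. Qed.

Lemma notriple23 u v w : notriple u v w -> notriple u w v.
Proof. by move=> h q ptq uq wq; rewrite ltNge; apply/negP => vq; have := h q ptq uq vq; rewrite ltNge wq. Qed.

Lemma thin3_12 u v w : thin3 u v w -> thin3 v u w.
Proof. by move=> [[? ? ?] /overlapC ? ? ? /notriple12]. Qed.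

Lemma thin3_23 u v w : thin3 u v w -> thin3 u w v.
Proof. by move=> [[? ? ?] ? /overlapC ? ? /notriple23]. Qed.

(* [Q] is the second crossing point of the circles [v] and [w]: it is the image of [P']
   in the chart sending [P] to infinity under the reflection in the line of centres. *)
Lemma thin3_gamma u v w : thin3 u v w -> 0 < e u w + e u v * e v w.
Proof.
move=> [[uu vv ww] [[P [ptP uP vP]] _] [[P' [ptP' vP' wP']] _] _ nt].
set a := e u v; set b := e v w.
have k0 : 0 < e w P by apply: nt => //; rewrite ?uP ?vP.
have k'0 : 0 < e u P' by apply: (notriple23 (notriple12 (notriple23 nt))) => //; rewrite ?wP' ?vP'.
have m0 : 0 < e P' P by apply: (null_ray_sep_gt0 (n := u)) => //; rewrite gt_eqF.
set k := e w P in k0 *; set m := e P' P in m0 *.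
have k1 := lt0r_neq0 k0; have m1 := lt0r_neq0 m0.
(* [t] is orthogonal to [v] and [w] and has product 1 with [P]. When [ta] is nonzero it is a
   multiple of the projection of [P] to the orthogonal complement of [v] and [w]; this scaling also
   covers the tangent case, where [ta = 0]. *)
pose ta := (1 - b ^+ 2) / k ^+ 2.
pose t := fD (fD (fZ (b / k) v) (fZ k^-1 w)) (fZ ta P).
pose Q := fD (fZ 2 t) (fZ (- m^-1) P').
have PP : e P P = 0 by case: ptP.
have PP' : e P' P' = 0 by case: ptP'.
have tv : e t v = 0.
  by rewrite /t !eDl !eZl vv (eC w) -/b (eC P) vP; field.
have tw : e t w = 0.
  by rewrite /t !eDl !eZl ww -/b (eC P) -/k /ta; field.
have tP : e t P = 1 by rewrite /t !eDl !eZl vP -/k PP; field.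
have tP' : e t P' = ta * m by rewrite /t !eDl !eZl vP' wP' (eC P) -/m; ring.
have tt : e t t = ta.
  by rewrite {2}/t !eDr !eZr tv tw tP; ring.
have QQ : e Q Q = 0 by rewrite /Q !eDl !eDr !eZl !eZr tt (eC P' t) tP' PP'; field.
have QP : e Q P = 1 by rewrite /Q !eDl !eZl tP -/m; field.
have ptQ : null_ray Q by apply: null_ray_future ptP QQ _; rewrite QP.
have vQ : e v Q = 0 by rewrite eC /Q eDl !eZl tv (eC P') vP'; ring.
have wQ : e w Q = 0 by rewrite eC /Q eDl !eZl tw (eC P') wP'; ring.
have : 0 < e u Q by apply: (notriple23 (notriple12 (notriple23 nt))) => //; rewrite ?wQ ?vQ.
have ut : e u t = (e u w + a * b) / k.
  by rewrite /t !eDr !eZr uP -/a; field.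
rewrite /Q eDr !eZr ut => h.
have h2 : 0 < m^-1 * e u P' by rewrite mulr_gt0 // invr_gt0.
(* [2 t] is [Q] plus a positive multiple of [P'], and by thinness both crossing points of [v] and
   [w] are outside [u]. *)
have h1 : 0 < 2 * ((e u w + a * b) / k) by lra.
by move: h1; rewrite pmulr_rgt0// pmulr_lgt0// invr_gt0.
Qed.

(** Were the common normal [f] not spacelike, subtracting a suitable multiple of [P] from [f] or
    [-f] would give a null ray orthogonal to [u] and [v] and not outside [w], that is, a point of
    all three disks. *)
Lemma thin3_cross_lt0 u v w : thin3 u v w -> e (cross u v w) (cross u v w) < 0.
Proof.
move=> [[uu vv ww] [[P [ptP uP vP]] _] [[P' [ptP' vP' wP']] _] [[P2 [ptP2 uP2 wP2]] _] nt].
have k3 : 0 < e w P by apply: nt => //; rewrite ?uP ?vP.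
have k1 : 0 < e u P' by apply: (notriple23 (notriple12 (notriple23 nt))) => //; rewrite ?wP' ?vP'.
have k2 : 0 < e v P2 by apply: (notriple23 nt) => //; rewrite ?wP2 ?uP2.
set f := cross u v w; rewrite ltNge; apply/negP => ff.
have fu : e f u = 0 := cross_orth1 _ _ _.
have fv : e f v = 0 := cross_orth2 _ _ _.
have fw : e f w = 0 := cross_orth3 _ _ _.
(* Orthogonality to [w] forces [c = 0]. But [f] is not zero: the matrix of products of [u, v, w]
   with [P', P2, P] is diagonal with positive entries. *)
have fn0 : forall c, f <> fZ c P.
  move=> c fc; have c0 : c = 0.
    by apply/eqP; move: fw; rewrite fc eZl (eC P) => /eqP; rewrite mulf_eq0 (gt_eqF k3) orbF.
  have := cauchy_binet u v w P' P2 P; rewrite -/f fc c0 eZl mul0r.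
  rewrite uP uP2 vP vP' wP' wP2 /det3 => /eqP; rewrite eq_sym => /eqP h.
  have : 0 < e u P' * e v P2 * e w P by rewrite !mulr_gt0.
  lra.
have fP : e f P != 0 by apply/eqP => fP; have [c] := causal_perp ptP fP ff; exact: fn0.
have [g [gu gv gw gg gP]] : exists g, [/\ e g u = 0, e g v = 0, e g w = 0, 0 <= e g g & 0 < e g P].
  have [fPn|fPp] := ltP (e f P) 0.
    exists (fZ (-1) f); rewrite !eZl !eZr fu fv fw !mulr0; split => //; lra.
  by exists f; split => //; rewrite lt_neqAle eq_sym fP.
pose la := e g g / (2 * e g P).
have gP0 := lt0r_neq0 gP.
have la0 : 0 <= la by rewrite divr_ge0// mulr_ge0// ltW.
pose y := fD g (fZ (- la) P).
have PP : e P P = 0 by case: ptP.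
have yy : e y y = 0 by rewrite /y !eDl !eDr !eZl !eZr PP (eC P g) /la; field.
have yP : e y P = e g P by rewrite /y eDl eZl PP; ring.
have pty : null_ray y by apply: null_ray_future ptP yy _; rewrite yP.
have h z : e g z = 0 -> e z y = - la * e z P by move=> gz; rewrite /y eDr eZr (eC z g) gz add0r.
have := nt y pty; rewrite (h _ gu) (h _ gv) (h _ gw) uP vP !mulr0 lexx => /(_ isT isT).
by rewrite mulNr oppr_gt0 pmulr_llt0// ltNge la0.
Qed.

(** The Gram determinant of three vectors of norm -1 with products [a], [b], [c]. *)
Definition gram3 (a b c : R) := a ^+ 2 + b ^+ 2 + c ^+ 2 + 2 * a * b * c - 1.

Lemma cross_norm u v w : e u u = -1 -> e v v = -1 -> e w w = -1 ->
  e (cross u v w) (cross u v w) = - 4 * gram3 (e u v) (e u w) (e v w).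
Proof.
by move=> uu vv ww; rewrite cauchy_binet uu vv ww (eC v u) (eC w u) (eC w v) /det3 /gram3; ring.
Qed.

(* The point at infinity of the normalisation making the three circles of a face congruent. *)
Lemma thin3_center u v w (s : bool) : thin3 u v w ->
  exists p, [/\ null_ray p, e u p = 1, e v p = 1, e w p = 1 & 0 < (-1) ^+ s * e (cross u v w) p].
Proof.
move=> th; have ff := thin3_cross_lt0 th.
have g1 := thin3_gamma th; have g2 := thin3_gamma (thin3_12 th); have g3 := thin3_gamma (thin3_23 th).
have [[uu vv ww] [[P [ptP uP vP]] ha] [_ hc] [_ hb] nt] := th.
have k0 : 0 < e w P by apply: nt => //; rewrite ?uP ?vP.
have cu : e (cross u v w) u = 0 := cross_orth1 _ _ _.
have cv : e (cross u v w) v = 0 := cross_orth2 _ _ _.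
have cw : e (cross u v w) w = 0 := cross_orth3 _ _ _.
have fE := cross_norm uu vv ww.
move: g1 g2 g3 ff ha hb hc fE cu cv cw; set f := cross u v w; rewrite (eC v u) (eC w v).
set a := e u v; set b := e u w; set c := e v w => g1 g2 g3 ff ha hb hc fE cu cv cw.
have sq (x : R) : -1 < x <= 1 -> 0 <= 1 - x ^+ 2.
  by move=> /andP[? ?]; nra.
have a2 := sq _ ha; have b2 := sq _ hb; have c2 := sq _ hc.
have D0 : 0 < gram3 a b c by lra.
have D1 := lt0r_neq0 D0.
(* Cramer's rule for a combination of [u, v, w] having product 1 with each of them. The numerators
   are positive by the three inequalities of [thin3_gamma]. *)
pose c1' := (1 - c ^+ 2 + (a + b * c) + (b + a * c)) / gram3 a b c.
pose c2' := (1 - b ^+ 2 + (a + b * c) + (c + a * b)) / gram3 a b c.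
pose c3' := (1 - a ^+ 2 + (b + a * c) + (c + a * b)) / gram3 a b c.
have c1p : 0 < c1' by apply: divr_gt0 => //; lra.
have c2p : 0 < c2' by apply: divr_gt0 => //; lra.
have c3p : 0 < c3' by apply: divr_gt0 => //; lra.
(* The multiple of [f] that makes [q0 + x f] and [q0 - x f] null. These two points are exchanged by
   reflection in the common orthogonal circle, and [s] selects one of them. *)
pose x := Num.sqrt ((c1' + c2' + c3') / (4 * gram3 a b c)).
have xx : x ^+ 2 = (c1' + c2' + c3') / (4 * gram3 a b c).
  by rewrite sqr_sqrtr// divr_ge0//; [rewrite !addr_ge0// ltW | rewrite mulr_ge0// ltW].
have x0 : 0 < x by rewrite sqrtr_gt0 divr_gt0//; [rewrite !addr_gt0 | rewrite mulr_gt0].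
pose q0 := fD (fD (fZ c1' u) (fZ c2' v)) (fZ c3' w).
pose q y := fD q0 (fZ y f).
have qu y : e u (q y) = 1.
  rewrite /q /q0 !eDr !eZr uu -/a -/b (eC u f) cu /c1' /c2' /c3'.
  by move: D1; rewrite /gram3 => D1; field.
have qv y : e v (q y) = 1.
  rewrite /q /q0 !eDr !eZr vv (eC v u) -/a -/c (eC v f) cv /c1' /c2' /c3'.
  by move: D1; rewrite /gram3 => D1; field.
have qw y : e w (q y) = 1.
  rewrite /q /q0 !eDr !eZr ww (eC w u) (eC w v) -/b -/c (eC w f) cw /c1' /c2' /c3'.
  by move: D1; rewrite /gram3 => D1; field.
have qf y : e f (q y) = y * (- 4 * gram3 a b c) by rewrite /q /q0 !eDr !eZr cu cv cw fE; ring.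
have qq y z : e (q y) (q z) = (c1' + c2' + c3') - y * z * (4 * gram3 a b c).
  by rewrite {1}/q /q0 !eDl !eZl qu qv qw qf; ring.
have x4 : x ^+ 2 * (4 * gram3 a b c) = c1' + c2' + c3' by rewrite xx divfK// mulf_neq0.
have n1 : e (q x) (q x) = 0 by rewrite qq -expr2 x4 subrr.
have n2 : e (q (- x)) (q (- x)) = 0 by rewrite qq mulrNN -expr2 x4 subrr.
have n12 : 0 < e (q (- x)) (q x) by rewrite qq mulNr mulNr opprK -expr2 x4; lra.
have qP y : e (q y) P = c3' * e w P + y * e f P by rewrite /q /q0 !eDl !eZl uP vP; ring.
(* The two products with [P] have positive sum, so one of the two null vectors is forward; their
   mutual product is positive, so both are. *)
have [pt1 pt2] : null_ray (q x) /\ null_ray (q (- x)).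
  have : 0 < e (q x) P + e (q (- x)) P by rewrite !qP; have := mulr_gt0 c3p k0; lra.
  have [h1 _|h1 h2] := ltP 0 (e (q x) P).
    have pt1 := null_ray_future ptP n1 h1; split => //; exact: null_ray_future pt1 n2 n12.
  have h3 : 0 < e (q (- x)) P by lra.
  have pt1 := null_ray_future ptP n2 h3; split => //; apply: null_ray_future pt1 n1 _.
  by rewrite eC.
have xD : 0 < x * (4 * gram3 a b c) by rewrite mulr_gt0// mulr_gt0.
case: s.
  by exists (q x); split => //; rewrite qf expr1; lra.
by exists (q (- x)); split => //; rewrite qf expr0; lra.
Qed.

End Lorentz.

(** * Faces are facets of the convex hull *)

Local Notation e := mink.

Section Combinatorics.
Context {V : finType} (F : {set {set V}}).

Definition tri (u v w : V) : bool := [set u; v; w]%SET \in F.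
Definition adj (u v : V) : bool := (u != v) && [exists w, tri u v w].

(** The combinatorial trace of the sphere. Connectedness without a face is phrased with closed sets
    [X], so that it serves as an induction principle. *)
Definition tight_complex : Prop :=
  [/\ forall u v w, tri u v w -> [/\ u != v, u != w & v != w],
      forall u v w, tri u v w -> exists2 x, x != w & tri u v x,
      forall f x (X : {set V}), f \in F -> x \in X -> x \notin f ->
        (forall u v, u \in X -> v \notin f -> adj u v -> v \in X) ->
        forall y, y \notin f -> y \in X,
      exists u v w, tri u v w &
      forall f, f \in F -> exists u v w, f = [set u; v; w]%SET].

Lemma tri12 u v w : tri u v w = tri v u w.
Proof. by rewrite /tri (finset.setUC [set u]%SET). Qed.

Lemma tri23 u v w : tri u v w = tri u w v.
Proof. by rewrite /tri -!finset.setUA (finset.setUC [set v]%SET). Qed.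

Lemma tri_adj12 u v w : tight_complex -> tri u v w -> adj u v.
Proof. by move=> [h _ _ _ _] /[dup] t /h[uv _ _]; rewrite /adj uv/=; apply/existsP; exists w. Qed.

Lemma adjC u v : adj u v = adj v u.
Proof. by rewrite /adj eq_sym; congr andb; apply: eq_existsb => w; rewrite tri12. Qed.

Lemma tri_adj23 u v w : tight_complex -> tri u v w -> adj v w.
Proof. by move=> h t; apply: (@tri_adj12 _ _ u) => //; rewrite -tri23 -tri12. Qed.

Lemma tri_adj13 u v w : tight_complex -> tri u v w -> adj u w.
Proof. by move=> h t; apply: (@tri_adj12 _ _ v) => //; rewrite -tri23. Qed.

End Combinatorics.

Section Configuration.
Context {R : realType} {V : finType} (F : {set {set V}}) (n : V -> @form R).
Hypothesis hF : tight_complex F.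

Definition thin_config : Prop :=
  [/\ forall v, e (n v) (n v) = -1,
      forall u v, adj F u v -> overlap (n u) (n v) &
      forall u v w, u != v -> u != w -> v != w -> notriple (n u) (n v) (n w)].

Hypothesis hn : thin_config.

Local Notation tri := (tri F).
Local Notation adj := (adj F).

Lemma tri_thin3 u v w : tri u v w -> thin3 (n u) (n v) (n w).
Proof.
move=> t; have [h1 h2 h3] := hn; have [hd _ _ _ _] := hF; have [uv uw vw] := hd _ _ _ t.
split; [by rewrite !h1 | exact/h2/(tri_adj12 hF t) | exact/h2/(tri_adj23 hF t) | exact/h2/(tri_adj13 hF t) |].
exact: h3.
Qed.

Definition face_det u v w (x : @form R) : R := e (cross (n u) (n v) (n w)) x.

Lemma span3 (u v w z : @form R) : e (cross u v w) (cross u v w) != 0 -> e (cross u v w) z = 0 ->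
  exists c1 c2 c3, forall m, e m z = c1 * e m u + c2 * e m v + c3 * e m w.
Proof.
set f := cross u v w => f0 fz; exists (e (cross z v w) f / e f f), (e (cross u z w) f / e f f), (e (cross u v z) f / e f f).
move=> m; have := cramer u v w f m z; rewrite -/f fz mul0r addr0 => h.
by apply: (mulfI f0); rewrite h; field.
Qed.

Lemma span4 (u v w p z : @form R) : e (cross u v w) p != 0 ->
  exists c1 c2 c3, forall m, e m z = c1 * e m u + c2 * e m v + c3 * e m w + e (cross u v w) z / e (cross u v w) p * e m p.
Proof.
set k := e (cross u v w) p => k0.
exists (e (cross z v w) p / k), (e (cross u z w) p / k), (e (cross u v z) p / k).
move=> m; have := cramer u v w p m z; rewrite -/k => h.
by apply: (mulfI k0); rewrite h; field.
Qed.

(* The coefficient of a vertex of a face is read off at the crossing point of the other two. *)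
Lemma coef_gt0 u v w c1 c2 c3 :
  tri u v w -> (forall P, null_ray P -> [\/ e (n u) P = 0 /\ e (n v) P = 0, e (n v) P = 0 /\ e (n w) P = 0 | e (n u) P = 0 /\ e (n w) P = 0] ->
     0 < c1 * e P (n u) + c2 * e P (n v) + c3 * e P (n w)) ->
  [/\ 0 < c1, 0 < c2 & 0 < c3].
Proof.
move=> t h; have [_ [[P [ptP uP vP]] _] [[Q [ptQ vQ wQ]] _] [[S [ptS uS wS]] _] nt] := tri_thin3 t.
have k3 : 0 < e (n w) P by apply: nt => //; rewrite ?uP ?vP.
have k1 : 0 < e (n u) Q by apply: (notriple23 (notriple12 (notriple23 nt))) => //; rewrite ?wQ ?vQ.
have k2 : 0 < e (n v) S by apply: (notriple23 nt) => //; rewrite ?wS ?uS.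
have := h P ptP (Or31 _ _ (conj uP vP)).
have := h Q ptQ (Or32 _ _ (conj vQ wQ)).
have := h S ptS (Or33 _ _ (conj uS wS)).
rewrite !(eC P) !(eC Q) !(eC S) uP vP vQ wQ uS wS !mulr0 !addr0 !add0r.
by rewrite !pmulr_lgt0.
Qed.

Lemma notin3 (u v w x : V) : x \notin [set u; v; w]%SET -> [/\ x != u, x != v & x != w].
Proof. by rewrite !inE !negb_or -!andbA => /and3P[]. Qed.

Lemma out_pos u v w x P : tri u v w -> x \notin [set u; v; w]%SET -> null_ray P ->
  [\/ e (n u) P = 0 /\ e (n v) P = 0, e (n v) P = 0 /\ e (n w) P = 0 | e (n u) P = 0 /\ e (n w) P = 0] ->
  0 < e (n x) P.
Proof.
move=> t /notin3[xu xv xw] ptP h; have [_ _ h3] := hn; have [hd _ _ _ _] := hF.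
have [uv uw vw] := hd _ _ _ t.
case: h => -[h1 h2]; [apply: (h3 u v x) | apply: (h3 v w x) | apply: (h3 u w x)] => //;
  by rewrite ?h1 ?h2 // eq_sym.
Qed.

(** Otherwise some [z] on the segment from [n x] to [n y] is in the span of the face, with positive
    coefficients since [x] and [y] are positive at the crossing points of the face. At a crossing
    point of [x] and [y], however, [z] vanishes and the three vectors of the face are positive. *)
Lemma side_adj u v w x y : tri u v w -> x \notin [set u; v; w]%SET -> y \notin [set u; v; w]%SET ->
  adj x y -> 0 < face_det u v w (n x) * face_det u v w (n y).
Proof.
move=> t xf yf xy; rewrite ltNge; apply/negP; set a := face_det _ _ _ _; set b := face_det _ _ _ _ => ab.
have f0 : e (cross (n u) (n v) (n w)) (cross (n u) (n v) (n w)) != 0.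
  by rewrite lt_eqF//; apply: thin3_cross_lt0; exact: tri_thin3.
have [s [s0 s1 sE]] : exists s, [/\ 0 <= s, s <= 1 & (1 - s) * a + s * b = 0].
  have [ab0|ab0] := eqVneq a b.
    by exists 0; split => //; move: ab; rewrite -ab0; nra.
  have d0 : a - b != 0 by rewrite subr_eq0.
  have dd : 0 < (a - b) ^+ 2 by rewrite lt_neqAle eq_sym sqrf_eq0 d0 sqr_ge0.
  exists (a / (a - b)); split; last by field.
    have e1 : a / (a - b) * (a - b) ^+ 2 = a ^+ 2 - a * b by field.
    by rewrite -(pmulr_lge0 _ dd) e1; have := sqr_ge0 a; lra.
  have e2 : (1 - a / (a - b)) * (a - b) ^+ 2 = b ^+ 2 - a * b by field.
  by rewrite -subr_ge0 -(pmulr_lge0 _ dd) e2; have := sqr_ge0 b; lra.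
pose z := fD (fZ (1 - s) (n x)) (fZ s (n y)).
have fz : e (cross (n u) (n v) (n w)) z = 0 by rewrite /z eDr !eZr.
have [c1 [c2 [c3 zE]]] := span3 f0 fz.
have zP P : e P z = (1 - s) * e (n x) P + s * e (n y) P by rewrite /z eDr !eZr !(eC P).
have [|c1p c2p c3p] := @coef_gt0 u v w c1 c2 c3 t.
  move=> P ptP hP; rewrite -zE zP.
  have h1 := out_pos t xf ptP hP; have h2 := out_pos t yf ptP hP; nra.
have [_ h2 h3] := hn; have [[q [ptq xq yq]] _] := h2 _ _ xy.
have [xu xv xw] := notin3 xf; have [yu yv yw] := notin3 yf.
have xyn : x != y by case/andP: xy.
have pos i : x != i -> y != i -> 0 < e (n i) q by move=> xi yi; apply: (h3 x y i) => //; rewrite ?xq ?yq.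
have := zE q; rewrite zP xq yq !mulr0 addr0 !(eC q) => h.
have := mulr_gt0 c1p (pos u xu yu); have := mulr_gt0 c2p (pos v xv yv); have := mulr_gt0 c3p (pos w xw yw); lra.
Qed.

(** The argument of [side_adj] with [z = n x], evaluated at a crossing point of [x] and [u], where
    [v] and [w] are still positive. *)
Lemma side_nz u v w x : tri u v w -> x \notin [set u; v; w]%SET -> adj x u -> face_det u v w (n x) != 0.
Proof.
move=> t xf xu; apply/eqP => d0.
have f0 : e (cross (n u) (n v) (n w)) (cross (n u) (n v) (n w)) != 0.
  by rewrite lt_eqF//; apply: thin3_cross_lt0; exact: tri_thin3.
have [c1 [c2 [c3 zE]]] := span3 f0 d0.
have [|c1p c2p c3p] := @coef_gt0 u v w c1 c2 c3 t.
  by move=> P ptP hP; rewrite -zE eC; exact: out_pos hP.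
have [_ h2 h3] := hn; have [[q [ptq xq uq]] _] := h2 _ _ xu.
have [xu' xv xw] := notin3 xf; have [hd _ _ _ _] := hF; have [uv uw vw] := hd _ _ _ t.
have pv : 0 < e (n v) q by apply: (h3 x u v) => //; rewrite ?xq ?uq.
have pw : 0 < e (n w) q by apply: (h3 x u w) => //; rewrite ?xq ?uq.
have := zE q; rewrite !(eC q) xq uq mulr0 add0r => h.
have := mulr_gt0 c2p pv; have := mulr_gt0 c3p pw; lra.
Qed.

(* A face is a facet of the convex hull of the vectors [n]. *)
Lemma side_const u v w : tri u v w ->
  exists s : bool, forall x, x \notin [set u; v; w]%SET -> 0 < (-1) ^+ s * face_det u v w (n x).
Proof.
move=> t; have [hd h2 hc _ _] := hF; have [x0 x0w t'] := h2 _ _ _ t.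
have [uv ux vx] := hd _ _ _ t'.
have x0f : x0 \notin [set u; v; w]%SET by rewrite !inE !negb_or ![x0 == _]eq_sym ux vx eq_sym.
have x0u : adj x0 u by rewrite adjC; exact: tri_adj13 hF t'.
(* The sign is read off at the vertex across the side [u v]: being adjacent to [u], it is off the
   hyperplane of the face. *)
have d0 := side_nz t x0f x0u.
have sgn (d : R) : d != 0 -> 0 < (-1) ^+ (d < 0)%R * d.
  move=> d1; have [h|h|h] := ltrgtP d 0; last by rewrite h eqxx in d1.
  - by rewrite expr1 mulN1r oppr_gt0.
  - by rewrite expr0 mul1r.
exists (face_det u v w (n x0) < 0)%R => x xf; set s := (face_det u v w (n x0) < 0)%R.
have := hc _ x0 [set x | (x \notin [set u; v; w]%SET) && (0 < (-1) ^+ s * face_det u v w (n x))]%SET t.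
have sx0 : 0 < (-1) ^+ s * face_det u v w (n x0) := sgn _ d0.
rewrite finset.in_set x0f sx0 => /(_ isT isT) h.
suff : x \in [set x | (x \notin [set u; v; w]%SET) && (0 < (-1) ^+ s * face_det u v w (n x))]%SET by rewrite finset.in_set => /andP[].
apply: h => // y z; rewrite finset.in_set => /andP[yf yp] zf yz; rewrite finset.in_set zf /=.
have := side_adj t yf zf yz; move: yp; case: (s); rewrite /= ?expr0 ?expr1; nra.
Qed.

(** [x] and [q] are on opposite sides of the face, so the coefficient of [q] is negative. At the
    crossing points of the face [x] is positive and the term of [q] at most 0, so the other three
    terms have a positive sum. *)
Lemma expand_out u v w x q s : tri u v w -> x \notin [set u; v; w]%SET -> null_ray q ->
  (forall x, x \notin [set u; v; w]%SET -> 0 < (-1) ^+ s * face_det u v w (n x)) ->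
  (-1) ^+ s * face_det u v w q < 0 ->
  exists c1 c2 c3 mu, [/\ 0 < c1, 0 < c2, 0 < c3 &
    forall m, e m (n x) = c1 * e m (n u) + c2 * e m (n v) + c3 * e m (n w) + mu * e m q].
Proof.
move=> t xf ptq hs qs.
have q0 : face_det u v w q != 0 by apply/eqP => h; move: qs; rewrite h mulr0 ltxx.
have [c1 [c2 [c3 xE]]] := span4 (n x) q0.
set mu := (_ / _) in xE.
have mu0 : mu < 0.
  have := hs x xf; rewrite /mu -/(face_det u v w (n x)) -/(face_det u v w q); move: (face_det u v w (n x)) (face_det u v w q) q0 qs => a b b0 qs h.
  rewrite -(pmulr_llt0 _ (_ : 0 < b ^+ 2)); last by rewrite lt_neqAle eq_sym sqrf_eq0 b0 sqr_ge0.
  have -> : a / b * b ^+ 2 = a * b by field.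
  by move: qs h; case: (s); rewrite /= ?expr0 ?expr1 => qs h; nra.
have [|c1p c2p c3p] := @coef_gt0 u v w c1 c2 c3 t.
  move=> P ptP hP; have h1 := out_pos t xf ptP hP.
  have h2 := null_ray_ge0 ptP ptq; have := xE P; rewrite (eC P (n x)); nra.
by exists c1, c2, c3, mu.
Qed.

Section Center.
Variables (o a b : V) (s0 : bool) (p : @form R).
Hypotheses (t0 : tri o a b)
  (hs0 : forall x, x \notin [set o; a; b]%SET -> 0 < (-1) ^+ s0 * face_det o a b (n x))
  (ptp : null_ray p) (po : e (n o) p = 1) (pa : e (n a) p = 1) (pb : e (n b) p = 1)
  (sp : (-1) ^+ s0 * face_det o a b p < 0).

Lemma center_out x : 0 < e (n x) p.
Proof.
have [xf|xf] := boolP (x \in [set o; a; b]%SET).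
  by move: xf; rewrite !inE => /orP[/orP[]|] /eqP ->; rewrite ?po ?pa ?pb.
have [c1 [c2 [c3 [mu [c1p c2p c3p xE]]]]] := expand_out t0 xf ptp hs0 sp.
have pp : e p p = 0 by case: ptp.
by rewrite eC xE !(eC p) po pa pb pp; lra.
Qed.

(** The functional is 1 on [o] and 0 on [a], [b] and [p]. Divided by the product with [p], it is an
    affine function in the chart at [p] whose maximum 1 is attained at [o] alone, so [o] is
    extreme. *)
Lemma center_functional x : x != o -> e (fZ (- (face_det o a b p)^-1) (cross p (n a) (n b))) (n x) < e (n x) p.
Proof.
set g := fZ _ _ => xo.
have p0 : face_det o a b p != 0 by apply/eqP => h; move: sp; rewrite h mulr0 ltxx.
have go : e g (n o) = 1.
  rewrite /g eZl; have -> : e (cross p (n a) (n b)) (n o) = - face_det o a b p.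
    by rewrite /face_det; case: (n o) (n a) (n b) p => [? ? ? ?] [? ? ? ?] [? ? ? ?] [? ? ? ?]; rewrite /mink /cross /det3 /=; field.
  by field.
have ga : e g (n a) = 0 by rewrite /g eZl cross_orth2 mulr0.
have gb : e g (n b) = 0 by rewrite /g eZl cross_orth3 mulr0.
have gp : e g p = 0 by rewrite /g eZl cross_orth1 mulr0.
have [xf|xf] := boolP (x \in [set o; a; b]%SET).
  by move: xf; rewrite !inE (negbTE xo)/= => /orP[] /eqP ->; rewrite ?ga ?gb ?pa ?pb.
have [c1 [c2 [c3 [mu [c1p c2p c3p xE]]]]] := expand_out t0 xf ptp hs0 sp.
have pp : e p p = 0 by case: ptp.
by rewrite (eC _ p) !xE !(eC p) po pa pb pp go ga gb gp; lra.
Qed.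

Lemma center_functional_o : e (fZ (- (face_det o a b p)^-1) (cross p (n a) (n b))) (n o) = e (n o) p.
Proof.
have p0 : face_det o a b p != 0 by apply/eqP => h; move: sp; rewrite h mulr0 ltxx.
rewrite eZl; have -> : e (cross p (n a) (n b)) (n o) = - face_det o a b p.
  by rewrite /face_det; case: (n o) (n a) (n b) p => [? ? ? ?] [? ? ? ?] [? ? ? ?] [? ? ? ?]; rewrite /mink /cross /det3 /=; field.
by rewrite po; field.
Qed.

(* If the centre were beyond another face not containing [o], then [o] would be a convex combination of other vertices in the affine chart at [p], although it is extreme there. *)
Lemma center_side_aux u v w s : tri u v w -> o \notin [set u; v; w]%SET ->
  (forall x, x \notin [set u; v; w]%SET -> 0 < (-1) ^+ s * face_det u v w (n x)) ->
  0 < (-1) ^+ s * face_det u v w p.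
Proof.
move=> t of_ hs; rewrite ltNge; apply/negP; rewrite le_eqVlt => /orP[|ps].
  (* Borderline case: [p] would be a positive combination of three vectors having positive product
     with [p], against [e p p = 0]. *)
  rewrite mulf_eq0 signr_eq0/= => /eqP d0.
  have f0 : e (cross (n u) (n v) (n w)) (cross (n u) (n v) (n w)) != 0.
    by rewrite lt_eqF//; apply: thin3_cross_lt0; exact: tri_thin3.
  have [c1 [c2 [c3 pE]]] := span3 f0 d0.
  have [|c1p c2p c3p] := @coef_gt0 u v w c1 c2 c3 t.
    move=> P ptP hP; rewrite -pE eC.
    have [i iP] : exists i, e (n i) P = 0 by case: hP => -[? ?]; [exists u | exists v | exists u].
    by apply: (null_ray_sep_gt0 (n := n i)) => //; rewrite gt_eqF// center_out.
  have pp : e p p = 0 by case: ptp.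
  have := pE p; rewrite pp !(eC p) => h.
  have := mulr_gt0 c1p (center_out u); have := mulr_gt0 c2p (center_out v); have := mulr_gt0 c3p (center_out w); lra.
have [c1 [c2 [c3 [mu [c1p c2p c3p oE]]]]] := expand_out t of_ ptp hs ps.
have [ou ov ow] := notin3 of_.
have := oE (fZ (- (face_det o a b p)^-1) (cross p (n a) (n b))); rewrite center_functional_o.
have gp : e (fZ (- (face_det o a b p)^-1) (cross p (n a) (n b))) p = 0 by rewrite eZl cross_orth1 mulr0.
rewrite gp mulr0 addr0.
have pp : e p p = 0 by case: ptp.
have := oE p; rewrite pp mulr0 addr0 !(eC p) => ->.
move: ou ov ow; rewrite !(eq_sym o) => ou ov ow.
have := center_functional ou; have := center_functional ov; have := center_functional ow; nra.
Qed.

End Center.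

End Configuration.

(** * Normalisation at a face *)

Section Normalisation.
Context {R : realType} {V : finType} (F : {set {set V}}) (n : V -> @form R).
Hypothesis hF : tight_complex F.
Hypothesis hn : thin_config F n.

Local Notation tri := (tri F).
Local Notation adj := (adj F).
Local Notation fdet := (face_det n).

Lemma face_det12 u v w x : fdet u v w x = - fdet v u w x.
Proof.
by rewrite /face_det; case: (n u) (n v) (n w) x => [? ? ? ?] [? ? ? ?] [? ? ? ?] [? ? ? ?]; rewrite /mink /cross /det3 /=; field.
Qed.

Lemma face_det13 u v w x : fdet u v w x = - fdet w v u x.
Proof.
by rewrite /face_det; case: (n u) (n v) (n w) x => [? ? ? ?] [? ? ? ?] [? ? ? ?] [? ? ? ?]; rewrite /mink /cross /det3 /=; field.
Qed.

Lemma set3C12 (u v w : V) : [set u; v; w]%SET = [set v; u; w]%SET.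
Proof. by rewrite (finset.setUC [set u]%SET). Qed.

Lemma set3C13 (u v w : V) : [set u; v; w]%SET = [set w; v; u]%SET.
Proof. by rewrite finset.setUAC set3C12 finset.setUAC. Qed.

Lemma signrN_negb (s : bool) (x : R) : (-1) ^+ (~~ s) * - x = (-1) ^+ s * x.
Proof. by case: s; rewrite /= ?expr0 ?expr1; ring. Qed.

(** In the last clause [p] is on the same side as the vertices, for every face but the fixed one.
    The products 1 make the three radii of the fixed face equal to 1/2. *)
Definition central (o a b : V) (p : @form R) :=
  [/\ null_ray p, [/\ e (n o) p = 1, e (n a) p = 1 & e (n b) p = 1], forall x, 0 < e (n x) p &
    forall u v w, tri u v w -> [set u; v; w]%SET != [set o; a; b]%SET ->
      exists s : bool, (forall x, x \notin [set u; v; w]%SET -> 0 < (-1) ^+ s * fdet u v w (n x)) /\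
        0 < (-1) ^+ s * fdet u v w p].

Lemma central_exists o a b : tri o a b -> exists p, central o a b p.
Proof.
move=> t0; have [s0 hs0] := side_const hF hn t0.
(* The negated sign puts [p] beyond the face, away from all other vertices. *)
have [p [ptp po pa pb]] := thin3_center (~~ s0) (tri_thin3 hF hn t0).
rewrite -/(fdet o a b p) => sp'.
have sp : (-1) ^+ s0 * fdet o a b p < 0.
  by move: sp'; case: (s0); rewrite /= ?expr0 ?expr1; lra.
have out := center_out hF hn t0 hs0 ptp po pa pb sp.
exists p; split; [exact: ptp | by split | exact: out |].
move=> u v w t ne; have [s hs] := side_const hF hn t; exists s; split => //.
have [hd _ _ _ _] := hF; have [oa ob ab] := hd _ _ _ t0; have [uv uw vw] := hd _ _ _ t.
have c3 (x y z : V) : x != y -> x != z -> y != z -> #|[set x; y; z]%SET| = 3%N.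
  by move=> xy xz yz; rewrite -!finset.setUA cardsU1 !inE negb_or xy xz cards2 yz.
have : ~~ ([set o; a; b]%SET \subset [set u; v; w]%SET).
  apply: contra ne => sub; rewrite eq_sym eqEcard sub !c3//.
(* Another face misses one of [o], [a], [b], which then takes the role of [o]; the transposition
   reverses the determinant, hence the sign [~~ s0]. *)
case/subsetPn => y; rewrite !inE -orbA => /or3P[] /eqP -> yf.
- by apply: (@center_side_aux _ _ _ _ hF hn o a b s0 p t0 hs0 ptp po pa pb sp u v w s t) => //; rewrite !inE.
- have t1 : tri a o b by rewrite tri12.
  apply: (@center_side_aux _ _ _ _ hF hn a o b (~~ s0) p t1 _ ptp pa po pb _ u v w s t) => //.
  + by move=> x; rewrite set3C12 face_det12 signrN_negb; exact: hs0.
  + by rewrite face_det12 signrN_negb.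
  + by rewrite !inE.
- have t1 : tri b a o by rewrite tri12 tri23 tri12.
  apply: (@center_side_aux _ _ _ _ hF hn b a o (~~ s0) p t1 _ ptp pb pa po _ u v w s t) => //.
  + by move=> x; rewrite set3C13 face_det13 signrN_negb; exact: hs0.
  + by rewrite face_det13 signrN_negb.
  + by rewrite !inE.
Qed.

(* In the chart sending [p] to infinity: seen from [v], no neighbour lies in the sector of a face. *)
Lemma sector_empty o a b p v u w x s t la mu : central o a b p ->
  tri v u w -> [set v; u; w]%SET != [set o; a; b]%SET -> adj v x -> x \notin [set v; u; w]%SET ->
  0 <= s -> 0 <= t ->
  (forall m, e m (n x) = s * e m (n u) + t * e m (n w) + la * e m (n v) + mu * e m p) -> False.
Proof.
move=> [ptp _ po hc] tf ne vx xf s0 t0 xE; have [sg [hs hp]] := hc _ _ _ tf ne.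
have mu0 : 0 < mu.
  have := hs x xf; rewrite {1}/face_det xE cross_orth1 cross_orth2 cross_orth3 !mulr0 !add0r.
  by rewrite -/(fdet v u w p) mulrCA pmulr_lgt0.
(* At a crossing point of [v] and [x] the terms of [v] and [x] vanish, while [u], [w] and [p] are
   positive there. *)
have [_ h2 h3] := hn; have [[q [ptq vq xq]] _] := h2 _ _ vx.
have [xv xu xw] := notin3 xf; have [hd _ _ _ _] := hF; have [vu vw uw] := hd _ _ _ tf.
have pu : 0 < e (n u) q by apply: (h3 v x u) => //; rewrite ?vq ?xq// eq_sym.
have pw : 0 < e (n w) q by apply: (h3 v x w) => //; rewrite ?vq ?xq// eq_sym.
have pp : 0 < e p q by apply: (null_ray_sep_gt0 (n := n v)) => //; rewrite gt_eqF.
have := xE q; rewrite !(eC q) xq vq; nra.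
Qed.

Lemma central_indep o a b p v u w : central o a b p ->
  tri v u w -> [set v; u; w]%SET != [set o; a; b]%SET -> fdet v u w p != 0.
Proof.
move=> [_ _ _ hc] tf ne; have [sg [_ hp]] := hc _ _ _ tf ne.
by apply/eqP => h; move: hp; rewrite h mulr0 ltxx.
Qed.

End Normalisation.

(** * Charts sending a point to infinity *)

Section Chart.
Context {R : realType}.
Local Notation Re := complex.Re.
Local Notation Im := complex.Im.

(* The function [|x - z|^2] of [x], and 1 for the point at infinity. *)
Definition point_form (z : riemann_sphere R) : @form R :=
  if z is Some w then Form 1 (- Re w) (- Im w) (Re w ^+ 2 + Im w ^+ 2) else Form 0 0 0 1.

Lemma null_ray_point z : null_ray (point_form z).
Proof.
case: z => [[x y]|]; rewrite /null_ray /mink /=; split; try lra.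
  by rewrite addr_ge0 ?sqr_ge0.
by rewrite ltr_pwDl// addr_ge0 ?sqr_ge0.
Qed.

(* A Moebius transformation sending the null vector [p] to infinity, together
   with the isometry it induces on forms. *)
Lemma chart (p : @form R) : null_ray p ->
  exists (a b c d : R[i]) (L : @form R -> @form R), [/\ a * d - b * c != 0,
    forall x y, e (L x) (L y) = e x y, L p = Form 0 0 0 1 &
    forall z, exists2 k, 0 < k & forall m, e m (point_form z) = k * e (L m) (point_form (moebius_map a b c d z))].
Proof.
move=> [/null_eq pp pA pC pAC]; case: (eqVneq (fA p) 0) => [A0|A0].
  have [X0 Y0] : fX p = 0 /\ fY p = 0 by apply: sumsq_eq0; rewrite -pp A0 mul0r.
  have C0 : 0 < fC p by move: pAC; rewrite A0 add0r.
  have C1 := lt0r_neq0 C0.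
  set C := fC p in C0 C1.
  exists 1, 0, 0, (real_complex R C), (fun m => Form (C * fA m) (fX m) (fY m) (fC m / C)); split.
  - by rewrite mul0r subr0 mul1r; apply: contra C1; rewrite eq_complex /= eqxx andbT.
  - by move=> [? ? ? ?] [? ? ? ?]; rewrite /mink /=; field.
  - by rewrite A0 X0 Y0 mulr0 -/C divff.
  - case=> [[x y]|] /=; last first.
      by exists C^-1; rewrite ?invr_gt0// eqxx => -[? ? ? ?]; rewrite /mink /=; field.
    have cC0 : real_complex R C != 0 by apply: contra C1; rewrite eq_complex /= eqxx andbT.
    rewrite mul0r add0r mul1r addr0 (negbTE cC0).
    have -> : Complex x y / real_complex R C = Complex (x / C) (y / C).
      apply: (mulIf cC0); rewrite divfK//; apply/eqP; rewrite eq_complex /=.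
      by apply/andP; split; apply/eqP; field.
    by exists C => // -[? ? ? ?]; rewrite /mink /=; field.
have A1 : 0 < fA p by rewrite lt_neqAle eq_sym A0.
set A := fA p in A0 A1 pp.
pose x0 := - fX p / A; pose y0 := - fY p / A.
have pX : fX p = - A * x0 by rewrite /x0; field.
have pY : fY p = - A * y0 by rewrite /y0; field.
have pC' : fC p = A * (x0 ^+ 2 + y0 ^+ 2).
  by apply: (mulfI A0); rewrite pp pX pY; ring.
pose Q (m : @form R) := fA m * (x0 ^+ 2 + y0 ^+ 2) + 2 * (fX m * x0 + fY m * y0) + fC m.
(* The map [z -> 1 / (A (z - z0))], with [z0 = (x0, y0)] the point represented by [p]; [Q m] is the
   value of the form [m] at [z0]. The factor [A] makes the image of [p] exactly the standard
   vector. *)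
exists 0, 1, (real_complex R A), (- (real_complex R A * Complex x0 y0)),
  (fun m => Form (A * Q m) (fA m * x0 + fX m) (- (fA m * y0 + fY m)) (fA m / A)); split.
- by rewrite mul0r sub0r mul1r oppr_eq0; apply: contra A0; rewrite eq_complex /= eqxx andbT.
- by move=> [? ? ? ?] [? ? ? ?]; rewrite /mink /Q /=; field.
- by rewrite /Q -/A pX pY pC'; apply: form_eq => /=; field.
- have cA0 : real_complex R A != 0 by apply: contra A0; rewrite eq_complex /= eqxx andbT.
  case=> [[x y]|] /=; last first.
    by exists A => //; rewrite (negbTE cA0) mul0r => -[? ? ? ?]; rewrite /mink /Q /=; field.
  have -> : real_complex R A * Complex x y - real_complex R A * Complex x0 y0 = real_complex R A * Complex (x - x0) (y - y0).
    by rewrite -mulrBr; congr (_ * _); rewrite /GRing.add /=; apply/eqP; rewrite eq_complex /= !eqxx.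
  rewrite mulf_eq0 (negbTE cA0) /=.
  case: eqP => [[/subr0_eq -> /subr0_eq ->]|zn].
    exists A^-1; rewrite ?invr_gt0// => -[? ? ? ?]; rewrite /mink /Q /=; field.
    exact: A0.
  pose N := (x - x0) ^+ 2 + (y - y0) ^+ 2.
  have N0 : 0 < N.
    rewrite lt_neqAle addr_ge0 ?sqr_ge0// andbT eq_sym; apply/eqP => h.
    have [h1 h2] : x - x0 = 0 /\ y - y0 = 0 by apply: sumsq_eq0; rewrite -/N h.
    by apply: zn; rewrite h1 h2.
  have N1 := lt0r_neq0 N0.
  exists (A * N); first by rewrite mulr_gt0.
  have -> : (0 * Complex x y + 1) / (real_complex R A * Complex (x - x0) (y - y0)) =
      Complex ((x - x0) / (A * N)) (- (y - y0) / (A * N)).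
    rewrite mul0r add0r mul1r; apply: (mulIf (x := real_complex R A * Complex (x - x0) (y - y0))).
      by rewrite mulf_neq0//; apply/eqP.
    rewrite mulVf; last by rewrite mulf_neq0//; apply/eqP.
    apply/eqP; rewrite eq_complex /=; apply/andP; split; apply/eqP; rewrite /N; move: N1; rewrite /N => N1; field;
      by rewrite N1 A0.
  by move=> [? ? ? ?]; rewrite /mink /Q /= /N; move: N1; rewrite /N => N1; field; rewrite N1 A0.
Qed.

End Chart.

Section PlaneConfiguration.
Context {R : realType} {V : finType} (F : {set {set V}}).

(** The configuration seen in the chart. [pc_edge] is the law of cosines, [I] being the cosine of
    the overlap angle. The radius is the inverse of [2 * e (n v) p], whence 1/2 on the fixed
    face. *)
Record plane_config (I : V -> V -> R) (f0 : {set V}) (cx cy r : V -> R) : Prop := PlaneConfig {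
  pc_r : forall v, 0 < r v;
  pc_f0 : forall v, v \in f0 -> r v = 2^-1;
  pc_edge : forall u v, adj F u v ->
    (cx u - cx v) ^+ 2 + (cy u - cy v) ^+ 2 = r u ^+ 2 + r v ^+ 2 + 2 * I u v * r u * r v;
  pc_indep : forall v u w, tri F v u w -> [set v; u; w]%SET != f0 ->
    (cx u - cx v) * (cy w - cy v) - (cy u - cy v) * (cx w - cx v) != 0;
  pc_sector : forall v u w x s t, tri F v u w -> [set v; u; w]%SET != f0 -> adj F v x ->
    x \notin [set v; u; w]%SET -> 0 <= s -> 0 <= t ->
    cx x - cx v = s * (cx u - cx v) + t * (cx w - cx v) ->
    cy x - cy v = s * (cy u - cy v) + t * (cy w - cy v) -> False }.

(** [L] is only known to preserve [e] and may reverse orientation, so non-vanishing is transferred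
    through squares. *)
Lemma det_inf (u v w : @form R) (L : @form R -> @form R) p :
  (forall x y, e (L x) (L y) = e x y) -> L p = Form 0 0 0 1 ->
  fA (L u) != 0 -> fA (L v) != 0 -> fA (L w) != 0 -> e (cross u v w) p != 0 ->
  (fX (L v) / fA (L v) - fX (L u) / fA (L u)) * (fY (L w) / fA (L w) - fY (L u) / fA (L u)) -
  (fY (L v) / fA (L v) - fY (L u) / fA (L u)) * (fX (L w) / fA (L w) - fX (L u) / fA (L u)) != 0.
Proof.
move=> LE Lp.
case Eu : (L u) => [A X Y C]; case Ev : (L v) => [A' X' Y' C']; case Ew : (L w) => [A'' X'' Y'' C''] /= A0 A0' A0''.
apply: contra => /eqP h.
have dep : e (cross (L u) (L v) (L w)) (L p) = 0.
  rewrite Lp Eu Ev Ew /mink /cross /det3 /=.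
  transitivity (A * A' * A'' * ((X' / A' - X / A) * (Y'' / A'' - Y / A) - (Y' / A' - Y / A) * (X'' / A'' - X / A))).
    by field; rewrite A0 A0' A0''.
  by rewrite h mulr0.
(* the Gram determinant of [u, v, w, p] is an invariant, and it is a multiple of the squared determinant *)
have gram (a b c d : @form R) : e (cross a b c) d ^+ 2 =
    - 4 * (det3 (e a a) (e a b) (e a c) (e b a) (e b b) (e b c) (e c a) (e c b) (e c c) * e d d
     - (det3 (e a d) (e a b) (e a c) (e b d) (e b b) (e b c) (e c d) (e c b) (e c c) * e d a
      + det3 (e a a) (e a d) (e a c) (e b a) (e b d) (e b c) (e c a) (e c d) (e c c) * e d b
      + det3 (e a a) (e a b) (e a d) (e b a) (e b b) (e b d) (e c a) (e c b) (e c d) * e d c)).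
  by case: a b c d => [? ? ? ?] [? ? ? ?] [? ? ? ?] [? ? ? ?]; rewrite /mink /cross /det3 /=; field.
have g2 := gram (L u) (L v) (L w) (L p).
by move: g2; rewrite dep expr0n !LE -gram => /eqP; rewrite eq_sym sqrf_eq0.
Qed.

Lemma plane_of_central (n : V -> @form R) (o a b : V) p (L : @form R -> @form R) :
  tight_complex F -> thin_config F n -> tri F o a b -> central F n o a b p ->
  (forall x y, e (L x) (L y) = e x y) -> L p = Form 0 0 0 1 ->
  plane_config (fun u v => e (n u) (n v)) [set o; a; b]%SET
    (fun v => - (fX (L (n v)) / fA (L (n v)))) (fun v => - (fY (L (n v)) / fA (L (n v)))) (fun v => (fA (L (n v)))^-1).
Proof.
move=> hF hn t0 hc LE Lp; have [ptp [po pa pb] pout _] := hc; have [n1 _ _] := hn.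
have AE v : fA (L (n v)) = 2 * e (n v) p by rewrite -LE Lp /mink /=; field.
have A0 v : 0 < fA (L (n v)) by rewrite AE mulr_gt0.
have A1 v : fA (L (n v)) != 0 by rewrite lt0r_neq0.
have CE v : fC (L (n v)) = (fX (L (n v)) ^+ 2 + fY (L (n v)) ^+ 2 - 1) / fA (L (n v)).
  apply: (mulfI (A1 v)); have := n1 v; rewrite -LE mulrCA divff// mulr1 /mink; lra.
split.
- by move=> v; rewrite invr_gt0.
- by move=> v; rewrite !inE => /orP[/orP[]|] /eqP ->; rewrite AE ?po ?pa ?pb mulr1.
- move=> u v uv; rewrite -LE /mink !CE; move: (A1 u) (A1 v).
  by move: (fA (L (n u))) (fX (L (n u))) (fY (L (n u))) (fA (L (n v))) (fX (L (n v))) (fY (L (n v))) => A X Y A' X' Y' A10 A10'; field; rewrite A10 A10'.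
- move=> v u w t ne; have := det_inf LE Lp (A1 v) (A1 u) (A1 w) (central_indep hc t ne).
  by apply: contra => /eqP h; apply/eqP; move: h; lra.
- move=> v u w x s t tf ne vx xf s0 t0' hx hy.
  (* The affine combination of centres with weights [s], [t], [1 - s - t], rescaled by the leading
     coefficients; [mu] absorbs the constant term, the only nonzero entry of [L p]. *)
  pose S := fA (L (n x)) * s / fA (L (n u)); pose T := fA (L (n x)) * t / fA (L (n w)).
  pose la := fA (L (n x)) * (1 - s - t) / fA (L (n v)).
  pose mu := fC (L (n x)) - S * fC (L (n u)) - T * fC (L (n w)) - la * fC (L (n v)).
  apply: (sector_empty (s := S) (t := T) (la := la) (mu := mu) hF hn hc tf ne vx xf).
  + by rewrite /S divr_ge0 ?mulr_ge0// ltW.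
  + by rewrite /T divr_ge0 ?mulr_ge0// ltW.
  + have xE : L (n x) = fD (fD (fZ S (L (n u))) (fZ T (L (n w)))) (fD (fZ la (L (n v))) (fZ mu (L p))).
      have hx' : fX (L (n x)) / fA (L (n x)) = s * (fX (L (n u)) / fA (L (n u))) + t * (fX (L (n w)) / fA (L (n w))) + (1 - s - t) * (fX (L (n v)) / fA (L (n v))) by lra.
      have hy' : fY (L (n x)) / fA (L (n x)) = s * (fY (L (n u)) / fA (L (n u))) + t * (fY (L (n w)) / fA (L (n w))) + (1 - s - t) * (fY (L (n v)) / fA (L (n v))) by lra.
      have {}hx : fX (L (n x)) = fA (L (n x)) * (fX (L (n x)) / fA (L (n x))) by rewrite mulrCA divff// mulr1.
      have {}hy : fY (L (n x)) = fA (L (n x)) * (fY (L (n x)) / fA (L (n x))) by rewrite mulrCA divff// mulr1.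
      apply: form_eq; rewrite Lp /=.
      * by rewrite /S /T /la; field; rewrite !A1.
      * by rewrite hx hx' /S /T /la; field; rewrite !A1.
      * by rewrite hy hy' /S /T /la; field; rewrite !A1.
      * by rewrite /mu; ring.
    by move=> m; rewrite -LE xE !eDr !eZr !LE; ring.
Qed.

End PlaneConfiguration.

(** * From metric disks to vectors *)

Section DiskForms.
Context {R : realType}.
Local Notation Re := complex.Re.
Local Notation Im := complex.Im.

(** The function [(cos r - <a, x>) / sin r] on the sphere, multiplied by [|z|^2 + 1] in the
    stereographic coordinate. Dividing by the sine makes the norm -1. *)
Definition disk_form (A : disk R) : @form R :=
  let a := stereo (center A) in let c := cos (radius A) in let s := sin (radius A) in
  Form ((c - a 0 o2) / s) (- a 0 o0 / s) (- a 0 o1 / s) ((c + a 0 o2) / s).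

Definition point_scale (z : riemann_sphere R) : R :=
  if z is Some w then (Re w ^+ 2 + Im w ^+ 2 + 1) / 2 else 2^-1.

Lemma point_scale_gt0 z : 0 < point_scale z.
Proof.
case: z => [[x y]|] /=; last by rewrite invr_gt0.
by rewrite divr_gt0// sqn1_gt0.
Qed.

Lemma stereo_sphere (z : riemann_sphere R) : dot (stereo z) (stereo z) = 1.
Proof.
case: z => [[x y]|]; last by rewrite dot3 !mxE /=; ring.
exact: (inv_stereo_sphere (x, y)).
Qed.

Lemma dot_parseval (p q t : 'rV[R]_3) : dot p p = 1 -> dot q q = 1 -> dot t t = 1 ->
  dot p q = 0 -> dot p t = 0 -> dot q t = 0 ->
  forall x y, dot x y = dot x p * dot y p + dot x q * dot y q + dot x t * dot y t.
Proof.
move=> pp qq tt pq null_ray qt x y.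
pose M : 'M[R]_3 := \matrix_(i, j) (nth p [:: p; q; t] i) 0 j.
have ME (i j : 'I_3) : (M *m M^T) i j = dot (nth p [:: p; q; t] i) (nth p [:: p; q; t] j).
  by rewrite mxE /dot; apply: eq_bigr => k _; rewrite !mxE.
have M1 : M *m M^T = 1%:M.
  apply/matrixP => i j; rewrite ME mxE.
  by case: (ord3P i) => ->; case: (ord3P j) => -> /=; rewrite ?pp ?qq ?tt ?pq ?null_ray ?qt ?(dotC q p) ?(dotC t p) ?(dotC t q) ?pq ?null_ray ?qt.
have M2 : M^T *m M = 1%:M by exact: mulmx1C.
have dE (u v : 'rV[R]_3) : dot u v = (u *m v^T) 0 0.
  by rewrite mxE /dot; apply: eq_bigr => k _; rewrite mxE.
have -> : dot x y = ((x *m M^T) *m (M *m y^T)) 0 0 by rewrite mulmxA -(mulmxA x) M2 mulmx1 dE.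
rewrite mxE 3!big_ord_recl big_ord0 addr0 addrA.
have xM (i : 'I_3) (u : 'rV[R]_3) : (u *m M^T) 0 i = dot u (nth p [:: p; q; t] i).
  by rewrite mxE /dot; apply: eq_bigr => k _; rewrite !mxE.
have yM (i : 'I_3) : (M *m y^T) i 0 = dot y (nth p [:: p; q; t] i).
  by rewrite mxE /dot; apply: eq_bigr => k _; rewrite !mxE mulrC.
by rewrite !xM !yM.
Qed.

Lemma dot_unit_le1 (u v : 'rV[R]_3) : dot u u = 1 -> dot v v = 1 -> -1 <= dot u v <= 1.
Proof.
move=> uu vv.
have sqd (w : 'rV[R]_3) : 0 <= dot w w by rewrite /dot sumr_ge0// => i _; rewrite -expr2 sqr_ge0.
have h1 := sqd (u - v); have h2 := sqd (u - (-1) *: v).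
move: h1 h2; rewrite !dotBl !dotBr !dotZl !dotZr (dotC v u) uu vv => h1 h2.
by apply/andP; split; lra.
Qed.

Lemma acos_le (x r : R) : -1 <= x <= 1 -> 0 <= r <= pi -> (acos x <= r) = (cos r <= x).
Proof.
move=> x1 r1; rewrite -[in RHS](acosK (x := x)) ?in_itv//.
have xi : acos x \in `[0, pi] by rewrite in_itv/= acos_ge0// acos_lepi.
rewrite !leNgt; congr negb; rewrite ltr_cos//.
Qed.

Lemma acos_eq (x r : R) : -1 <= x <= 1 -> 0 <= r <= pi -> acos x = r -> cos r = x.
Proof. by move=> x1 r1 <-; rewrite acosK// in_itv. Qed.

Section OneDisk.
Variable A : disk R.
Hypothesis rA : radius A < pi.

Let sA : 0 < sin (radius A).
Proof. by apply: sin_gt0_pi; rewrite radius_gt0. Qed.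

Let rA' : 0 <= radius A <= pi.
Proof. by rewrite !ltW// radius_gt0. Qed.

Lemma disk_form_norm : e (disk_form A) (disk_form A) = -1.
Proof.
rewrite /mink /disk_form /=; have := stereo_sphere (center A); rewrite dot3.
have cs := cos2Dsin2 (radius A); move: (lt0r_neq0 sA); move: cs.
set c := cos _; set s := sin _; move: (stereo _ 0 o0) (stereo _ 0 o1) (stereo _ 0 o2) => x y z cs s0 xyz.
transitivity ((c ^+ 2 - (x * x + y * y + z * z)) / s ^+ 2); first by field.
have -> : c ^+ 2 - (x * x + y * y + z * z) = - s ^+ 2 by rewrite xyz; lra.
by field.
Qed.

Lemma disk_form_point z : e (disk_form A) (point_form z) =
  point_scale z * (cos (radius A) - dot (stereo (center A)) (stereo z)) / sin (radius A).
Proof.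
rewrite dot3 /mink /disk_form; move: (lt0r_neq0 sA); set c := cos _; set s := sin _ => s0.
case: z => [[x y]|] /=; last first.
  rewrite !mxE /=; move: (stereo _ 0 o0) (stereo _ 0 o1) (stereo _ 0 o2) => a b d.
  by field.
rewrite !mxE /=; move: (stereo _ 0 o0) (stereo _ 0 o1) (stereo _ 0 o2) => a b d.
by have n0 := lt0r_neq0 (sqn1_gt0 x y); field; rewrite s0 n0.
Qed.

Lemma disk_setE z : disk_set A z <-> e (disk_form A) (point_form z) <= 0.
Proof.
rewrite /disk_set /= /sdist disk_form_point pmulr_lle0 ?invr_gt0// pmulr_rle0 ?point_scale_gt0// subr_le0.
by rewrite acos_le// dot_unit_le1// stereo_sphere.
Qed.

Lemma disk_boundary_eq z : disk_boundary A z -> e (disk_form A) (point_form z) = 0.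
Proof.
rewrite /disk_boundary /= /sdist => h.
have -> := disk_form_point z.
by rewrite (acos_eq _ _ h)// ?subrr ?mulr0 ?mul0r// dot_unit_le1// stereo_sphere.
Qed.

End OneDisk.

Lemma disk_form_pair (A B : disk R) : radius A < pi -> radius B < pi ->
  e (disk_form A) (disk_form B) =
  (cos (radius A) * cos (radius B) - dot (stereo (center A)) (stereo (center B))) / (sin (radius A) * sin (radius B)).
Proof.
move=> rA rB; have sA : sin (radius A) != 0 by apply: lt0r_neq0; apply: sin_gt0_pi; rewrite radius_gt0.
have sB : sin (radius B) != 0 by apply: lt0r_neq0; apply: sin_gt0_pi; rewrite radius_gt0.
rewrite dot3 /mink /disk_form /=; move: sA sB; set s := sin _; set s' := sin _; set c := cos _; set c' := cos _.
move: (stereo (center A)) (stereo (center B)) => u v.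
by move: (u 0 o0) (u 0 o1) (u 0 o2) (v 0 o0) (v 0 o1) (v 0 o2) => *; field; apply/andP.
Qed.

Lemma null_ray_pointP (q : @form R) : null_ray q -> exists z k, 0 < k /\ q = fZ k (point_form z).
Proof.
move=> [/null_eq qq qA qC qAC]; have [A0|A0] := eqVneq (fA q) 0.
  have [X0 Y0] : fX q = 0 /\ fY q = 0 by apply: sumsq_eq0; rewrite -qq A0 mul0r.
  exists None, (fC q); split; first by move: qAC; rewrite A0 add0r.
  by apply: form_eq; rewrite /= ?mulr0 ?mulr1.
exists (Some (Complex (- fX q / fA q) (- fY q / fA q))), (fA q); split.
  by rewrite lt_neqAle eq_sym A0.
apply: form_eq; rewrite /= ?mulr1//; try by field.
by apply: (mulfI A0); rewrite qq; field.
Qed.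

(** In the tangent plane at [p], with basis [a'] (towards the centre of [A]) and [tA], the centre of
    [B] projects to a vector of length [sin (radius B)] orthogonal to [tB]. So [tB] is that vector
    rescaled and turned by a quarter turn, one way or the other. *)
Lemma crossing_angle (A B : disk R) p tA tB : radius A < pi -> radius B < pi ->
  disk_boundary A p -> disk_boundary B p -> leaving_tangent A B p tA -> leaving_tangent B A p tB ->
  dot tA tB = e (disk_form A) (disk_form B) /\ -1 <= dot tA tB <= 1.
Proof.
move=> rA rB pA pB [tAt tAp tAa tAb] [tBt tBp tBb tBa].
have s0A : 0 < sin (radius A) by apply: sin_gt0_pi; rewrite radius_gt0.
have s0B : 0 < sin (radius B) by apply: sin_gt0_pi; rewrite radius_gt0.
rewrite disk_form_pair//; split; last exact: dot_unit_le1.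
have bd C : radius C < pi -> disk_boundary C p -> dot (stereo (center C)) (stereo p) = cos (radius C).
  by move=> rC h; rewrite (acos_eq _ _ h)// ?dot_unit_le1 ?stereo_sphere// !ltW// radius_gt0.
have ap := bd A rA pA; have bp := bd B rB pB.
move: (stereo_sphere (center A)) (stereo_sphere (center B)) (stereo_sphere p) ap bp tAp tAa tAb tBp tBb tBa.
have := cos2Dsin2 (radius A); have := cos2Dsin2 (radius B); move: s0A s0B.
move: (cos (radius A)) (sin (radius A)) (cos (radius B)) (sin (radius B)) => cA sA cB sB.
move: (stereo (center A)) (stereo (center B)) (stereo p) => a b P s0A s0B csB csA aa bb PP aP bP tAp tAa tAb tBp tBb tBa.
have sA1 := lt0r_neq0 s0A; have sB1 := lt0r_neq0 s0B.
pose a' := sA^-1 *: (a - cA *: P).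
have a'D u : dot u a' = (dot u a - cA * dot u P) / sA by rewrite /a' dotZr dotBr dotZr mulrC.
have a'a' : dot a' a' = 1.
  rewrite a'D (dotC a' a) (dotC a' P) !a'D (dotC P a) aa aP PP.
  have -> : (1 - cA * cA) = sA ^+ 2 by rewrite -csA; ring.
  by field.
have Pa' : dot P a' = 0 by rewrite a'D (dotC P a) aP PP; field.
have PtA : dot P tA = 0 by rewrite dotC.
have a'tA : dot a' tA = 0 by rewrite dotC a'D tAa tAp mulr0 subrr mul0r.
have par := dot_parseval PP a'a' tAt Pa' PtA a'tA.
have := par b b; have := par tB tB; have := par tB b.
rewrite !a'D bb bP tBt tBp tBb (dotC b a) (dotC b tA) (dotC tB tA).
set X := (dot tB a - cA * 0) / sA; set x' := (dot a b - cA * cB) / sA; set y' := dot tA b; set Y := dot tA tB.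
move=> h1 h2 h3.
have X0 : X < 0 by rewrite /X mulr0 subr0 pmulr_llt0// invr_gt0.
have e1 : X * x' + Y * y' = 0 by lra.
have e2 : X ^+ 2 + Y ^+ 2 = 1 by lra.
have e3 : x' ^+ 2 + y' ^+ 2 = sB ^+ 2 by lra.
(* [k] is [sB] or its opposite; the leaving conditions make [X] and [y'] negative, which forces the
   minus sign. *)
pose k := x' * Y - X * y'.
have kY : Y * sB ^+ 2 = x' * k.
  by rewrite -e3 /k; transitivity (x' * (x' * Y - X * y') + y' * (X * x' + Y * y')); [ring | rewrite e1; ring].
have kX : X * sB ^+ 2 = - y' * k.
  by rewrite -e3 /k; transitivity (- y' * (x' * Y - X * y') + x' * (X * x' + Y * y')); [ring | rewrite e1; ring].
have k2 : k ^+ 2 = sB ^+ 2.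
  transitivity ((X ^+ 2 + Y ^+ 2) * (x' ^+ 2 + y' ^+ 2) - (X * x' + Y * y') ^+ 2); first by rewrite /k; ring.
  by rewrite e1 e2 e3; ring.
have k0 : k < 0.
  have : y' * k > 0 by have : 0 < sB ^+ 2 by [rewrite exprn_gt0]; nra.
  by rewrite nmulr_rgt0.
have kE : k = - sB.
  have /eqP := k2; rewrite -subr_eq0 subr_sqr mulf_eq0 => /orP[/eqP h|/eqP h]; lra.
have : Y * sB ^+ 2 = - (x' * sB) by rewrite kY kE; ring.
move/(congr1 (fun t => t / sB ^+ 2)); rewrite mulfK ?sqrf_eq0// => ->.
by rewrite /x'; field; rewrite sA1 sB1.
Qed.

Lemma quad_dominates (d al be ga : R) : 0 < d ->
  exists c0 : R, forall c, c0 <= c -> [/\ 0 <= c, ga <= c & al + be * c <= d * c ^+ 2].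
Proof.
move=> d0; exists ((`|al| + `|be|) / d + `|ga| + 1) => c hc.
have h1 : 0 <= (`|al| + `|be|) / d by rewrite divr_ge0 ?addr_ge0// ltW.
have h2 : (`|al| + `|be|) <= c * d.
  rewrite -ler_pdivrMr//; have : 0 <= `|ga| by []; lra.
have g0 : 0 <= `|ga| by [].
have c1 : 1 <= c by lra.
split; [lra | by have := ler_norm ga; lra |].
have a1 := ler_norm al; have b1 := ler_norm be.
have a0 : 0 <= `|al| by []. have b0 : 0 <= `|be| by [].
have : al + be * c <= (`|al| + `|be|) * c by nra.
by move/le_trans; apply; rewrite expr2 mulrA (mulrC d); apply: ler_wpM2r => //; lra.
Qed.

(* The image of [P] under the reflection fixing [Y], up to a factor. *)
Definition other_null (P Y : @form R) : @form R := fD (fZ (2 * e P Y) Y) (fZ (- e Y Y) P).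

Lemma other_nullE P Y m : e m (other_null P Y) = 2 * e P Y * e m Y - e Y Y * e m P.
Proof. by rewrite /other_null eDr !eZr; ring. Qed.

Lemma null_ray_other_null P Y : null_ray P -> e P Y != 0 -> null_ray (other_null P Y) /\ 0 < e P (other_null P Y).
Proof.
move=> ptP PY; have PP : e P P = 0 by case: ptP.
have h : e P (other_null P Y) = 2 * e P Y ^+ 2 by rewrite other_nullE PP; ring.
have h0 : 0 < e P (other_null P Y) by rewrite h mulr_gt0// lt_neqAle eq_sym sqrf_eq0 PY sqr_ge0.
split => //; apply: (null_ray_future ptP); last by rewrite eC.
by rewrite other_nullE (eC (other_null P Y) Y) (eC (other_null P Y) P) !other_nullE PP (eC Y P); ring.
Qed.

(** A further common point is sought as [other_null P (U + c l)] with [l] spacelike and orthogonal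
    to [P]: the product of [P] with [U + c l] stays [u] while its norm goes to minus infinity, so
    the ray tends to that of [P] as [c] grows. *)
Lemma tangent_forms (n m P : @form R) : e n n = -1 -> e m m = -1 -> null_ray P -> e n P <= 0 -> e m P <= 0 ->
  (forall q, null_ray q -> e n q <= 0 -> e m q <= 0 -> e P q = 0) ->
  [/\ e n P = 0, e m P = 0 & e n m = 1].
Proof.
move=> nn mm ptP.
have U0 : 0 < e P (Form 1 0 0 1) by case: ptP => _ _ _ h; rewrite /mink /=; lra.
have UU : e (Form 1 0 0 1) (Form 1 0 0 1) = 1 :> R by rewrite /mink /=; field.
set U := Form 1 0 0 1 in U0 UU; set u := e P U in U0.
have bnd (k l : @form R) : e l l = -1 -> e k P < 0 -> e l P = 0 ->
    (forall q, null_ray q -> e k q <= 0 -> e l q <= 0 -> e P q = 0) -> False.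
  move=> ll kP lP uniq.
  have [|c0 /(_ c0 (lexx _)) [c0p hg hc]] := @quad_dominates (- e k P) (2 * u * e k U - e k P) (2 * u * e k l - 2 * e U l * e k P) (e l U).
    by rewrite oppr_gt0.
  set Y := fD U (fZ c0 l).
  have PY : e P Y = u by rewrite /Y eDr eZr (eC P l) lP mulr0 addr0.
  have YY : e Y Y = 1 + 2 * c0 * e U l - c0 ^+ 2.
    by rewrite /Y !eDr !eDl !eZr !eZl UU ll (eC l U); ring.
  have [|ptq q0] := @null_ray_other_null P Y ptP; first by rewrite PY lt0r_neq0.
  have := uniq _ ptq; rewrite !other_nullE PY YY lP.
  have -> : e k Y = e k U + c0 * e k l by rewrite /Y eDr eZr.
  have -> : e l Y = e l U - c0 by rewrite /Y eDr eZr ll; ring.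
  move=> h; have : e P (other_null P Y) = 0.
    rewrite other_nullE PY YY; apply: h; first by lra.
    by rewrite mulr0 subr0; nra.
  by move=> h'; rewrite h' ltxx in q0.
have [W [PW WW]] : exists W, e P W = 0 /\ e W W = -1.
  have [[[x y]|] [k [k0 ->]]] := null_ray_pointP ptP.
    by exists (Form 0 1 0 (- 2 * x)); rewrite /mink /=; split; field.
  by exists (Form 0 1 0 0); rewrite /mink /=; split; field.
move=> nP mP uniq.
have uniq' q : null_ray q -> e m q <= 0 -> e n q <= 0 -> e P q = 0 by move=> ? ? ?; exact: uniq.
move: nP mP; rewrite !le_eqVlt => /predU1P[nP|nP] /predU1P[mP|mP].
- split => //; apply/eqP; rewrite eq_le; apply/andP; split.
    (* Otherwise [n + m], orthogonal to [P] and of positive norm, would be a multiple of the null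
       vector [P]. *)
    rewrite leNgt; apply/negP => nm.
    have yy : e (fD n m) (fD n m) = 2 * (e n m - 1) by rewrite !eDl !eDr nn mm (eC m n); ring.
    have [||c cE] := @causal_perp _ P (fD n m) ptP; first by rewrite eDl nP mP addr0.
      by rewrite yy; lra.
    move: yy; rewrite cE eZl eZr; case: ptP => -> _ _ _; rewrite !mulr0; lra.
  (* Otherwise the direction [n + m] leads into both disks at once. *)
  rewrite leNgt; apply/negP => nm.
  have d0 : 0 < 1 - e n m by lra.
  have [c0 [hn hm]] : exists c0, e n U - c0 * (1 - e n m) <= 0 /\ e m U - c0 * (1 - e n m) <= 0.
    exists ((`|e n U| + `|e m U|) / (1 - e n m)); rewrite divfK ?lt0r_neq0//.
    have := ler_norm (e n U); have := ler_norm (e m U).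
    have : 0 <= `|e n U| by []. have : 0 <= `|e m U| by []. by split; lra.
  set Y := fD U (fZ c0 (fD n m)).
  have PY : e P Y = u by rewrite /Y eDr eZr eDr (eC P n) (eC P m) mP nP addr0 mulr0 addr0.
  have [|ptq q0] := @null_ray_other_null P Y ptP; first by rewrite PY lt0r_neq0.
  have h1 : e n (other_null P Y) <= 0.
    rewrite other_nullE PY nP mulr0 subr0.
    have -> : e n Y = e n U - c0 * (1 - e n m) by rewrite /Y eDr eZr eDr nn; ring.
    by nra.
  have h2 : e m (other_null P Y) <= 0.
    rewrite other_nullE PY mP mulr0 subr0.
    have -> : e m Y = e m U - c0 * (1 - e n m) by rewrite /Y eDr eZr eDr mm (eC m n); ring.
    by nra.
  by rewrite (uniq _ ptq h1 h2) ltxx in q0.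
- by case: (bnd m n nn mP nP uniq').
- by case: (bnd n m mm nP mP uniq).
- have far (k : @form R) : e k P < 0 -> exists c0, forall c, c0 <= c -> e k (other_null P (fD U (fZ c W))) <= 0.
    move=> kP; have [|c0 h] := @quad_dominates (- e k P) (2 * u * e k U - e k P) (2 * u * e k W - 2 * e U W * e k P) 0.
      by rewrite oppr_gt0.
    exists c0 => c /h [_ _ hc]; rewrite other_nullE.
    have -> : e P (fD U (fZ c W)) = u by rewrite eDr eZr PW mulr0 addr0.
    have -> : e k (fD U (fZ c W)) = e k U + c * e k W by rewrite eDr eZr.
    have -> : e (fD U (fZ c W)) (fD U (fZ c W)) = 1 + 2 * c * e U W - c ^+ 2.
      by rewrite !eDr !eDl !eZr !eZl UU WW (eC W U); ring.
    by lra.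
  have [c1 h1] := far n nP; have [c2 h2] := far m mP.
  pose c := Num.max c1 c2.
  have [|ptq q0] := @null_ray_other_null P (fD U (fZ c W)) ptP; first by rewrite eDr eZr PW mulr0 addr0 lt0r_neq0.
  by rewrite (uniq _ ptq (h1 c _) (h2 c _)) ?ltxx ?le_max ?lexx ?orbT in q0.
Qed.

Lemma external_angle_overlap (A B : disk R) th : radius A < pi -> radius B < pi -> 0 <= th < pi ->
  external_angle A B th ->
  overlap (disk_form A) (disk_form B) /\ e (disk_form A) (disk_form B) = cos th.
Proof.
move=> rA rB /andP[th0 thpi].
have c1 : -1 < cos th.
  by rewrite -cospi ltr_cos // in_itv/= ?th0 ?(ltW thpi) ?pi_ge0 ?lexx.
have thb : cos th <= 1 by exact: cos_le1.
suff : external_angle A B th -> (exists P, [/\ null_ray P, e (disk_form A) P = 0 & e (disk_form B) P = 0]) /\ e (disk_form A) (disk_form B) = cos th.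
  by move=> h /h[hP hE]; split => //; split => //; rewrite hE c1 thb.
case=> [[[p pE] ->]|[p [tA [tB [pA pB lA lB ->]]]]]; last first.
  have [h1 h2] := crossing_angle rA rB pA pB lA lB; rewrite acosK ?in_itv//; split; last by [].
  by exists (point_form p); split; [exact: null_ray_point | exact: disk_boundary_eq | exact: disk_boundary_eq].
have pin : (disk_set A `&` disk_set B) p by rewrite pE.
case: pin => /disk_setE -/(_ rA) pA /disk_setE -/(_ rB) pB.
have [|||h1 h2 h3] := @tangent_forms (disk_form A) (disk_form B) (point_form p) _ _ (null_ray_point p) pA pB.
- exact: disk_form_norm.
- exact: disk_form_norm.
- move=> q /null_ray_pointP[z [k [k0 ->]]]; rewrite !eZr !pmulr_rle0// => zA zB.
  have : [set p] z by rewrite -pE; split; apply/disk_setE.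
  by move=> ->; have [-> _ _ _] := null_ray_point p; rewrite mulr0.
rewrite cos0; split => //; exists (point_form p); split => //; exact: null_ray_point.
Qed.

End DiskForms.

(** * From a triangulated disk configuration to the plane *)

Section FromTriangulation.
Context {R : realType} {V : finType} (F : {set {set V}}).

Lemma card3P (f : {set V}) : #|f| = 3%N -> exists u v w, [/\ f = [set u; v; w]%SET, u != v, u != w & v != w].
Proof.
move=> f3; have /card_gt0P[u uf] : (0 < #|f|)%N by rewrite f3.
have : #|f :\ u|%SET == 2%N by have := cardsD1 u f; rewrite uf f3 add1n => -[<-].
case/cards2P => v [w [vw fE]].
have : v \in (f :\ u)%SET by rewrite fE !inE eqxx.
have : w \in (f :\ u)%SET by rewrite fE !inE eqxx orbT.
rewrite !inE => /andP[wu _] /andP[vu _].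
exists u, v, w; rewrite ![u == _]eq_sym vu wu vw; split => //.
by rewrite -(finset.setD1K uf) fE finset.setUA.
Qed.

Lemma card3_distinct (u v w : V) : #|[set u; v; w]%SET| = 3%N -> [/\ u != v, u != w & v != w].
Proof.
move=> h; have le2 (a b : V) : (#|[set a; b]%SET| <= 2)%N by rewrite cards2; case: (a != b).
split; apply/eqP => e; move: h; rewrite e.
- by rewrite finset.setUid => h; have := le2 v w; rewrite h.
- by rewrite finset.setUAC finset.setUid => h; have := le2 w v; rewrite h.
- by rewrite -finset.setUA finset.setUid => h; have := le2 u w; rewrite h.
Qed.

Lemma card3_third (g : {set V}) u v : #|g| = 3%N -> u \in g -> v \in g -> u != v ->
  exists x, [/\ g = [set u; v; x]%SET, x != u & x != v].
Proof.
move=> g3 ug vg uv; have sub : [set u; v]%SET \subset g by rewrite finset.subUset !finset.sub1set ug vg.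
have : #|g :\: [set u; v]|%SET == 1%N by rewrite cardsD (finset.setIidPr sub) g3 cards2 uv.
case/cards1P => x xE; exists x.
have : x \in (g :\: [set u; v])%SET by rewrite xE !inE.
rewrite !inE negb_or => /andP[/andP[xu xv] _]; split => //.
by rewrite -xE -[LHS](finset.setID g [set u; v]%SET) (finset.setIidPr sub).
Qed.

Hypothesis hS : sphere_triangulation R F.

Lemma adj_skeleton u v : adj F u v = (u != v) && ([set u; v]%SET \in skeleton_edges F).
Proof.
have [F3 _ _] := hS.
rewrite /adj; case: eqVneq => //= uv; rewrite inE cards2 uv eqxx /=.
apply/existsP/existsP => [[w t]|[f /andP[fF]]].
  by exists [set u; v; w]%SET; move: t; rewrite /tri => ->; rewrite finset.subsetUl.
rewrite finset.subUset !finset.sub1set => /andP[uf vf].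
have [x [fE _ _]] := card3_third (F3 _ fF) uf vf uv.
by exists x; rewrite /tri -fE.
Qed.

Lemma tight_of_sphere : tight_complex F.
Proof.
have [F3 _ hom] := hS; have dis u v w : tri F u v w -> [/\ u != v, u != w & v != w].
  by move=> t; apply: card3_distinct; exact: F3.
split => //.
- move=> u v w t; have [uv uw vw] := dis _ _ _ t.
  have [uf vf] : u \in [set u; v; w]%SET /\ v \in [set u; v; w]%SET by rewrite !inE !eqxx ?orbT.
  have [g [gF gne ug vg]] := second_face hS t uf vf uv.
  have [x [gE xu xv]] := card3_third (F3 _ gF) ug vg uv.
  exists x; last by rewrite /tri -gE.
  by apply: contraNneq gne => xw; rewrite gE xw.
- move=> f x X fF xX xf cl; apply: (face_complement_connected hS fF xX xf).
  move=> u v uX vf uv; have [<-//|uv'] := eqVneq u v.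
  by apply: (cl u v uX vf); rewrite adj_skeleton uv'.
- have [h [g [_ _ _ hg]]] := hom.
  have NS : unit_sphere (mk3 0 0 1 : 'rV[R]_3) by rewrite /unit_sphere/= dot3 !mk3E; ring.
  have [[_ _ [f fF _]] _] := hg _ NS.
  have [u [v [w [fE _ _ _]]]] := card3P (F3 _ fF).
  by exists u, v, w; rewrite /tri -fE.
- by move=> f fF; have [u [v [w [fE _ _ _]]]] := card3P (F3 _ fF); exists u, v, w.
Qed.

Variables (Theta : {set V} -> R) (D : V -> disk R).
Hypotheses (hT : forall e, e \in skeleton_edges F -> 0 <= Theta e < pi)
  (hD : disk_configuration D) (hthin : thin D) (hR : realizes (skeleton_edges F) Theta D).

(** A disk of radius at least [pi] is the whole sphere and would contain another disk of the
    configuration. *)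
Lemma radius_lt_pi v : radius (D v) < pi.
Proof.
have [dis _ _ [a [b [c t]]] _] := tight_of_sphere; have [ab _ _] := dis _ _ _ t.
have [u uv] : exists u, u != v.
  by have [av|av] := eqVneq a v; [exists b; rewrite -av eq_sym | exists a].
rewrite ltNge; apply/negP => h; apply: (hD uv) => z _; rewrite /disk_set /=.
apply: le_trans h; apply: acos_lepi; apply: dot_unit_le1; exact: stereo_sphere.
Qed.

Lemma edge_overlap u v : adj F u v ->
  overlap (disk_form (D u)) (disk_form (D v)) /\ e (disk_form (D u)) (disk_form (D v)) = cos (Theta [set u; v]%SET).
Proof.
rewrite adj_skeleton => /andP[_ uv]; have [_ hang] := hR.
exact: (external_angle_overlap (radius_lt_pi u) (radius_lt_pi v) (hT uv) (hang _ _ uv)).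
Qed.

Lemma disks_thin_config : thin_config F (fun v => disk_form (D v)).
Proof.
split.
- by move=> v; apply: disk_form_norm; exact: radius_lt_pi.
- by move=> u v /edge_overlap[].
- move=> u v w uv uw vw q /null_ray_pointP[z [k [k0 ->]]]; rewrite !eZr !pmulr_rle0// pmulr_rgt0// => zu zv.
  rewrite ltNge; apply/negP => zw.
  have : (disk_set (D u) `&` disk_set (D v) `&` disk_set (D w)) z.
    by split; [split|]; apply/disk_setE => //; exact: radius_lt_pi.
  by rewrite (hthin uv uw vw).
Qed.

Lemma disks_normal_form o a b : tri F o a b ->
  exists (A B C E : R[i]) (cx cy r : V -> R), [/\ A * E - B * C != 0,
    plane_config F (fun u v => e (disk_form (D u)) (disk_form (D v))) [set o; a; b]%SET cx cy r &
    forall v z, disk_set (D v) z <->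
      exists2 w, moebius_map A B C E z = Some w & (complex.Re w - cx v) ^+ 2 + (complex.Im w - cy v) ^+ 2 <= r v ^+ 2].
Proof.
move=> t0; have hF := tight_of_sphere; have hn := disks_thin_config.
have [p hc] := central_exists hF hn t0; have [ptp _ pout _] := hc.
have [A [B [C [E [L [AE LE Lp Lz]]]]]] := chart ptp.
have pc := plane_of_central hF hn t0 hc LE Lp.
exists A, B, C, E, (fun v => - (fX (L (disk_form (D v))) / fA (L (disk_form (D v))))),
  (fun v => - (fY (L (disk_form (D v))) / fA (L (disk_form (D v))))), (fun v => (fA (L (disk_form (D v))))^-1).
split => // v z; have [k k0 kE] := Lz z.
have nv : e (disk_form (D v)) (disk_form (D v)) = -1 by apply: disk_form_norm; exact: radius_lt_pi.
have Av : 0 < fA (L (disk_form (D v))).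
  have : fA (L (disk_form (D v))) = 2 * e (disk_form (D v)) p by rewrite -LE Lp /mink /=; field.
  by move=> ->; rewrite mulr_gt0.
rewrite -LE in nv.
rewrite disk_setE; last exact: radius_lt_pi.
rewrite kE pmulr_rle0//; move: Av nv; move: (L (disk_form (D v))) => [a0 x0 y0 c0] /= a00 nv.
have a1 := lt0r_neq0 a00.
case: (moebius_map A B C E z) => [[x y]|]; last first.
  by split => [h|[w []]] //; exfalso; move: h; rewrite /mink /=; lra.
have key : (x - - (x0 / a0)) ^+ 2 + (y - - (y0 / a0)) ^+ 2 - a0^-1 ^+ 2 =
    2 / a0 * e (Form a0 x0 y0 c0) (point_form (Some (Complex x y))).
  have c0E : c0 = (x0 ^+ 2 + y0 ^+ 2 - 1) / a0.
    by apply: (mulfI a1); rewrite mulrCA divff// mulr1; move: nv; rewrite /mink /=; lra.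
  by rewrite c0E /mink /=; field.
have a2 : 0 < 2 / a0 by rewrite divr_gt0.
split=> [h|[w [<-]] h].
  by exists (Complex x y) => //=; rewrite -subr_le0 key pmulr_rle0.
by rewrite -(pmulr_rle0 _ a2) -key subr_le0.
Qed.

End FromTriangulation.

(** * Angles around a vertex *)

Section AngleSum.
Context {R : realType} {V : finType}.

Lemma cos_eq1_2pi (t : R) : 0 < t <= pi *+ 2 -> cos t = 1 -> t = pi *+ 2.
Proof.
move=> /andP[t0 t2] ct; have pi0 := pi_gt0 R.
have lt1 (u : R) : 0 < u <= pi -> cos u < 1.
  move=> /andP[u0 u1]; rewrite -cos0 ltr_cos// in_itv/= ?lexx ?(ltW u0) ?u1 ?(ltW pi0)//.
apply/eqP; rewrite eq_le t2 leNgt; apply/negP => tlt.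
have [tpi|tpi] := leP t pi; first by have := lt1 t; rewrite t0 tpi ct ltxx => /(_ isT).
have := lt1 (pi *+ 2 - t); rewrite addrC cosD2pi cosN ct ltxx => /(_ _)/notF; apply.
by apply/andP; split; rewrite mulr2n in tlt t2 *; lra.
Qed.

(** The star of a vertex: neighbours, pairs spanning a face with the vertex, and displacements from
    its centre. The link is not assumed to be a cycle. *)
Variables (N : pred V) (la : rel V) (dx dy : V -> R).
Hypotheses (laC : forall u w, la u w = la w u) (laN : forall u w, la u w -> N u)
  (Nla : forall u, N u -> exists w, la u w)
  (la2 : forall u w, la u w -> exists2 x, x != w & la u x).

Let cr u w := dx u * dy w - dy u * dx w.

Hypotheses (indep : forall u w, la u w -> cr u w != 0)
  (sector : forall u w x s t, la u w -> N x -> x != u -> x != w -> 0 <= s -> 0 <= t ->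
     dx x = s * dx u + t * dx w -> dy x = s * dy u + t * dy w -> False).

Definition nrm (u : V) : R := Num.sqrt (dx u ^+ 2 + dy u ^+ 2).
Definition ang (u w : V) : R := acos ((dx u * dx w + dy u * dy w) / (nrm u * nrm w)).

Lemma angC u w : ang u w = ang w u.
Proof. by rewrite /ang (mulrC (nrm u)) (mulrC (dx u)) (mulrC (dy u)). Qed.

Let crC u w : cr u w = - cr w u. Proof. rewrite /cr; ring. Qed.

Let Nla' u w : la u w -> N w. Proof. by rewrite laC => /laN. Qed.

Let nrm_gt0 u : N u -> 0 < nrm u.
Proof.
move=> /Nla[w /indep c0]; rewrite sqrtr_gt0 lt_neqAle addr_ge0 ?sqr_ge0// andbT eq_sym.
apply: contra c0; rewrite paddr_eq0 ?sqr_ge0// !sqrf_eq0 => /andP[/eqP h1 /eqP h2].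
by rewrite /cr h1 h2 !mul0r subrr.
Qed.

(* Two faces at [v] on the same side of the ray towards [u] have nested sectors, hence coincide. *)
Lemma same_side_eq u w w' : la u w -> la u w' -> 0 < cr u w * cr u w' -> w = w'.
Proof.
(* Of two vectors on the same side of [u], one lies in the sector of [u] and the other; by symmetry
   it is [w']. *)
wlog h : w w' / 0 <= cr w' w * cr u w.
  move=> H l l' c; have [h|h] := leP 0 (cr w' w * cr u w); first exact: H.
  apply/esym; apply: H => //; last by rewrite mulrC.
  have : cr w' w * cr u w' < 0.
    have : 0 < cr u w ^+ 2 by rewrite lt_neqAle eq_sym sqrf_eq0 indep// sqr_ge0.
    nra.
  by rewrite (crC w w') mulNr oppr_ge0 => /ltW.
move=> l l' c; have c0 := indep l.
have dd : 0 < cr u w ^+ 2 by rewrite lt_neqAle eq_sym sqrf_eq0 c0 sqr_ge0.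
apply/eqP; apply: contraT => ww'; exfalso.
apply: (@sector u w w' (cr w' w / cr u w) (cr u w' / cr u w) l (Nla' l')).
- by apply: contraTneq c => ->; rewrite {2}/cr mulrC (mulrC (dx u)) subrr mul0r ltxx.
- by rewrite eq_sym.
- have e1 : cr w' w / cr u w * cr u w ^+ 2 = cr w' w * cr u w by field.
  by rewrite -(pmulr_lge0 _ dd) e1.
- have e2 : cr u w' / cr u w * cr u w ^+ 2 = cr u w * cr u w' by field.
  by rewrite -(pmulr_lge0 _ dd) e2 ltW.
- by move: c0; rewrite /cr => c0; field.
- by move: c0; rewrite /cr => c0; field.
Qed.

(** The next neighbour counterclockwise. It fixes the vertices outside [N], so as to be a
    permutation of [V]. *)
Let sc (u : V) : V := if [pick w | la u w && (0 < cr u w)] is Some w then w else u.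

Let scP u : N u -> la u (sc u) /\ 0 < cr u (sc u).
Proof.
move=> Nu; rewrite /sc; case: pickP => [w /andP[] //|no]; exfalso.
have [w l] := Nla Nu; have [x xw l'] := la2 l.
have neg y : la u y -> cr u y < 0.
  move=> ly; have := no y; rewrite ly/= => /negbT; rewrite -leNgt le_eqVlt.
  by rewrite (negbTE (indep ly)).
have := same_side_eq l l'; rewrite nmulr_rgt0 ?neg// => /(_ isT) e.
by rewrite e eqxx in xw.
Qed.

Let sc_uniq u w : la u w -> 0 < cr u w -> w = sc u.
Proof.
move=> l c; have [l' c'] := scP (laN l); apply: (same_side_eq l l').
by rewrite mulr_gt0.
Qed.

Let Nsc u : N u -> N (sc u). Proof. by move=> /scP[/Nla']. Qed.

Let sc_out u : ~~ N u -> sc u = u.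
Proof.
by move=> Nu; rewrite /sc; case: pickP => // w /andP[/laN]; rewrite (negbTE Nu).
Qed.

Let sc_inj : injective sc.
Proof.
move=> u w; have [Nu|Nu] := boolP (N u); have [Nw|Nw] := boolP (N w).
- move=> e; have [l c] := scP Nu; have [l' c'] := scP Nw; rewrite -e in l' c'.
  apply: (@same_side_eq (sc u)); rewrite 1?laC//.
  by rewrite (crC _ u) (crC _ w) mulrNN mulr_gt0.
- by rewrite (sc_out Nw) => e; have := Nsc Nu; rewrite e (negbTE Nw).
- by rewrite (sc_out Nu) => e; have := Nsc Nw; rewrite -e (negbTE Nu).
- by rewrite !sc_out.
Qed.

Let polar u : N u -> exists f, dx u = nrm u * cos f /\ dy u = nrm u * sin f.
Proof.
move=> Nu; have n0 := nrm_gt0 Nu; have n1 := lt0r_neq0 n0.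
have [|f [_ _ hc hs]] := @polar_unit R (dx u / nrm u) (dy u / nrm u).
  have nn : nrm u ^+ 2 = dx u ^+ 2 + dy u ^+ 2 by rewrite sqr_sqrtr// addr_ge0 ?sqr_ge0.
  by rewrite !expr_div_n -mulrDl -nn divff// sqrf_eq0.
by exists f; rewrite -hc -hs; split; field.
Qed.

Let phi u : R := if pselect (exists f, dx u = nrm u * cos f /\ dy u = nrm u * sin f) is left h
  then projT1 (cid h) else 0.

Let phiP u : N u -> dx u = nrm u * cos (phi u) /\ dy u = nrm u * sin (phi u).
Proof. by move=> /polar h; rewrite /phi; case: pselect => // h'; case: cid. Qed.

Let crE u w : N u -> N w -> cr u w = nrm u * nrm w * sin (phi w - phi u).
Proof.
by move=> /phiP[h1 h2] /phiP[h3 h4]; rewrite /cr h1 h2 h3 h4 sinB; ring.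
Qed.

Let angE u w : N u -> N w -> ang u w = acos (cos (phi w - phi u)).
Proof.
move=> Nu Nw; have [h1 h2] := phiP Nu; have [h3 h4] := phiP Nw.
rewrite /ang; congr acos; have n1 := lt0r_neq0 (nrm_gt0 Nu); have n2 := lt0r_neq0 (nrm_gt0 Nw).
by rewrite h1 h2 h3 h4 cosB; field; rewrite n1 n2.
Qed.

Let al u := ang u (sc u).

Let alP u : N u -> [/\ 0 < al u, al u < pi, cos (al u) = cos (phi (sc u) - phi u) & sin (al u) = sin (phi (sc u) - phi u)].
Proof.
move=> Nu; have [l c] := scP Nu; have Nw := Nsc Nu.
have s0 : 0 < sin (phi (sc u) - phi u).
  by move: c; rewrite crE// pmulr_rgt0// mulr_gt0// nrm_gt0.
rewrite /al angE//; set t := phi _ - _ in s0 *.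
have := cos2Dsin2 t => cs.
have c1 : -1 < cos t < 1.
  by have := sqr_ge0 (cos t); rewrite -ltr_norml -(@ltr_pXn2r _ 2) ?nnegrE// expr1n real_normK ?num_real//; nra.
have [c2 c3] := andP c1; have c4 : -1 <= cos t <= 1 by rewrite !ltW.
split.
- by apply: acos_gt0; rewrite c3 ltW.
- by apply: acos_ltpi; rewrite c2 ltW.
- by rewrite acosK// in_itv.
- rewrite sin_acos// -cs addrC addKr sqrtr_sqr gtr0_norm//.
Qed.

Section Orbit.
Variable u0 : V.
Hypothesis Nu0 : N u0.

Let us i := iter i sc u0.
Let th i := \sum_(j < i) al (us j).

Let Nus i : N (us i). Proof. by elim: i => //= i IH; exact: Nsc. Qed.

Let thS i : th i.+1 = th i + al (us i). Proof. by rewrite /th big_ord_recr. Qed.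

Let dir_us i : cos (phi u0 + th i) = cos (phi (us i)) /\ sin (phi u0 + th i) = sin (phi (us i)).
Proof.
elim: i => [|i [hc hs]]; first by rewrite /th big_ord0 addr0.
have [_ _ ac as_] := alP (Nus i).
rewrite thS addrA; move: (phi u0 + th i) hc hs => A hc hs.
by rewrite cosD sinD hc hs ac as_ -cosD -sinD subrKC.
Qed.

(** A direction met while turning from [us i] to [us i.+1] lies in an empty sector, so it is the
    initial one; the half-open interval excludes the final one. *)
Let claimA i x psi : N x -> th i <= psi < th i.+1 ->
  cos (phi u0 + psi) = cos (phi x) -> sin (phi u0 + psi) = sin (phi x) -> x = us i.
Proof.
move=> Nx /andP[h1 h2] hc hs; apply/eqP; apply: contraT => xi; exfalso.
have [a0 api ac as_] := alP (Nus i).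
have [ci si] := dir_us i; have [cS sS] := dir_us i.+1.
have sa : 0 < sin (al (us i)) by apply: sin_gt0_pi; rewrite a0.
have sa1 := lt0r_neq0 sa.
rewrite thS in h2 cS sS.
have [xS|xS] := eqVneq x (us i.+1).
  have e1 : cos (th i + al (us i) - psi) = 1.
    have -> : th i + al (us i) - psi = (phi u0 + (th i + al (us i))) - (phi u0 + psi) by ring.
    by rewrite cosB hc hs cS sS xS -!expr2 cos2Dsin2.
  have pi0 := pi_gt0 R.
  have := @cos_eq1_2pi _ _ e1; rewrite mulr2n => /(_ _) h.
  suff : th i + al (us i) - psi = pi + pi by lra.
  by apply: h; apply/andP; split; lra.
have [l _] := scP (Nus i); have Nsi := Nus i.+1.
have [x1 x2] := phiP Nx; have [y1 y2] := phiP (Nus i); have [z1 z2] := phiP Nsi.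
have n1 := lt0r_neq0 (nrm_gt0 (Nus i)); have n2 := lt0r_neq0 (nrm_gt0 Nsi).
(* The coefficients come from [sin A e^{ip} = sin (A - p) + sin p e^{iA}], with [A] the angle of the
   sector and [p] that from [us i] to [x]. *)
apply: (@sector (us i) (us i.+1) x (nrm x / nrm (us i) * (sin (th i + al (us i) - psi) / sin (al (us i))))
  (nrm x / nrm (us i.+1) * (sin (psi - th i) / sin (al (us i)))) l Nx xi xS).
- apply: mulr_ge0; apply: divr_ge0; rewrite ?(ltW (nrm_gt0 Nx)) ?(ltW (nrm_gt0 _)) ?(ltW sa)//.
  by apply: sin_ge0_pi; apply/andP; split; lra.
- apply: mulr_ge0; apply: divr_ge0; rewrite ?(ltW (nrm_gt0 Nx)) ?(ltW (nrm_gt0 _)) ?(ltW sa)//.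
  by apply: sin_ge0_pi; apply/andP; split; lra.
- rewrite x1 y1 z1 -hc -ci -cS.
  set p := psi - th i; have -> : th i + al (us i) - psi = al (us i) - p by rewrite /p; ring.
  have -> : phi u0 + psi = (phi u0 + th i) + p by rewrite /p; ring.
  clearbody p; rewrite [phi u0 + (_ + _)]addrA; move: sa1 n1 n2; move: (al (us i)) (phi u0 + th i) => A B sa1 n1 n2.
  rewrite sinB !cosD; have := cos2Dsin2 A; move: (cos A) (sin A) sa1 (cos B) (sin B) (cos p) (sin p) => ca sA sa1 cb sb cp sp cs.
  transitivity (nrm x * (((sA * cp - ca * sp) * cb + sp * (cb * ca - sb * sA)) / sA)); last by field; rewrite sa1 n1 n2.
  by congr (_ * _); field.
- rewrite x2 y2 z2 -hs -si -sS.
  set p := psi - th i; have -> : th i + al (us i) - psi = al (us i) - p by rewrite /p; ring.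
  have -> : phi u0 + psi = (phi u0 + th i) + p by rewrite /p; ring.
  clearbody p; rewrite [phi u0 + (_ + _)]addrA; move: sa1 n1 n2; move: (al (us i)) (phi u0 + th i) => A B sa1 n1 n2.
  rewrite sinB !sinD; have := cos2Dsin2 A; move: (cos A) (sin A) sa1 (cos B) (sin B) (cos p) (sin p) => ca sA sa1 cb sb cp sp cs.
  transitivity (nrm x * (((sA * cp - ca * sp) * sb + sp * (sb * ca + cb * sA)) / sA)); last by field; rewrite sa1 n1 n2.
  by congr (_ * _); field.
Qed.

Let th_locate k psi : 0 <= psi < th k -> exists2 i, (i < k)%N & th i <= psi < th i.+1.
Proof.
elim: k => [|k IH]; first by rewrite /th big_ord0 => /andP[h1 h2]; have := le_lt_trans h1 h2; rewrite ltxx.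
move=> /andP[h1 h2]; have [h|h] := leP (th k) psi; first by exists k => //; rewrite h h2.
by have [|i ik hi] := IH _; [rewrite h1 h | exists i => //; exact: ltnW].
Qed.

Let K := fingraph.order sc u0.

Let usK : us K = u0. Proof. exact: iter_order. Qed.

Let K0 : (0 < K)%N. Proof. exact: order_gt0. Qed.

Let us_inj i : (i < K)%N -> us i = u0 -> i = 0%N.
Proof.
move=> iK e; have := findex_iter iK; rewrite -/(us i) e => <-.
by rewrite findex0.
Qed.

Let th_gt0 k : (0 < k)%N -> 0 < th k.
Proof.
case: k => // k _; rewrite thS; apply: ltr_wpDl; last by have [] := alP (Nus k).
by rewrite /th sumr_ge0// => j _; have [/ltW] := alP (Nus j).
Qed.

(** The orbit ends in its initial direction. Had it turned by more than [2 pi], it would have met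
    the direction of [u0] strictly earlier, hence [u0] itself before its period. *)
Let thK : th K = pi *+ 2.
Proof.
have pi0 := pi_gt0 R.
have [hc hs] := dir_us K; rewrite usK in hc hs.
apply: cos_eq1_2pi; last first.
  have -> : th K = (phi u0 + th K) - phi u0 by ring.
  by rewrite cosB hc hs -!expr2 cos2Dsin2.
rewrite th_gt0//=; rewrite leNgt; apply/negP => h.
have [|i iK hi] := @th_locate K (pi *+ 2); first by rewrite h mulrn_wge0// ltW.
have e := claimA Nu0 hi (cosD2pi _) (sinD2pi _).
have i0 := us_inj iK (esym e); move: hi; rewrite i0 thS /th big_ord0 add0r => /andP[_].
by have [_ h1 _ _] := alP (Nus 0); rewrite mulr2n; lra.
Qed.

(** One full turn meets every direction, so the orbit exhausts the neighbours. *)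
Let in_orbit x : N x -> exists2 i, (i < K)%N & x = us i.
Proof.
move=> Nx; have [psi [p0 p2 pc ps]] := polar_unit (cos2Dsin2 (phi x - phi u0)).
have [|i iK hi] := @th_locate K psi; first by rewrite p0 thK.
exists i => //; apply: (claimA Nx hi).
- rewrite cosD -pc -ps -cosD; congr cos; ring.
- rewrite sinD -pc -ps -sinD; congr sin; ring.
Qed.

Lemma link_connected (P : V -> Prop) : P u0 -> (forall u w, la u w -> P u -> P w) ->
  forall x, N x -> P x.
Proof.
move=> P0 hP x /in_orbit[i _ ->]; elim: i => //= i IH.
by apply: hP IH; have [] := scP (Nus i).
Qed.

Let sum_traject (g : V -> R) x k : \sum_(u <- traject sc x k) g u = \sum_(i < k) g (iter i sc x).
Proof.
elim: k x => [|k IH] x; first by rewrite big_nil big_ord0.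
by rewrite big_cons big_ord_recl IH; congr (_ + _); apply: eq_bigr => i _; rewrite -iterSr.
Qed.

Let sum_al : \sum_(u | N u) al u = pi *+ 2.
Proof.
rewrite -thK /th -sum_traject -/(orbit sc u0) big_uniq ?orbit_uniq//=.
apply: eq_bigl => x; apply/idP/idP => [/in_orbit[i _ ->]|].
  by rewrite -fconnect_orbit; exact: fconnect_iter.
by rewrite -fconnect_orbit => /iter_findex <-; exact: Nus.
Qed.

(* Twice the full turn: every face is counted twice. *)
Lemma angle_sum : \sum_(u | N u) \sum_(w | la u w) ang u w = pi *+ 4.
Proof.
have s1 u : N u -> \sum_(w | la u w && (0 < cr u w)) ang u w = al u.
  move=> Nu; have [l c] := scP Nu; rewrite (big_pred1 (sc u))// => w.
  apply/andP/eqP => [[l' c']|->//]; exact: sc_uniq.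
have s2 : \sum_(u | N u) \sum_(w | la u w && (0 < cr u w)) ang u w = pi *+ 2.
  by rewrite -sum_al; apply: eq_bigr => u; exact: s1.
have s3 : \sum_(u | N u) \sum_(w | la u w && ~~ (0 < cr u w)) ang u w = pi *+ 2.
  rewrite -s2 !pair_big_dep /= (reindex_inj (h := fun p : V * V => (p.2, p.1))) /=; last by move=> [? ?] [? ?] [-> ->].
  apply: eq_big => [[u w]|[u w] _]; last by rewrite angC.
  rewrite /= laC; have [l|l] := boolP (la u w); rewrite ?andbF//=.
  rewrite (laN l) (Nla' l) /= crC -leNgt oppr_le0 le_eqVlt eq_sym (negbTE (indep l)) //.
transitivity (\sum_(u | N u) (\sum_(w | la u w && (0 < cr u w)) ang u w + \sum_(w | la u w && ~~ (0 < cr u w)) ang u w)).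
  by apply: eq_bigr => u _; rewrite (bigID (fun w => 0 < cr u w)).
by rewrite big_split/= s2 s3 -mulrnDr.
Qed.

End Orbit.
End AngleSum.

(** * The maximum principle *)

Section Monotonicity.
Context {R : realType}.

(** The derivative of [(Y w - ga) / sqrt (Y^2 + s2)] in [Y] has the sign of [w s2 + ga Y], affine in
    [Y] and positive at both ends by hypothesis. The identity [key] replaces calculus. *)
Lemma lt_quot (Y1 Y2 w ga s2 : R) : Y1 < Y2 -> 0 <= s2 -> 0 < ga ->
  0 < Y1 ^+ 2 + s2 -> 0 < Y2 ^+ 2 + s2 -> 0 < w * s2 + ga * Y1 -> 0 < w * s2 + ga * Y2 ->
  (Y1 * w - ga) / Num.sqrt (Y1 ^+ 2 + s2) < (Y2 * w - ga) / Num.sqrt (Y2 ^+ 2 + s2).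
Proof.
move=> Y12 s0 g0 p1 p2 E1 E2.
set N1 := Num.sqrt (Y1 ^+ 2 + s2); set N2 := Num.sqrt (Y2 ^+ 2 + s2).
have n1 : N1 ^+ 2 = Y1 ^+ 2 + s2 by rewrite sqr_sqrtr// ltW.
have n2 : N2 ^+ 2 = Y2 ^+ 2 + s2 by rewrite sqr_sqrtr// ltW.
have N10 : 0 < N1 by rewrite sqrtr_gt0.
have N20 : 0 < N2 by rewrite sqrtr_gt0.
rewrite ltr_pdivrMr// mulrAC ltr_pdivlMr//.
have NN : 0 < N1 * N2 by rewrite mulr_gt0.
have NN2 : (N1 * N2) ^+ 2 = (Y1 * Y2 + s2) ^+ 2 + s2 * (Y2 - Y1) ^+ 2.
  by rewrite exprMn n1 n2; ring.
(* For [w >= 0], Cauchy-Schwarz bounds this factor below by the sum of the two end values. For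
   [w < 0] both [Y1] and [Y2] are positive, and [N1 * N2] is bounded above after multiplication by
   [Y1]. *)
have brace : 0 < w * (s2 + N1 * N2 - Y1 * Y2) + ga * (Y1 + Y2).
  have [w0|w0] := leP 0 w.
    have cs : Y1 * Y2 + s2 <= N1 * N2.
      rewrite leNgt; apply/negP => h.
      have : (N1 * N2) ^+ 2 < (Y1 * Y2 + s2) ^+ 2 by rewrite ltr_pXn2r ?nnegrE ?(ltW NN)//; lra.
      by rewrite NN2; have := mulr_ge0 s0 (sqr_ge0 (Y2 - Y1)); lra.
    by have := mulr_ge0 w0 (_ : 0 <= N1 * N2 - (Y1 * Y2 + s2)); rewrite subr_ge0 => /(_ cs); lra.
  have ws : w * s2 <= 0 by rewrite nmulr_rle0.
  have Y10 : 0 < Y1 by rewrite -(pmulr_rgt0 _ g0); lra.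
  have Y20 : 0 < Y2 by lra.
  have h1 : Y1 * N2 <= Y2 * N1.
    rewrite -(@ler_pXn2r _ 2) ?nnegrE ?mulr_ge0 ?(ltW Y10) ?(ltW Y20) ?(ltW N10) ?(ltW N20)//.
    by rewrite !exprMn n1 n2 !mulrDr; have : Y1 ^+ 2 <= Y2 ^+ 2 by [rewrite ler_pXn2r ?nnegrE ?ltW]; nra.
  have h2 : Y1 * (N1 * N2) <= Y2 * (Y1 ^+ 2 + s2).
    have := ler_wpM2l (ltW N10) h1; rewrite -n1.
    have -> : N1 * (Y1 * N2) = Y1 * (N1 * N2) by ring.
    by have -> : N1 * (Y2 * N1) = Y2 * N1 ^+ 2 by ring.
  rewrite -(pmulr_rgt0 _ Y10).
  have h3 : Y1 * (s2 + N1 * N2 - Y1 * Y2) <= s2 * (Y1 + Y2) by lra.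
  have h4 : w * (s2 * (Y1 + Y2)) <= w * (Y1 * (s2 + N1 * N2 - Y1 * Y2)) by rewrite ler_nM2l.
  have h5 : 0 < (w * s2 + ga * Y1) * (Y1 + Y2) by rewrite mulr_gt0// addr_gt0.
  lra.
have key : (N1 + N2) * ((Y2 * w - ga) * N1 - (Y1 * w - ga) * N2) =
    (Y2 - Y1) * (w * (s2 + N1 * N2 - Y1 * Y2) + ga * (Y1 + Y2)).
  transitivity (w * (Y2 * N1 ^+ 2 - Y1 * N2 ^+ 2 + (Y2 - Y1) * (N1 * N2)) + ga * (N2 ^+ 2 - N1 ^+ 2)); first by ring.
  by rewrite n1 n2; ring.
have : 0 < (N1 + N2) * ((Y2 * w - ga) * N1 - (Y1 * w - ga) * N2).
  by rewrite key mulr_gt0 // subr_gt0.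
have N12 : 0 < N1 + N2 by rewrite addr_gt0.
by rewrite (pmulr_rgt0 _ N12) subr_gt0.
Qed.

(* The cosine of the angle at [v] of the triangle of centres, where [x] and [y] are the ratios
   of the radius at [v] to the other radii and [a], [b], [c] are the cosines of the three overlap angles. *)
Definition cosang (a b c x y : R) : R :=
  (x * y + a * y + b * x - c) / (Num.sqrt (x ^+ 2 + 2 * a * x + 1) * Num.sqrt (y ^+ 2 + 2 * b * y + 1)).

Lemma cosangC a b c x y : cosang a b c x y = cosang b a c y x.
Proof. by rewrite /cosang (mulrC (Num.sqrt _)); congr (_ / _); ring. Qed.

Lemma quad_gt0 (a x : R) : -1 < a -> 0 < x -> 0 < x ^+ 2 + 2 * a * x + 1.
Proof. by move=> a1 x0; have := sqr_ge0 (x - 1); have := mulr_gt0 (_ : 0 < a + 1) x0; nra. Qed.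

Lemma cosang_lt a b c x x' y : -1 < a <= 1 -> -1 < b <= 1 -> 0 < c + a * b -> 0 < b + a * c ->
  0 < x -> x < x' -> 0 < y -> cosang a b c x y < cosang a b c x' y.
Proof.
move=> /andP[a1 a2] /andP[b1 b2] g1 g2 x0 xx y0.
have sN := quad_gt0 b1 y0; have sx := quad_gt0 a1 x0; have sx' := quad_gt0 a1 (lt_trans x0 xx).
have E t : t ^+ 2 + 2 * a * t + 1 = (t + a) ^+ 2 + (1 - a ^+ 2) by ring.
have s0 : 0 <= 1 - a ^+ 2 by nra.
have F t : (t * y + a * y + b * t - c) / (Num.sqrt (t ^+ 2 + 2 * a * t + 1) * Num.sqrt (y ^+ 2 + 2 * b * y + 1)) =
  ((t + a) * (y + b) - (c + a * b)) / Num.sqrt ((t + a) ^+ 2 + (1 - a ^+ 2)) / Num.sqrt (y ^+ 2 + 2 * b * y + 1).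
  by rewrite E invfM mulrA; congr (_ / _ / _); ring.
rewrite /cosang !F ltr_pM2r ?invr_gt0 ?sqrtr_gt0//.
(* The sign of the derivative of [lt_quot], with [s2 = 1 - a^2], [w = y + b] and [ga = c + a b]: a
   sum of three terms, two of them positive by the hypotheses on the cosines. *)
have EE t : 0 < t -> 0 < (y + b) * (1 - a ^+ 2) + (c + a * b) * (t + a).
  move=> t0; have -> : (y + b) * (1 - a ^+ 2) + (c + a * b) * (t + a) = y * (1 - a ^+ 2) + (c + a * b) * t + (b + a * c) by ring.
  by have := mulr_ge0 (ltW y0) s0; have := mulr_gt0 g1 t0; lra.
apply: lt_quot => //; rewrite -?E//; first by rewrite ltrD2r.
- exact: EE.
- exact/EE/(lt_trans x0).
Qed.

Lemma cosang_le a b c x x' y y' : -1 < a <= 1 -> -1 < b <= 1 -> 0 < c + a * b -> 0 < b + a * c -> 0 < a + b * c ->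
  0 < x -> x <= x' -> 0 < y -> y <= y' ->
  cosang a b c x y <= cosang a b c x' y' /\ (cosang a b c x y = cosang a b c x' y' -> x = x' /\ y = y').
Proof.
move=> ha hb g1 g2 g3 x0 xx y0 yy.
have st1 : cosang a b c x y <= cosang a b c x' y.
  by move: xx; rewrite le_eqVlt => /predU1P[->//|xx]; apply/ltW/cosang_lt.
have x'0 := lt_le_trans x0 xx.
have st2 : cosang a b c x' y <= cosang a b c x' y'.
  move: yy; rewrite le_eqVlt => /predU1P[->//|yy]; rewrite !(cosangC a).
  by apply/ltW/cosang_lt => //; rewrite mulrC.
split; first exact: le_trans st1 st2.
move=> e; have e1 : cosang a b c x y = cosang a b c x' y by apply/eqP; rewrite eq_le st1 e st2.
have e2 : cosang a b c x' y = cosang a b c x' y' by rewrite -e1.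
split; apply/eqP; rewrite eq_le ?xx ?yy leNgt; apply/negP => h.
  by have := cosang_lt ha hb g1 g2 x0 h y0; rewrite e1 ltxx.
move: e2; rewrite !(cosangC a) => e2.
by have := @cosang_lt b a c y y' x' hb ha; rewrite mulrC e2 ltxx => /(_ g1 g3 y0 h x'0).
Qed.

End Monotonicity.

Section MaximumPrinciple.
Context {R : realType} {V : finType} (F : {set {set V}}) (I : V -> V -> R).
Hypotheses (hF : tight_complex F) (IC : forall u v, I u v = I v u)
  (hI : forall u v, adj F u v -> -1 < I u v <= 1)
  (hg : forall u v w, tri F u v w -> 0 < I u w + I u v * I v w).

Local Notation tri := (tri F).
Local Notation adj := (adj F).

Section AtVertex.
Variables (f0 : {set V}) (cx cy r : V -> R) (v : V).
Hypotheses (pc : plane_config F I f0 cx cy r) (vf : v \notin f0).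

Let neq u w : [set v; u; w]%SET != f0.
Proof. by apply: contraNneq vf => <-; rewrite !inE eqxx. Qed.

Definition dxv u := cx u - cx v.
Definition dyv u := cy u - cy v.

Let lav u w := tri v u w.

Lemma star_laC u w : lav u w = lav w u. Proof. by rewrite /lav tri23. Qed.
Lemma star_laN u w : lav u w -> adj v u. Proof. exact: tri_adj12. Qed.
Lemma star_Nla u : adj v u -> exists w, lav u w. Proof. by move=> /andP[_ /existsP]. Qed.
Lemma star_la2 u w : lav u w -> exists2 x, x != w & lav u x.
Proof. by have [_ h _ _ _] := hF; exact: h. Qed.
Lemma star_indep u w : lav u w -> dxv u * dyv w - dyv u * dxv w != 0.
Proof. by move=> t; exact: (pc_indep pc t (neq u w)). Qed.
Lemma star_sector u w x s t : lav u w -> adj v x -> x != u -> x != w -> 0 <= s -> 0 <= t ->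
  dxv x = s * dxv u + t * dxv w -> dyv x = s * dyv u + t * dyv w -> False.
Proof.
move=> l vx xu xw s0 t0 hx hy; apply: (pc_sector pc l (neq u w) vx _ s0 t0 hx hy).
by rewrite !inE !negb_or xu xw; case/andP: vx => vx _; rewrite eq_sym vx.
Qed.

Lemma star_angle_sum u0 : adj v u0 ->
  \sum_(u | adj v u) \sum_(w | tri v u w) ang dxv dyv u w = pi *+ 4.
Proof.
by move=> h; apply: (@angle_sum R V (adj v) lav dxv dyv star_laC star_laN star_Nla star_la2 star_indep star_sector u0 h).
Qed.

Lemma star_nrm u : adj v u -> nrm dxv dyv u = r u * Num.sqrt ((r v / r u) ^+ 2 + 2 * I v u * (r v / r u) + 1).
Proof.
move=> vu; have ru := pc_r pc u; have ru1 := lt0r_neq0 ru.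
rewrite /nrm -[X in X * _](ger0_norm (ltW ru)) -sqrtr_sqr -sqrtrM ?sqr_ge0//; congr Num.sqrt.
have := pc_edge pc vu; rewrite /dxv /dyv => h.
transitivity ((cx v - cx u) ^+ 2 + (cy v - cy u) ^+ 2); first by ring.
by rewrite h; field.
Qed.

Lemma star_ang u w : tri v u w ->
  ang dxv dyv u w = acos (cosang (I v u) (I v w) (I u w) (r v / r u) (r v / r w)) /\
  -1 <= cosang (I v u) (I v w) (I u w) (r v / r u) (r v / r w) <= 1.
Proof.
move=> t; have vu := tri_adj12 hF t; have vw := tri_adj13 hF t; have uw := tri_adj23 hF t.
have ru := pc_r pc u; have rw := pc_r pc w; have rv := pc_r pc v.
have ru1 := lt0r_neq0 ru; have rw1 := lt0r_neq0 rw.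
have dE : dxv u * dxv w + dyv u * dyv w = r u * r w *
    (r v / r u * (r v / r w) + I v u * (r v / r w) + I v w * (r v / r u) - I u w).
  have h1 := pc_edge pc vu; have h2 := pc_edge pc vw; have h3 := pc_edge pc uw.
  transitivity (((cx v - cx u) ^+ 2 + (cy v - cy u) ^+ 2 + ((cx v - cx w) ^+ 2 + (cy v - cy w) ^+ 2) - ((cx u - cx w) ^+ 2 + (cy u - cy w) ^+ 2)) / 2).
    by rewrite /dxv /dyv; field.
  by rewrite h1 h2 h3; field; rewrite ru1 rw1.
have [/andP[a1 _] /andP[b1 _]] : -1 < I v u <= 1 /\ -1 < I v w <= 1 by split; exact: hI.
have q1 := quad_gt0 a1 (divr_gt0 rv ru); have q2 := quad_gt0 b1 (divr_gt0 rv rw).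
have cE : (dxv u * dxv w + dyv u * dyv w) / (nrm dxv dyv u * nrm dxv dyv w) =
    cosang (I v u) (I v w) (I u w) (r v / r u) (r v / r w).
  rewrite !star_nrm// dE /cosang.
  have := sqrtr_gt0 ((r v / r u) ^+ 2 + 2 * I v u * (r v / r u) + 1); rewrite q1 => /lt0r_neq0.
  have := sqrtr_gt0 ((r v / r w) ^+ 2 + 2 * I v w * (r v / r w) + 1); rewrite q2 => /lt0r_neq0.
  move: (Num.sqrt _) (Num.sqrt _) (_ - I u w) => s1 s2 A s10 s20.
  by field; rewrite s10 s20 ru1 rw1.
split; first by rewrite /ang cE.
rewrite -cE -ler_norml -(@ler_pXn2r _ 2) ?nnegrE// expr1n real_normK ?num_real// expr_div_n.
have n1 : 0 < nrm dxv dyv u by rewrite star_nrm// mulr_gt0// sqrtr_gt0.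
have n2 : 0 < nrm dxv dyv w by rewrite star_nrm// mulr_gt0// sqrtr_gt0.
rewrite ler_pdivrMr ?exprn_gt0 ?mulr_gt0// mul1r exprMn /nrm !sqr_sqrtr ?addr_ge0 ?sqr_ge0//.
by have := sqr_ge0 (dxv u * dyv w - dyv u * dxv w); lra.
Qed.

End AtVertex.

Lemma acos_le_anti (x y : R) : -1 <= x <= 1 -> -1 <= y <= 1 -> x <= y -> acos y <= acos x.
Proof.
move=> x1 y1 xy; rewrite acos_le//; last by rewrite acos_ge0// acos_lepi.
by rewrite acosK// in_itv.
Qed.

Lemma acos_inj_itv (x y : R) : -1 <= x <= 1 -> -1 <= y <= 1 -> acos x = acos y -> x = y.
Proof. by move=> x1 y1 h; rewrite -(acosK (x := x)) ?in_itv// h acosK// in_itv. Qed.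

Variables (f0 : {set V}) (cx cy r cx' cy' r' : V -> R) (o a b : V).
Hypotheses (pc : plane_config F I f0 cx cy r) (pc' : plane_config F I f0 cx' cy' r')
  (f0E : f0 = [set o; a; b]%SET) (t0 : tri o a b).

(* If the ratio of the radii is maximal at [v], no angle at [v] increases; but the angle sum is the same. *)
Lemma ratio_max_propagates v : v \notin f0 -> (forall u, r' u / r u <= r' v / r v) ->
  forall u, adj v u -> r' u / r u = r' v / r v.
Proof.
move=> vf mx u0 vu0.
have rp := pc_r pc; have rp' := pc_r pc'.
(* Maximality of the ratio at [v] says that both arguments of [cosang] grow, so the angles at [v]
   shrink. *)
have xle u : r v / r u <= r' v / r' u.
  have := mx u; rewrite ler_pdivrMr// mulrAC ler_pdivlMr// => h.
  by rewrite ler_pdivrMr// mulrAC ler_pdivlMr// [leLHS]mulrC.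
have cmp u w : tri v u w ->
    ang (dxv cx' v) (dyv cy' v) u w <= ang (dxv cx v) (dyv cy v) u w /\
    (ang (dxv cx' v) (dyv cy' v) u w = ang (dxv cx v) (dyv cy v) u w -> r v / r u = r' v / r' u).
  move=> t; have [-> c1] := star_ang pc t; have [-> c2] := star_ang pc' t.
  have ha := hI (tri_adj12 hF t); have hb := hI (tri_adj13 hF t).
  have g1 : 0 < I u w + I v u * I v w by rewrite (IC v u); apply: hg; rewrite tri12.
  have g2 : 0 < I v w + I v u * I u w by exact: hg.
  have g3 : 0 < I v u + I v w * I u w by rewrite (IC u w); apply: hg; rewrite tri23.
  have [le eq] := cosang_le ha hb g1 g2 g3 (divr_gt0 (rp v) (rp u)) (xle u) (divr_gt0 (rp v) (rp w)) (xle w).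
  split; first exact: acos_le_anti.
  by move=> /acos_inj_itv -/(_ c2 c1)/esym/eq[].
have s1 := star_angle_sum pc vf vu0; have s2 := star_angle_sum pc' vf vu0.
(* Non-negative differences with sum 0 all vanish, and the equality case of monotonicity applies. *)
have : \sum_(u | adj v u) \sum_(w | tri v u w) (ang (dxv cx v) (dyv cy v) u w - ang (dxv cx' v) (dyv cy' v) u w) = 0.
  under eq_bigr do rewrite sumrB.
  by rewrite sumrB s1 s2 subrr.
have pos u w : tri v u w -> 0 <= ang (dxv cx v) (dyv cy v) u w - ang (dxv cx' v) (dyv cy' v) u w.
  by move=> t; rewrite subr_ge0; have [] := cmp _ _ t.
move=> /psumr_eq0P h.
have h0 : \sum_(w | tri v u0 w) (ang (dxv cx v) (dyv cy v) u0 w - ang (dxv cx' v) (dyv cy' v) u0 w) = 0.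
  by apply: h => // u _; apply: sumr_ge0 => w; exact: pos.
have [w t] := star_Nla vu0.
have /psumr_eq0P h1 := h0; have := h1 _ _ t; move/(_ (pos u0))/eqP.
rewrite subr_eq0 eq_sym => /eqP e; have [_ /(_ e) e1] := cmp _ _ t.
have rv := lt0r_neq0 (rp v); have ru := lt0r_neq0 (rp u0).
have rv' := lt0r_neq0 (rp' v); have ru' := lt0r_neq0 (rp' u0).
move: e1 => /eqP; rewrite eqr_div// => /eqP e1; apply/eqP; rewrite eqr_div//; apply/eqP.
by rewrite mulrC e1 mulrC.
Qed.

(** A maximum off the fixed face spreads over the graph without the face, up to a vertex across one
    of its sides, and from there onto the face, where the ratio is 1. *)
Lemma radius_le v : r' v <= r v.
Proof.
have rp := pc_r pc; have rp' := pc_r pc'.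
have [dis h2 hc _ _] := hF; have [oa ob ab] := dis _ _ _ t0.
pose m := [arg max_(u > o) (r' u / r u)]%O.
have mx u : r' u / r u <= r' m / r m by rewrite /m; case: arg_maxP => // i _; apply.
suff M1 : r' m / r m = 1 by have := mx v; rewrite M1 ler_pdivrMr// mul1r.
have on u : u \in f0 -> r' u / r u = r' m / r m -> r' m / r m = 1.
  by move=> uf <-; rewrite (pc_f0 pc uf) (pc_f0 pc' uf) divff// invr_eq0.
have [mf|mf] := boolP (m \in f0); first exact: (on m).
have [x xb t1] := h2 _ _ _ t0; have [_ ox ax] := dis _ _ _ t1.
have xf : x \notin f0 by rewrite f0E !inE !negb_or ![x == _]eq_sym ox ax eq_sym.
have F0 : f0 \in F by rewrite f0E.
pose X : {set V} := [set u | r' u / r u == r' m / r m]%SET.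
have mX : m \in (X :\: f0)%SET by rewrite !inE mf eqxx.
have cl u w : u \in (X :\: f0)%SET -> w \notin f0 -> adj u w -> w \in (X :\: f0)%SET.
  rewrite !inE => /andP[uf /eqP uX] wf uw; rewrite wf /=; apply/eqP.
  rewrite -uX; apply: ratio_max_propagates => //; rewrite uX; exact: mx.
have := hc f0 m _ F0 mX mf cl x xf; rewrite !inE => /andP[_ /eqP xX].
apply: (on o); first by rewrite f0E !inE eqxx.
rewrite -xX; apply: ratio_max_propagates => //; first by rewrite xX; exact: mx.
by rewrite adjC; exact: tri_adj13 hF t1.
Qed.

End MaximumPrinciple.

(** * Congruence and Moebius transformations *)

Section Congruence.
Context {R : realType} {V : finType} (F : {set {set V}}) (I : V -> V -> R).
Hypothesis hF : tight_complex F.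

Local Notation tri := (tri F).
Local Notation adj := (adj F).

Lemma plane_config_conj (f0 : {set V}) (cx cy r : V -> R) :
  plane_config F I f0 cx cy r -> plane_config F I f0 cx (fun v => - cy v) r.
Proof.
move=> [h1 h2 h3 h4 h5]; split => //.
- by move=> u v /h3 <-; ring.
- move=> v u w t ne; have := h4 v u w t ne; apply: contra => /eqP h; apply/eqP; lra.
- move=> v u w x s t tf ne vx xf s0 t0 hx hy.
  by apply: (h5 v u w x s t tf ne vx xf s0 t0 hx); lra.
Qed.

Variables (f0 : {set V}) (cx cy r cx' cy' : V -> R) (o a b : V).
Hypotheses (pc : plane_config F I f0 cx cy r) (pc' : plane_config F I f0 cx' cy' r)
  (f0E : f0 = [set o; a; b]%SET) (t0 : tri o a b).

Let cr (x y : V -> R) v u w := (x u - x v) * (y w - y v) - (y u - y v) * (x w - x v).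
Let dt (x y : V -> R) v u w := (x u - x v) * (x w - x v) + (y u - y v) * (y w - y v).
Let dd (x y : V -> R) v u := (x u - x v) ^+ 2 + (y u - y v) ^+ 2.

Let ddE v u : adj v u -> dd cx cy v u = dd cx' cy' v u.
Proof.
move=> vu; have h1 := pc_edge pc vu; have h2 := pc_edge pc' vu; rewrite /dd.
transitivity ((cx v - cx u) ^+ 2 + (cy v - cy u) ^+ 2); first by ring.
by rewrite h1 -h2; ring.
Qed.

Let dtE v u w : tri v u w -> dt cx cy v u w = dt cx' cy' v u w.
Proof.
move=> t; have h1 := ddE (tri_adj12 hF t); have h2 := ddE (tri_adj13 hF t); have h3 := ddE (tri_adj23 hF t).
transitivity ((dd cx cy v u + dd cx cy v w - dd cx cy u w) / 2); first by rewrite /dd /dt; field.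
by rewrite h1 h2 h3 /dd /dt; field.
Qed.

Let crE2 v u w : tri v u w -> cr cx cy v u w ^+ 2 = cr cx' cy' v u w ^+ 2.
Proof.
move=> t; have h1 := ddE (tri_adj12 hF t); have h2 := ddE (tri_adj13 hF t); have h3 := dtE t.
transitivity (dd cx cy v u * dd cx cy v w - dt cx cy v u w ^+ 2); first by rewrite /dd /dt /cr; ring.
by rewrite h1 h2 h3 /dd /dt /cr; ring.
Qed.

(** Otherwise the sectors of the two faces would be nested. This carries the orientation from one
    face to the next. *)
Let opposite (x y : V -> R) v u w w' : plane_config F I f0 x y r -> v \notin f0 ->
  tri v u w -> tri v u w' -> w != w' -> cr x y v u w * cr x y v u w' < 0.
Proof.
move=> pcx vf t t' ww'; rewrite ltNge; apply/negP => h.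
have i1 := star_indep pcx vf t; have i2 := star_indep pcx vf t'.
have : 0 < cr x y v u w * cr x y v u w' by rewrite lt_neqAle h andbT eq_sym mulf_neq0.
move=> h1; have := @same_side_eq R V (adj v) (fun u w => tri v u w) (dxv x v) (dyv y v)
  (@star_laC V F v) (@star_laN V F hF v) (@star_indep R V F I f0 x y r v pcx vf) (@star_sector R V F I f0 x y r v pcx vf) u w w' t t' h1.
by move=> e; rewrite e eqxx in ww'.
Qed.

Section Rotation.
Variables (p q s1 s2 : R).
Hypothesis pq : p ^+ 2 + q ^+ 2 = 1.

Definition agree v := cx' v = p * cx v - q * cy v + s1 /\ cy' v = q * cx v + p * cy v + s2.

(** A point is determined by its inner product and determinant with the edge [v u]. Edge lengths
    give the first and, up to sign, the second; the sign is opposite to that of [w] in both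
    configurations. *)
Let agree_step v u w x : v \notin f0 -> tri v u w -> tri v u x -> agree v -> agree u -> agree w -> agree x.
Proof.
move=> vf t tx [vx vy] [ux uy] [wx wy]; have [<-//|ne] := eqVneq w x.
have o1 := opposite pc vf t tx ne; have o2 := opposite pc' vf t tx ne.
have e1 := dtE tx; have e2 := crE2 tx.
have cw : cr cx' cy' v u w = cr cx cy v u w.
  rewrite /cr wx wy ux uy vx vy.
  transitivity ((p ^+ 2 + q ^+ 2) * cr cx cy v u w); first by rewrite /cr; ring.
  by rewrite pq mul1r.
have cxE : cr cx' cy' v u x = cr cx cy v u x.
  move: e2 => /eqP; rewrite eq_sym -subr_eq0 subr_sqr mulf_eq0 => /orP[/eqP h|/eqP h]; first by lra.
  have e3 : cr cx' cy' v u x = - cr cx cy v u x by lra.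
  by exfalso; move: o1 o2; rewrite cw e3; lra.
have du0 : dd cx cy v u != 0.
  apply: contra (star_indep pc vf t) => /eqP h.
  have [h1 h2] := sumsq_eq0 (eq_ind_r (fun z => z <= 0) (lexx 0) h).
  by rewrite /dxv /dyv h1 h2 !mul0r subrr.
move: e1 cxE; rewrite /dt /cr ux uy vx vy.
set X := cx' x - _; set Y := cy' x - _.
set A := cx u - cx v; set B := cy u - cy v; set A' := cx x - cx v; set B' := cy x - cy v.
have -> : p * cx u - q * cy u + s1 - (p * cx v - q * cy v + s1) = p * A - q * B by rewrite /A /B; ring.
have -> : q * cx u + p * cy u + s2 - (q * cx v + p * cy v + s2) = q * A + p * B by rewrite /A /B; ring.
move=> e1 e3.
have nE : (p * A - q * B) ^+ 2 + (q * A + p * B) ^+ 2 = dd cx cy v u.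
  transitivity ((p ^+ 2 + q ^+ 2) * dd cx cy v u); [by rewrite /dd -/A -/B; ring | by rewrite pq mul1r].
have XE : X = p * A' - q * B'.
  apply: (mulfI du0); rewrite -{1}nE.
  transitivity ((p * A - q * B) * ((p * A - q * B) * X + (q * A + p * B) * Y) - (q * A + p * B) * ((p * A - q * B) * Y - (q * A + p * B) * X)); first by ring.
  by rewrite -e1 e3 /dd -/A -/B; ring.
have YE : Y = q * A' + p * B'.
  apply: (mulfI du0); rewrite -{1}nE.
  transitivity ((q * A + p * B) * ((p * A - q * B) * X + (q * A + p * B) * Y) + (p * A - q * B) * ((p * A - q * B) * Y - (q * A + p * B) * X)); first by ring.
  by rewrite -e1 e3 /dd -/A -/B; ring.
by move: XE YE; rewrite /X /Y /A' /B'; split; lra.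
Qed.

Let agree_star v u w : v \notin f0 -> tri v u w -> agree v -> agree u -> agree w ->
  forall x, adj v x -> agree x.
Proof.
move=> vf t av au aw x vx.
pose P y := agree y /\ exists2 z, tri v y z & agree z.
have vu := tri_adj12 hF t.
have [] // : P x.
apply: (@link_connected R V (adj v) (fun u w => tri v u w) (dxv cx v) (dyv cy v)
  (@star_laC V F v) (@star_laN V F hF v) (@star_Nla V F v) (@star_la2 V F hF v)
  (@star_indep R V F I f0 cx cy r v pc vf) (@star_sector R V F I f0 cx cy r v pc vf) u vu P) => //.
- by split => //; exists w.
- move=> y z yz [ay [z' yz' az']]; split; first exact: agree_step vf yz' yz av ay az'.
  by exists y => //; rewrite tri23.
Qed.

(** [G] records a whole agreeing face at [v], since a single position does not spread. The vertices
    of the fixed face come last, as neighbours of vertices across its sides. *)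
Lemma agree_all v0 u0 w0 : v0 \notin f0 -> tri v0 u0 w0 -> agree v0 -> agree u0 -> agree w0 ->
  forall v, agree v.
Proof.
move=> vf t av au aw; have [dis h2 hc _ _] := hF.
pose G v := agree v /\ exists u w, [/\ tri v u w, agree u & agree w].
pose X : {set V} := [set v | (v \notin f0) && `[< G v >]]%SET.
have F0 : f0 \in F by rewrite f0E.
have v0X : v0 \in X by rewrite inE vf; apply/asboolP; split => //; exists u0, w0.
have cl u v : u \in X -> v \notin f0 -> adj u v -> v \in X.
  rewrite !inE => /andP[uf /asboolP[au' [x [y [txy ax ay]]]]] vf' uv; rewrite vf' /=.
  have st := agree_star uf txy au' ax ay.
  have [w tw] := star_Nla uv; apply/asboolP; split; first exact: st.
  exists u, w; split => //; first by rewrite tri12.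
  by apply: st; exact: tri_adj13 tw.
have inner v : v \notin f0 -> G v.
  by move=> /(hc f0 v0 X F0 v0X vf cl); rewrite inE => /andP[_ /asboolP].
have nb x v : x \notin f0 -> adj x v -> agree v.
  by move=> xf xv; have [ax [u [w [tx au' aw']]]] := inner _ xf; exact: agree_star xf tx ax au' aw' v xv.
have third x y z : tri x y z -> f0 = [set x; y; z]%SET -> agree x /\ agree y.
  move=> t1 fE; have [w wz t2] := h2 _ _ _ t1; have [xy xw yw] := dis _ _ _ t2.
  have wf : w \notin f0 by rewrite fE !inE !negb_or ![w == _]eq_sym xw yw eq_sym.
  split; apply: (nb w _ wf); rewrite adjC; [exact: tri_adj13 t2 | exact: tri_adj23 t2].
move=> v; have [vf'|vf'] := boolP (v \in f0); last by have [] := inner _ vf'.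
have [ao aa] := third _ _ _ t0 f0E.
have t1 : tri o b a by rewrite -tri23.
have fE1 : f0 = [set o; b; a]%SET by rewrite f0E finset.setUAC.
have [_ ab] := third _ _ _ t1 fE1.
by move: vf'; rewrite f0E !inE => /orP[/orP[]|] /eqP ->.
Qed.

End Rotation.

Lemma congruent_pos v u w : v \notin f0 -> tri v u w -> cr cx' cy' v u w = cr cx cy v u w ->
  exists p q s1 s2, p ^+ 2 + q ^+ 2 = 1 /\
    forall x, cx' x = p * cx x - q * cy x + s1 /\ cy' x = q * cx x + p * cy x + s2.
Proof.
move=> vf t cE; have vu := tri_adj12 hF t.
have du0 : dd cx cy v u != 0.
  apply: contra (star_indep pc vf t) => /eqP h.
  have [h1 h2] := sumsq_eq0 (eq_ind_r (fun z => z <= 0) (lexx 0) h).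
  by rewrite /dxv /dyv h1 h2 !mul0r subrr.
pose A := cx u - cx v; pose B := cy u - cy v; pose A' := cx' u - cx' v; pose B' := cy' u - cy' v.
(* [p + i q] is the complex quotient of the edge [v u] in the two configurations. *)
pose p := (A' * A + B' * B) / dd cx cy v u; pose q := (B' * A - A' * B) / dd cx cy v u.
pose s1 := cx' v - (p * cx v - q * cy v); pose s2 := cy' v - (q * cx v + p * cy v).
have n1 : dd cx cy v u = A ^+ 2 + B ^+ 2 by [].
have n2 : dd cx cy v u = A' ^+ 2 + B' ^+ 2 by rewrite ddE.
have pq : p ^+ 2 + q ^+ 2 = 1.
  rewrite /p /q !expr_div_n -mulrDl.
  have -> : (A' * A + B' * B) ^+ 2 + (B' * A - A' * B) ^+ 2 = dd cx cy v u ^+ 2.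
    by rewrite [in RHS]expr2 {1}n1 n2; ring.
  by rewrite divff// sqrf_eq0.
have uA : p * A - q * B = A'.
  by transitivity (A' * (A ^+ 2 + B ^+ 2) / dd cx cy v u); [rewrite /p /q; field | rewrite -n1 mulfK].
have uB : q * A + p * B = B'.
  by transitivity (B' * (A ^+ 2 + B ^+ 2) / dd cx cy v u); [rewrite /p /q; field | rewrite -n1 mulfK].
have av : agree p q s1 s2 v by rewrite /agree /s1 /s2; split; ring.
have au : agree p q s1 s2 u.
  rewrite /agree /s1 /s2; split.
    by transitivity (cx' v + A'); [rewrite /A'; ring | rewrite -uA /A /B; ring].
  by transitivity (cy' v + B'); [rewrite /B'; ring | rewrite -uB /A /B; ring].
have aw : agree p q s1 s2 w.
  have e1 := dtE t; move: e1 cE; rewrite /dt /cr -/A -/B -/A' -/B'.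
  set C := cx w - cx v; set E := cy w - cy v; set C' := cx' w - cx' v; set E' := cy' w - cy' v => e1 e2.
  have wC : C' = p * C - q * E.
    apply: (mulfI du0); rewrite {1}n2.
    transitivity (A' * (A' * C' + B' * E') - B' * (A' * E' - B' * C')); first by ring.
    rewrite -e1 e2; transitivity ((A' * A + B' * B) * C - (B' * A - A' * B) * E); first by ring.
    by rewrite /p /q; field.
  have wE : E' = q * C + p * E.
    apply: (mulfI du0); rewrite {1}n2.
    transitivity (B' * (A' * C' + B' * E') + A' * (A' * E' - B' * C')); first by ring.
    rewrite -e1 e2; transitivity ((B' * A - A' * B) * C + (A' * A + B' * B) * E); first by ring.
    by rewrite /p /q; field.
  rewrite /agree /s1 /s2; split.
    by transitivity (cx' v + C'); [rewrite /C'; ring | rewrite wC /C /E; ring].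
  by transitivity (cy' v + E'); [rewrite /E'; ring | rewrite wE /C /E; ring].
exists p, q, s1, s2; split => //; exact: agree_all pq v u w vf t av au aw.
Qed.

End Congruence.

Lemma plane_congruent {R : realType} {V : finType} (F : {set {set V}}) (I : V -> V -> R) (f0 : {set V})
    (cx cy r cx' cy' : V -> R) (o a b : V) :
  tight_complex F -> plane_config F I f0 cx cy r -> plane_config F I f0 cx' cy' r ->
  f0 = [set o; a; b]%SET -> tri F o a b ->
  exists (e : bool) p q s1 s2, p ^+ 2 + q ^+ 2 = 1 /\
    forall x, cx' x = p * cx x - q * ((-1) ^+ e * cy x) + s1 /\ cy' x = q * cx x + p * ((-1) ^+ e * cy x) + s2.
Proof.
move=> hF pc pc' f0E t0; have [dis h2 _ _ _] := hF.
have [x xb t1] := h2 _ _ _ t0; have [oa ox ax] := dis _ _ _ t1.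
have xf : x \notin f0 by rewrite f0E !inE !negb_or ![x == _]eq_sym ox ax eq_sym.
have t : tri F x o a by rewrite tri12 tri23.
have pcc := plane_config_conj pc.
have e0 := @congruent_pos _ _ _ _ hF f0 cx cy r cx' cy' o a b pc pc' f0E t0 x o a xf t.
have e1 := @congruent_pos _ _ _ _ hF f0 cx (fun v => - cy v) r cx' cy' o a b pcc pc' f0E t0 x o a xf t.
have edge u v : adj F u v -> (cx u - cx v) ^+ 2 + (cy u - cy v) ^+ 2 = (cx' u - cx' v) ^+ 2 + (cy' u - cy' v) ^+ 2.
  by move=> uv; rewrite (pc_edge pc uv) (pc_edge pc' uv).
have d1 := edge _ _ (tri_adj12 hF t); have d2 := edge _ _ (tri_adj13 hF t); have d3 := edge _ _ (tri_adj23 hF t).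
move: e0 e1; set c' := (X in X = _ -> _); set c := (X in _ = X -> _) => e0 e1.
have cc : c' ^+ 2 = c ^+ 2.
  (* Heron's formula: the squared determinant of a triangle depends only on its side lengths. *)
  have eq4 (X Y Z : R) (k : V -> R) (l : V -> R) : (k x - k o) ^+ 2 + (l x - l o) ^+ 2 = X -> (k x - k a) ^+ 2 + (l x - l a) ^+ 2 = Y ->
    (k o - k a) ^+ 2 + (l o - l a) ^+ 2 = Z ->
    ((k o - k x) * (l a - l x) - (l o - l x) * (k a - k x)) ^+ 2 = X * Y - ((X + Y - Z) / 2) ^+ 2.
    by move=> <- <- <-; field.
  by rewrite /c' /c (eq4 _ _ _ cx' cy' erefl erefl erefl) (eq4 _ _ _ cx cy erefl erefl erefl) d1 d2 d3.
move/eqP: cc; rewrite -subr_eq0 subr_sqr mulf_eq0 => /orP[/eqP h|/eqP h].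
  have [|p [q [s1 [s2 [pq pE]]]]] := e0; first by lra.
  by exists false, p, q, s1, s2; split => // y; rewrite expr0 mul1r.
have [|p [q [s1 [s2 [pq pE]]]]] := e1; first by move: h; rewrite /c'/c; lra.
by exists true, p, q, s1, s2; split => // y; rewrite expr1 mulN1r.
Qed.

Section Moebius.
Context {R : realType}.
Implicit Types (M T : riemann_sphere R -> riemann_sphere R).

Lemma moebius_comp (a b c d a' b' c' d' : R[i]) z : a' * d' - b' * c' != 0 ->
  moebius_map a b c d (moebius_map a' b' c' d' z) =
  moebius_map (a * a' + b * c') (a * b' + b * d') (c * a' + d * c') (c * b' + d * d') z.
Proof.
move=> det'.
have scale (k x y : R[i]) : k != 0 -> (if y * k == 0 then None else Some (x * k / (y * k))) = (if y == 0 then None else Some (x / y)).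
  by move=> k0; rewrite mulf_eq0 (negbTE k0) orbF; case: eqVneq => // y0; rewrite -mulf_div divff// mulr1.
case: z => [w|] /=.
  have eN : (a * a' + b * c') * w + (a * b' + b * d') = a * (a' * w + b') + b * (c' * w + d') by ring.
  have eD : (c * a' + d * c') * w + (c * b' + d * d') = c * (a' * w + b') + d * (c' * w + d') by ring.
  rewrite eN eD; case: eqVneq => [D0|D0] /=.
    have n0 : a' * w + b' != 0.
      apply: contra det' => /eqP n0; apply/eqP.
      have h1 : d' = - (c' * w) by apply/eqP; rewrite -subr_eq0 opprK addrC D0.
      have h2 : b' = - (a' * w) by apply/eqP; rewrite -subr_eq0 opprK addrC n0.
      by rewrite h1 h2; ring.
    by rewrite D0 !mulr0 !addr0 scale.
  have e1 x y : (x * ((a' * w + b') / (c' * w + d')) + y) * (c' * w + d') = x * (a' * w + b') + y * (c' * w + d') by field.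
  by rewrite -(scale (c' * w + d') (a * ((a' * w + b') / (c' * w + d')) + b)) // !e1.
case: eqVneq => [c0|c0] /=.
  have a0 : a' != 0 by apply: contra det' => /eqP ->; rewrite c0 mul0r mulr0 subrr.
  by rewrite c0 !mulr0 !addr0 scale.
have e1 x y : (x * (a' / c') + y) * c' = x * a' + y * c' by field.
by rewrite -(scale c' (a * (a' / c') + b))// !e1.
Qed.

Lemma moebius_scalar (k : R[i]) z : k != 0 -> moebius_map k 0 0 k z = z.
Proof.
move=> k0; case: z => [w|] /=; last by rewrite eqxx.
by rewrite mul0r add0r (negbTE k0) addr0 mulrC mulKf.
Qed.

Lemma is_moebius_comp M T : is_moebius M -> is_moebius T -> is_moebius (M \o T).
Proof.
move=> [a [b [c [d [h ->]]]]] [a' [b' [c' [d' [h' ->]]]]].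
exists (a * a' + b * c'), (a * b' + b * d'), (c * a' + d * c'), (c * b' + d * d'); split; last first.
  by apply/funext => z /=; exact: moebius_comp.
have -> : (a * a' + b * c') * (c * b' + d * d') - (a * b' + b * d') * (c * a' + d * c') = (a * d - b * c) * (a' * d' - b' * c') by ring.
exact: mulf_neq0.
Qed.

Lemma is_moebius_inv M : is_moebius M -> exists N, [/\ is_moebius N, cancel M N & cancel N M].
Proof.
move=> [a [b [c [d [h ->]]]]]; exists (moebius_map d (- b) (- c) a); split.
- by exists d, (- b), (- c), a; split => //; rewrite mulrNN mulrC.
- move=> z; rewrite moebius_comp// -[RHS](moebius_scalar z h); congr moebius_map; ring.
- move=> z; rewrite moebius_comp ?mulrNN ?[d * a]mulrC// -[RHS](moebius_scalar z h); congr moebius_map; ring.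
Qed.

Lemma sphere_conjK : involutive (@sphere_conj R).
Proof. by case=> [[x y]|] //=; rewrite opprK. Qed.

Lemma conj_moebius M : is_moebius M ->
  exists2 N, is_moebius N & @sphere_conj R \o M = N \o @sphere_conj R.
Proof.
move=> [a [b [c [d [h ->]]]]].
have cE (z : R[i]) : Complex (complex.Re z) (- complex.Im z) = conjc z by case: z.
exists (moebius_map (conjc a) (conjc b) (conjc c) (conjc d)).
  exists (conjc a), (conjc b), (conjc c), (conjc d); split => //.
  by rewrite -!rmorphM -rmorphB/= fmorph_eq0.
have c0 (z : R[i]) : (conjc z == 0) = (z == 0) by exact: fmorph_eq0.
apply/funext => -[w|] /=; rewrite ?cE.
  rewrite -!rmorphM -!rmorphD c0; case: eqP => //= _; rewrite cE.
  by rewrite fmorph_div.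
rewrite c0; case: eqP => //= _; rewrite cE.
by rewrite fmorph_div.
Qed.

Lemma is_moebius_isometry (p q s1 s2 : R) : p ^+ 2 + q ^+ 2 = 1 ->
  is_moebius (fun z : riemann_sphere R => omap (fun w => Complex p q * w + Complex s1 s2) z).
Proof.
move=> pq; exists (Complex p q), (Complex s1 s2), 0, 1; split.
  rewrite mulr1 mulr0 subr0; apply/eqP => -[p0 q0]; move: pq; rewrite p0 q0 expr0n addr0 => /eqP.
  by rewrite eq_sym oner_eq0.
by apply/funext => -[w|] /=; rewrite ?eqxx// mul0r add0r oner_eq0 divr1.
Qed.

End Moebius.

Lemma tri_gamma {R : realType} {V : finType} (F : {set {set V}}) (n : V -> @form R) u v w :
  tight_complex F -> thin_config F n -> tri F u v w -> 0 < e (n u) (n w) + e (n u) (n v) * e (n v) (n w).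
Proof. by move=> hF hn t; exact/thin3_gamma/(tri_thin3 hF hn t). Qed.

Theorem mainTheorem2 (R : realType) (V : finType) (F : {set {set V}})
    (Theta : {set V} -> R) (D D' : V -> disk R) :
  sphere_triangulation R F ->
  (forall e, e \in skeleton_edges F -> 0 <= Theta e < pi) ->
  disk_configuration D -> thin D -> realizes (skeleton_edges F) Theta D ->
  disk_configuration D' -> thin D' -> realizes (skeleton_edges F) Theta D' ->
  exists T : riemann_sphere R -> riemann_sphere R,
    (is_moebius T \/ is_anti_moebius T) /\
    forall v, T @` disk_set (D v) = disk_set (D' v).
Proof.
move=> hS hT hD ht hR hD' ht' hR'.
have hF := tight_of_sphere hS; have [_ _ _ [va [vb [vc t0]]] _] := hF.
pose I u v := e (disk_form (D u)) (disk_form (D v)).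
have hn := disks_thin_config hS hT hD ht hR; have hn' := disks_thin_config hS hT hD' ht' hR'.
have [A [B [C [E [cx [cy [r [det pc hz]]]]]]]] := disks_normal_form hS hT hD ht hR t0.
have [A' [B' [C' [E' [cx' [cy' [r' [det' pc0' hz']]]]]]]] := disks_normal_form hS hT hD' ht' hR' t0.
(* Both families of products are the cosines of the same [Theta], so the two configurations share
   [I]. *)
have pc' : plane_config F I [set va; vb; vc]%SET cx' cy' r'.
  case: pc0' => h1 h2 h3 h4 h5; split => // u v uv; rewrite h3//.
  by rewrite /I (edge_overlap hS hT hD hR uv).2 (edge_overlap hS hT hD' hR' uv).2.
have IC u v : I u v = I v u by exact: eC.
have hI u v : adj F u v -> -1 < I u v <= 1 by move=> /(edge_overlap hS hT hD hR)[[]].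
have hg u v w : tri F u v w -> 0 < I u w + I u v * I v w by exact: tri_gamma hF hn.
have rE : r' = r.
  apply/funext => v; apply/eqP; rewrite eq_le.
  by rewrite (radius_le hF IC hI hg pc pc' erefl t0) (radius_le hF IC hI hg pc' pc erefl t0).
rewrite {}rE in pc' hz'.
have [eps [p [q [s1 [s2 [pq cE]]]]]] := plane_congruent hF pc pc' erefl t0.
pose M := moebius_map A B C E; pose M' := moebius_map A' B' C' E'.
have mM : is_moebius M by exists A, B, C, E.
have mM' : is_moebius M' by exists A', B', C', E'.
have mS := is_moebius_isometry s1 s2 pq.
set S := (fun z : riemann_sphere R => _) in mS.
have [N [mN MN NM]] := is_moebius_inv mM; have [N' [mN' MN' NM']] := is_moebius_inv mM'.
have [S' [mS' SS' SS]] := is_moebius_inv mS.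
pose cj (z : riemann_sphere R) := if eps then sphere_conj z else z.
have cjK : involutive cj by rewrite /cj; case: (eps) => z //; exact: sphere_conjK.
exists (N' \o S \o cj \o M); split.
  rewrite /cj; case: (eps).
    (* The conjugation is moved to the innermost place, where [is_anti_moebius] has it. *)
    right; have [K mK KE] := conj_moebius mM.
    exists (N' \o S \o K); first by apply: is_moebius_comp => //; exact: is_moebius_comp.
    by apply/funext => z; have := congr1 (fun f => f z) KE => /= ->.
  by left; apply: is_moebius_comp => //; exact: (is_moebius_comp mN' mS).
have key v z : disk_set (D v) z <-> disk_set (D' v) ((N' \o S \o cj \o M) z).
  rewrite hz hz' -/M -/M' /= NM'; have [-> ->] := cE v.
  have norm (x y x0 y0 : R) : (p * x - q * y + s1 - (p * x0 - q * y0 + s1)) ^+ 2 +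
      (q * x + p * y + s2 - (q * x0 + p * y0 + s2)) ^+ 2 = (x - x0) ^+ 2 + (y - y0) ^+ 2.
    transitivity ((p ^+ 2 + q ^+ 2) * ((x - x0) ^+ 2 + (y - y0) ^+ 2)); first by ring.
    by rewrite pq mul1r.
  case: (M z) => [[x y]|]; last by rewrite /cj /S; case: (eps); split => -[? []].
  have -> : S (cj (Some (Complex x y))) = Some (Complex (p * x - q * ((-1) ^+ eps * y) + s1) (q * x + p * ((-1) ^+ eps * y) + s2)).
    rewrite /S /cj; case: (eps) => /=; congr Some; apply/eqP; rewrite eq_complex /= ?expr0 ?expr1 ?mulN1r ?mul1r.
      by apply/andP; split; apply/eqP; ring.
    by apply/andP; split; apply/eqP; ring.
  have sq : ((-1) ^+ eps * y - (-1) ^+ eps * cy v) ^+ 2 = (y - cy v) ^+ 2.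
    by rewrite -mulrBr exprMn sqrr_sign mul1r.
  split=> -[w [<-]] /= h.
    by eexists; [reflexivity | rewrite /= norm sq].
  by exists (Complex x y) => //=; rewrite -sq -(norm x ((-1) ^+ eps * y)).
move=> v; apply/seteqP; split => [_ [z zD <-]|y yD]; first exact/key.
have yE : (N' \o S \o cj \o M) (N (cj (S' (M' y)))) = y by rewrite /= NM cjK SS MN'.
by exists (N (cj (S' (M' y)))) => //; apply/key; rewrite yE.
Qed.
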